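(* Let $G$ be a finite group such that $|\mathrm{cod}(G|G')|>1$ and any two distinct elements of $\mathrm{cod}(G|G')$ are coprime. Then one of the following holds: \begin{itemize} \item $G$ is a Frobenius group and $G\cong C_p^k\rtimes Q_8$ for some prime $p$ and some integer $k$; \item $G$ is a $2$-Frobenius group, and whenever $1<K<H<G$ is a normal series such that $G/K=H/K\rtimes R$ and $H=K\rtimes J$ are Frobenius groups with Frobenius kernels $H/K$ and $K$ and with Frobenius complements $R\le G/K$ and $J\le H$, respectively, the following hold: \begin{enumerate} \item $R$ is cyclic; \item $J\cong C_p$ for some prime $p$; \item $K$ is the unique minimal normal subgroup of $G$; \item there is a subgroup $R_0\le R$ with $\pi(R_0)=\pi(R)$ such that $C_G(x)/K\cong R_0$ for every $1\neq x\in K$. \end{enumerate} \end{itemize}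
   Context: $\mathrm{Irr}(G)$ is the set of irreducible complex characters of the finite group $G$, and $G'$ is the derived subgroup. The codegree of $\chi\in\mathrm{Irr}(G)$ is $\mathrm{cod}(\chi)=|G:\ker\chi|/\chi(1)$. For $N\trianglelefteq G$, $\mathrm{Irr}(G|N)$ is the set of $\chi\in\mathrm{Irr}(G)$ whose kernel does not contain $N$, and $\mathrm{cod}(G|N)=\{\mathrm{cod}(\chi)\mid\chi\in\mathrm{Irr}(G|N)\}$. In particular $\mathrm{Irr}(G|G')$ is the set of non-linear irreducible characters of $G$. $\pi(X)$ is the set of prime divisors of $|X|$. $C_p$ is the cyclic group of order $p$, $C_p^k$ the direct product of $k$ copies of it, and $Q_8$ the quaternion group of order $8$. $G$ is a $2$-Frobenius group if it has a normal series $1<K<H<G$ such that $G/K$ is a Frobenius group with Frobenius kernel $H/K$, and $H$ is a Frobenius group with Frobenius kernel $K$. *)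

(* Defs.v *)
From mathcomp Require Import all_boot all_order all_algebra.
From mathcomp Require Import all_fingroup all_solvable all_field all_character.

Set Implicit Arguments.
Unset Strict Implicit.
Unset Printing Implicit Defensive.

Import GRing.Theory Num.Theory.
Local Open Scope group_scope.

(* The codegree |G : ker chi| / chi(1) is a natural number, so the truncation
   from algC to nat loses nothing: see [codE]. *)
Definition cod (gT : finGroupType) (G : {group gT}) (i : Iirr G) : nat :=
  Num.truncn (#|G : cfker 'chi_i|%g%:R / 'chi_i 1%g : algC)%R.

Lemma codE (gT : finGroupType) (G : {group gT}) (i : Iirr G) :
  ((cod i)%:R = #|G : cfker 'chi_i|%g%:R / 'chi_i 1%g :> algC)%R.
Proof.
have nker := cfker_normal ('chi_i)%R.
rewrite /cod truncnK // -card_quotient; last exact: normal_norm nker.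
have [n ->] : {n : nat | (#|G / cfker 'chi_i|%g%:R = n%:R * 'chi_i 1%g :> algC)%R}.
  apply: dvdCP_nat; [exact: char1_ge0 (irr_char _) | exact: ler0n |].
  have := dvd_irr1_cardG (quo_Iirr (cfker ('chi_i)%R) i).
  by rewrite quo_IirrE // cfQuo1.
by rewrite mulfK ?irr1_neq0 // natr_nat.
Qed.

(* Irr(G|N), as a set of indices of irreducible characters. *)
Definition Irr_over (gT : finGroupType) (G : {group gT}) (N : {set gT}) :
    {set Iirr G} :=
  [set i | ~~ (N \subset cfker ('chi_i)%R)].

(* cod(G|N), as a duplicate-free sequence. *)
Definition cod_set (gT : finGroupType) (G : {group gT}) (N : {set gT}) :
    seq nat :=
  undup [seq cod i | i in Irr_over G N].

Definition two_Frobenius_series (gT : finGroupType) (G H K : {group gT}) :=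
  [/\ [/\ [1 gT] \proper K, K \proper H & H \proper G],
      K <| G, H <| G,
      [Frobenius G / K with kernel H / K] & [Frobenius H with kernel K]].

Definition two_Frobenius (gT : finGroupType) (G : {group gT}) :=
  exists H K : {group gT}, two_Frobenius_series G H K.

(* [minnormal] does not require its first argument to be contained in the
   second. *)
Definition min_normal_subgroup (gT : finGroupType) (M G : {group gT}) : bool :=
  (M \subset G) && minnormal M G.

(* Main.v *)
Require Import Defs.
From mathcomp Require Import all_boot all_order all_algebra.
From mathcomp Require Import all_fingroup all_solvable all_field all_character.
From mathcomp Require Import zify.

(** The degree of an irreducible character with kernel [D] times its codegree is
    [#|G : D|]. Three facts about codegrees drive the proof. By Ito's theorem, a
    normal subgroup [A] that is abelian modulo [D] gives the divisor
    [#|A : A :&: D|] of the codegree ([dvd_index_cod]); hence two primes dividing the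
    order of an abelian normal section divide a common codegree
    ([exists_cod_dvd2]). The square of the codegree is at least [#|G : D|], so that
    coprime codegrees cannot belong to characters with the same kernel
    ([cod_eq_ker]). Finally, a common divisor of the degrees of the characters
    nontrivial on a normal subgroup [K] divides the degree of each character induced
    from a subgroup and nontrivial on [K] ([dvd_deg_Ind]).

    The group is solvable ([coprime_cods_solvable]): otherwise some quotient has a
    perfect minimal normal subgroup [K] contained in all others; the characters
    nontrivial on [K] are faithful, hence have the same degree, but for a prime [p]
    dividing it, coprime extension of characters produces a degree prime to [p].
    All nonlinear characters of [G / G^`(2)] have the same codegree [a], a power of a
    prime [p] ([metabelian_cod]).

    Suppose that no proper quotient of [G] has a nonlinear character of codegree
    other than [a]. Then [G] has a unique minimal normal subgroup [K], on which the
    elements of order [p] act without fixed points; so the Sylow [p]-subgroups have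
    rank 1, and [G / K], whose codegrees are all [a], is the quaternion group of
    order 8 or has a self-centralizing normal subgroup [H / K] of order [p]
    ([single_cod_structure], [minimal_two_cods]). These are the structures [typeI]
    and [typeII].

    In a group of [typeII] the codegree of a character nontrivial on [K] is the order
    of the inertia group of a constituent of its restriction to [K], so that all
    these inertia groups have the same order [c]. Brauer's permutation lemma turns
    this into [#|'C_G[x]| = c] for all nontrivial [x] in [K]
    ([typeII_cent_card]). A Frobenius group acting on [K] whose kernel has no fixed
    points has a complement with fixed points ([Frobenius_compl_cent]), so that each
    prime divisor of [#|G : H|] divides [c %/ #|K|].

    The general case is by induction: [G / M] has one of the two structures for some
    minimal normal subgroup [M]. Comparing codegrees shows that [M] is a [p']-group on
    which the elements of order [p] act without fixed points, and that it belongs to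
    the same prime as the minimal normal subgroup [N / M] of [G / M]. In the
    quaternion case [N] is elementary abelian and [G] has the same structure
    ([typeI_lift]). In the other case, either the characters nontrivial on [M] are
    faithful, and the counting formula [typeII_count] makes the degrees of the
    characters of [N] too large, or [N = M * W] with [W] normal in [G], and the inertia
    groups of the characters of [M] and of [W] coincide, which makes them normal and
    too small ([typeII_lift_false]).

    At last, a group of [typeII] has only one series as in the definition of a
    2-Frobenius group ([typeII_series_unique]). *)

Set Implicit Arguments.
Unset Strict Implicit.
Unset Printing Implicit Defensive.

Import Order.TTheory GRing.Theory Num.Theory.
Local Open Scope ring_scope.
Local Open Scope nat_scope.
Local Open Scope group_scope.

(** * Degrees, codegrees and abelian normal sections *)

Section Degree.

Variables (gT : finGroupType) (G : {group gT}).
Implicit Types (i j : Iirr G) (A B K S N : {group gT}).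

Definition deg i : nat := Num.truncn ('chi_i 1%g : algC)%R.

Lemma degE i : ('chi_i 1%g = (deg i)%:R)%R.
Proof. by rewrite /deg truncnK ?Cnat_irr1. Qed.

Lemma deg_gt0 i : 0 < deg i.
Proof. by rewrite -(ltr0n algC) -degE irr1_gt0. Qed.

Lemma cod_deg i : (cod i * deg i)%N = #|G : cfker 'chi_i|.
Proof.
apply/eqP; rewrite -(eqr_nat algC) natrM codE -degE divfK //.
exact: irr1_neq0.
Qed.

Lemma cod_gt0 i : 0 < cod i.
Proof.
have: 0 < #|G : cfker 'chi_i| by rewrite indexg_gt0.
by rewrite -cod_deg muln_gt0 => /andP[].
Qed.

Lemma deg_nonlinear i : (G^`(1) \subset cfker 'chi_i) = (deg i == 1%N).
Proof.
by rewrite -lin_irr_der1 qualifE/= irr_char degE pnatr_eq1.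
Qed.

Lemma sqr_deg_le_center i : (deg i ^ 2)%N <= #|G : 'Z('chi_i)%CF|.
Proof.
by rewrite -(ler_nat algC) natrX -degE (leif_le (irr1_bound i)).
Qed.

Lemma dvd_deg_index_center i : deg i %| #|G : 'Z('chi_i)%CF|.
Proof. by have := dvd_irr1_index_center i; rewrite degE dvdC_nat. Qed.

Lemma sqr_deg_le i : (deg i ^ 2)%N <= #|G : cfker 'chi_i|.
Proof.
apply: leq_trans (sqr_deg_le_center i) _.
apply: dvdn_leq (indexgS _ _); first exact: indexg_gt0.
exact: normal_sub (cfker_center_normal _).
Qed.

Lemma index_le_sqr_cod i : #|G : cfker 'chi_i| <= (cod i ^ 2)%N.
Proof.
rewrite -(leq_pmul2r (_ : 0 < (deg i ^ 2)%N)) ?expn_gt0 ?deg_gt0 //.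
by rewrite -expnMn cod_deg -mulnn leq_mul2l sqr_deg_le orbT.
Qed.

Lemma sum_sqr_deg : (\sum_i deg i ^ 2)%N = #|G|.
Proof.
apply/eqP; rewrite -(eqr_nat algC) -irr_sum_square natr_sum.
by apply/eqP/eq_bigr => i _; rewrite natrX degE.
Qed.

End Degree.

Section NormalSection.

Variables (gT : finGroupType) (G : {group gT}).
Implicit Types (i : Iirr G) (A B N : {group gT}).

Lemma Clifford_correspondent A i (t : Iirr A) :
    A <| G -> t \in irr_constt ('Res[A] 'chi_i) ->
  exists s : Iirr 'I_G['chi_t],
    [/\ t \in irr_constt ('Res[A] 'chi_s), 'chi_i = 'Ind[G] 'chi_s
      & deg i = (#|G : 'I_G['chi_t]| * deg s)%N].
Proof.
move=> nsAG iAt; have sAG := normal_sub nsAG.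
have [irrT _ defB _ _] := constt_Inertia_bijection t nsAG.
have /imsetP[s As def_i] : i \in Ind_Iirr G @: irr_constt ('Ind['I_G['chi_t]] 'chi_t).
  by rewrite defB constt_Ind_Res.
have chi_i : 'chi_i = 'Ind 'chi_s by rewrite def_i cfIirrE ?irrT.
exists s; split=> //; first by rewrite -constt_Ind_Res.
apply/eqP; rewrite -(eqr_nat algC) -degE chi_i cfInd1 ?Inertia_sub //.
by rewrite natrM degE.
Qed.

(** This is Ito's theorem, that the degree of an irreducible character divides the
    index of each abelian normal subgroup, applied in [G / cfker 'chi_i]. It is
    the source of all prime divisors of codegrees below. *)
Lemma dvd_index_cod A i :
  A <| G -> A^`(1) \subset cfker 'chi_i -> #|A : A :&: cfker 'chi_i| %| cod i.
Proof.
move=> nsAG A'K; have [sAG nAG] := andP nsAG; set D := cfker 'chi_i.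
have nsDG : D <| G := cfker_normal _; have [sDG nDG] := andP nsDG.
have [t iAt] := constt_cfRes_irr A i.
have [s [As chi_i dgi]] := Clifford_correspondent nsAG iAt.
have kerAt : A :&: D \subset cfker 'chi_t.
  rewrite -cfker_Res ?irr_char //.
  by apply: cfker_constt => //; rewrite cfRes_char ?irr_char.
have lin_t : 'chi_t \is a linear_char.
  rewrite lin_irr_der1 (subset_trans _ kerAt) // subsetI A'K der_sub //.
have sT : 'I_G['chi_t] \subset G := Inertia_sub _ _.
have sAT : A \subset 'I_G['chi_t] by rewrite sub_Inertia.
have nsAT : A <| 'I_G['chi_t] := normal_Inertia _ sAG.
(* [A] acts by scalars in a representation affording [s], as [t] is linear and invariant *)
have ResA : 'Res[A] 'chi_s = ('chi_s 1%g *: 'chi_t)%R.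
  have := Clifford_Res_sum_cfclass nsAT As.
  rewrite cfclass_inertia big_seq1 => eqA; rewrite {1}eqA; congr (_ *: _)%R.
  have := congr1 (fun f : 'CF(A) => f 1%g) eqA.
  by rewrite cfRes1 !cfunE (lin_char1 lin_t) mulr1.
have sDs : D \subset cfker 'chi_s.
  by rewrite /D chi_i cfker_Ind_irr // gcore_sub.
have sDT : D \subset 'I_G['chi_t] by exact: subset_trans sDs (cfker_sub _).
have sAZ : A \subset 'Z('chi_s)%CF.
  apply/subsetP=> x Ax; rewrite irr_cfcenterE ?(subsetP sAT) //.
  rewrite -(cfResE 'chi_s sAT Ax) ResA cfunE normrM (normC_lin_char lin_t Ax) mulr1.
  by rewrite ger0_norm // char1_ge0 ?irr_char.
have sDZ : D \subset 'Z('chi_s)%CF.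
  by apply: subset_trans sDs (normal_sub (cfker_center_normal _)).
have sDA_Z : D <*> A \subset 'Z('chi_s)%CF by rewrite join_subG sDZ.
have dv1 : deg i %| #|G : D <*> A|.
  rewrite dgi; have sZT := cfcenter_sub 'chi_s.
  rewrite -(Lagrange_index sT (subset_trans sDA_Z sZT)) dvdn_mul //.
  apply: dvdn_trans (_ : #|'I_G['chi_t] : 'Z('chi_s)%CF| %| _); last first.
    by rewrite -(Lagrange_index sZT sDA_Z) dvdn_mulr.
  exact: dvd_deg_index_center.
have sDDA : D \subset D <*> A := joing_subl _ _.
have sDAG : D <*> A \subset G by rewrite join_subG sDG.
have := cod_deg i; rewrite -/D -(Lagrange_index sDAG sDDA) => eqc.
have -> : #|A : A :&: D| = #|D <*> A : D|.
  rewrite indexgI norm_joinEr ?(subset_trans sAG) //.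
  by rewrite -indexMg.
case/dvdnP: dv1 => k def_k; move: eqc; rewrite def_k mulnAC => /eqP.
by rewrite eqn_pmul2r ?deg_gt0 // => /eqP->; rewrite dvdn_mull.
Qed.

End NormalSection.

(** * Characters lying over normal subgroups *)

Section Separation.

Variables (gT : finGroupType).
Implicit Types (G A B K S N : {group gT}).

Lemma exists_irr_sep G N (A : {set gT}) :
    N <| G -> ~~ (A \subset N) ->
  exists i : Iirr G, (N \subset cfker 'chi_i) && ~~ (A \subset cfker 'chi_i).
Proof.
move=> nsNG nsAN; apply/existsP; apply: contraNT nsAN => /existsPn noi.
rewrite -(cap_cfker_normal nsNG); apply/bigcapsP => i Ni.
by have := noi i; rewrite Ni /= negbK.
Qed.

Lemma exists_irr_nontrivial G (A : {set gT}) :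
    ~~ (A \subset [1]) -> exists i : Iirr G, ~~ (A \subset cfker 'chi_i).
Proof.
by move=> ntA; have [i /andP[_ Ai]] := exists_irr_sep (normal1 G) ntA; exists i.
Qed.

Lemma constt_Ind_ker G S K (t : Iirr S) (i : Iirr G) :
    K \subset S -> S \subset G -> i \in irr_constt ('Ind[G] 'chi_t) ->
  ~~ (K \subset cfker 'chi_t) -> ~~ (K \subset cfker 'chi_i).
Proof.
move=> sKS sSG ti; apply: contra => sKi.
rewrite constt_Ind_Res in ti; apply: subset_trans (cfker_constt _ ti).
  by rewrite cfker_Res ?irr_char // subsetI sKS.
by rewrite cfRes_char ?irr_char.
Qed.

Lemma constt_Ind_normal_ker G A N (t : Iirr A) (i : Iirr G) :
    N <| G -> A \subset G -> i \in irr_constt ('Ind[G] 'chi_t) ->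
  N \subset cfker 'chi_t -> N \subset cfker 'chi_i.
Proof.
move=> nsNG sAG ti sNt; apply: subset_trans (cfker_constt _ ti); last first.
  by rewrite cfInd_char ?irr_char.
rewrite cfker_Ind_irr //; apply/bigcapsP=> x Gx.
by rewrite -(normsP (normal_norm nsNG) x Gx) conjSg.
Qed.

(** Every constituent of the induced character is nontrivial on [K]. Choosing [S]
    small bounds the common divisors of the degrees in [Irr(G|K)]. *)
Lemma dvd_deg_Ind G S K d (t : Iirr S) :
    K \subset S -> S \subset G -> ~~ (K \subset cfker 'chi_t) ->
    (forall i : Iirr G, ~~ (K \subset cfker 'chi_i) -> d %| deg i) ->
  d %| (#|G : S| * deg t)%N.
Proof.
move=> sKS sSG Kt dvd_d.
have eqd : ((#|G : S| * deg t)%N%:R = 'Ind[G] 'chi_t 1%g :> algC)%R.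
  by rewrite cfInd1 // natrM -degE.
have Ind_char : 'Ind[G] 'chi_t \is a character by rewrite cfInd_char ?irr_char.
pose c (i : Iirr G) := Num.truncn '['Ind[G] 'chi_t, 'chi_i]%R.
have cE i : '['Ind[G] 'chi_t, 'chi_i]%R = (c i)%:R%R.
  by rewrite /c truncnK // Cnat_cfdot_char_irr.
suffices -> : (#|G : S| * deg t)%N =
   (\sum_(i in irr_constt ('Ind[G] 'chi_t)) c i * deg i)%N.
  apply: dvdn_sum => i ti; rewrite dvdn_mull // dvd_d //.
  exact: constt_Ind_ker ti Kt.
apply/eqP; rewrite -(eqr_nat algC) eqd natr_sum {1}(cfun_sum_constt ('Ind 'chi_t)).
by rewrite sum_cfunE; apply/eqP/eq_bigr => i _; rewrite cfunE natrM cE degE.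
Qed.

Lemma exists_lin_nontrivial S K :
    ~~ (K \subset S^`(1)) ->
  exists2 t : Iirr S, deg t = 1%N & ~~ (K \subset cfker 'chi_t).
Proof.
move=> nsK; have [i /andP[S'i Ki]] := exists_irr_sep (der_normal 1 S) nsK.
by exists i => //; apply/eqP; rewrite -deg_nonlinear.
Qed.

Lemma dvd_deg_index G S K d :
    K \subset S -> S \subset G -> ~~ (K \subset S^`(1)) ->
    (forall i : Iirr G, ~~ (K \subset cfker 'chi_i) -> d %| deg i) ->
  d %| #|G : S|.
Proof.
move=> sKS sSG /exists_lin_nontrivial[t dt Kt] /(dvd_deg_Ind sKS sSG Kt).
by rewrite dt muln1.
Qed.

Lemma sub_pcore_index (p : nat) G N S :
    N <| G -> p.-group S -> S \subset G -> ~~ (p %| #|G : N|) -> prime p ->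
  S \subset N.
Proof.
move=> nsNG pS sSG p'N p_pr; have [sNG nNG] := andP nsNG.
have nNS := subset_trans sSG nNG.
rewrite -quotient_sub1 // subG1 trivg_card1; apply/eqP.
apply: (@pnat_1 p); first exact: quotient_pgroup.
rewrite p'natE //; apply: contra p'N => /dvdn_trans-> //.
by rewrite -card_quotient // cardSg ?quotientS.
Qed.

End Separation.

Section OverSection.

Variables (gT : finGroupType).
Implicit Types (G A B K S N : {group gT}).

Lemma cod_mod G N (i : Iirr (G / N)) : N <| G -> cod (mod_Iirr i) = cod i.
Proof.
move=> nsNG; apply/eqP; rewrite -(eqr_nat algC) !codE mod_IirrE // cfMod1.
set D := cfker ('chi_i %% N)%CF.
have sND : N \subset D by exact: cfker_mod.
have -> : cfker 'chi_i = (D / N)%g by rewrite quotient_cfker_mod.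
have sDG : D \subset G := cfker_sub _.
by rewrite index_quotient_eq ?normal_norm // (subset_trans (subsetIr _ _)).
Qed.

Lemma deg_mod G N (i : Iirr (G / N)) : N <| G -> deg (mod_Iirr i) = deg i.
Proof. by move=> nsNG; rewrite /deg mod_IirrE // cfMod1. Qed.

Lemma mod_Iirr_quo G N (i : Iirr G) :
  N <| G -> N \subset cfker 'chi_i -> exists j : Iirr (G / N), i = mod_Iirr j.
Proof. by move=> nsNG sNi; exists (quo_Iirr N i); rewrite quo_IirrK. Qed.

Lemma sub_ker_mod G N A (i : Iirr (G / N)) :
    N <| G -> A \subset G ->
  (A \subset cfker 'chi_(mod_Iirr i)) = (A / N \subset cfker 'chi_i).
Proof.
move=> nsNG sAG; rewrite mod_IirrE // sub_cfker_mod //.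
exact: subset_trans sAG (normal_norm nsNG).
Qed.

Lemma nonlinear_mod G N (i : Iirr (G / N)) :
    N <| G ->
  ((G / N)^`(1) \subset cfker 'chi_i) = (G^`(1) \subset cfker 'chi_(mod_Iirr i)).
Proof. by move=> nsNG; rewrite !deg_nonlinear deg_mod. Qed.

(** If neither a character nontrivial on [S] nor one nontrivial on [T] is
    nontrivial on both, their product is. *)
Lemma exists_irr_nontrivial2 A (S T : {group gT}) :
    abelian A -> S \subset A -> T \subset A -> S :!=: 1 -> T :!=: 1 ->
  exists i : Iirr A, ~~ (S \subset cfker 'chi_i) && ~~ (T \subset cfker 'chi_i).
Proof.
move=> cAA sSA sTA ntS ntT.
have [|i Si] := @exists_irr_nontrivial _ A S; first by rewrite subG1.
have [|j Tj] := @exists_irr_nontrivial _ A T; first by rewrite subG1.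
case Ti: (T \subset cfker 'chi_i); last by exists i; rewrite Si Ti.
case Sj: (S \subset cfker 'chi_j); last by exists j; rewrite Sj Tj.
have lin k : 'chi[A]_k \is a linear_char by apply/char_abelianP.
have /irrP[k def_k] := mul_lin_irr (lin i) (mem_irr j).
exists k; rewrite -def_k; apply/andP; split.
- apply: contra Si => /subsetP sS; apply/subsetP => x Sx.
  have := cfker1 (sS x Sx); rewrite !cfunE (cfker1 (subsetP Sj x Sx)).
  rewrite !lin_char1 ?mulr1 // => eqx.
  by rewrite cfkerEirr inE lin_char1 // eqx.
- apply: contra Tj => /subsetP sT; apply/subsetP => x Tx.
  have := cfker1 (sT x Tx); rewrite !cfunE (cfker1 (subsetP Ti x Tx)).
  rewrite !lin_char1 ?mul1r // => eqx.
  by rewrite cfkerEirr inE lin_char1 // eqx.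
Qed.

Lemma dvd_index_ker A (p : nat) (i : Iirr A) :
    prime p -> abelian A -> ~~ ('O_p(A) \subset cfker 'chi_i) ->
  p %| #|A : cfker 'chi_i|.
Proof.
move=> p_pr cAA; apply: contraR => p'i.
by apply: sub_pcore_index p'i p_pr; rewrite ?cfker_normal ?pcore_pgroup ?pcore_sub.
Qed.

Lemma exists_irr_two_primes_abelian A t u :
    abelian A -> prime t -> prime u -> t %| #|A| -> u %| #|A| ->
  exists2 i : Iirr A, t %| #|A : cfker 'chi_i| & u %| #|A : cfker 'chi_i|.
Proof.
move=> cAA t_pr u_pr tA uA.
have ntO q : prime q -> q %| #|A| -> 'O_q(A) != 1.
  move=> q_pr qA; have [x Ax ox] := Cauchy q_pr qA.
  have sxO : <[x]> \subset 'O_q(A).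
    apply: pcore_max; first by rewrite /pgroup [#|_|]ox pnat_id.
    by rewrite -sub_abelian_normal // cycle_subG.
  apply: contraTneq sxO => ->; rewrite subG1 cycle_eq1 -order_eq1 ox.
  by case: (q) q_pr => [|[]].
have [i /andP[Si Ti]] := exists_irr_nontrivial2 cAA (pcore_sub t A)
  (pcore_sub u A) (ntO t t_pr tA) (ntO u u_pr uA).
by exists i; apply: dvd_index_ker.
Qed.

End OverSection.

(** Two primes dividing the order of an abelian normal section divide a common
    codegree: by [dvd_index_cod], take a character over a linear character of the
    section whose kernel has index divisible by both. *)
Lemma exists_cod_dvd2 (gT : finGroupType) (G A B : {group gT}) t u :
    A <| G -> B <| G -> B \subset A -> A^`(1) \subset B ->
    prime t -> prime u -> t %| #|A : B| -> u %| #|A : B| ->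
  exists i : Iirr G, [/\ B \subset cfker 'chi_i,
    t %| #|A : A :&: cfker 'chi_i|, u %| #|A : A :&: cfker 'chi_i|,
    t %| cod i & u %| cod i].
Proof.
move=> nsAG nsBG sBA A'B t_pr u_pr tAB uAB; have sAG := normal_sub nsAG.
have nsBA : B <| A := normalS sBA sAG nsBG.
have cAB : abelian (A / B) by rewrite sub_der1_abelian.
have iAB : #|A / B| = #|A : B| by rewrite card_quotient ?normal_norm.
rewrite -iAB in tAB uAB.
have [k tk uk] := exists_irr_two_primes_abelian cAB t_pr u_pr tAB uAB.
set l := mod_Iirr k.
have lin_l : deg l = 1%N.
  by apply/eqP; rewrite -deg_nonlinear -nonlinear_mod // (derG1P cAB) sub1G.
have lkA : cfker 'chi_l \subset A := cfker_sub _.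
have idx : #|A : cfker 'chi_l| = #|A / B : cfker 'chi_k|.
  rewrite -[LHS]cod_deg lin_l muln1 cod_mod // -[RHS]cod_deg.
  by rewrite -(deg_mod k nsBA) lin_l muln1.
have sBl : B \subset cfker 'chi_l by rewrite mod_IirrE // cfker_mod.
have [i li] := constt_cfInd_irr l sAG.
have sBi : B \subset cfker 'chi_i by apply: constt_Ind_normal_ker li sBl.
have sAi : A :&: cfker 'chi_i \subset cfker 'chi_l.
  rewrite constt_Ind_Res in li; rewrite -cfker_Res ?irr_char //.
  by apply: cfker_constt => //; rewrite cfRes_char ?irr_char.
have dvd_idx q : q %| #|A / B : cfker 'chi_k| -> q %| #|A : A :&: cfker 'chi_i|.
  by rewrite -idx => /dvdn_trans; apply; apply: indexgS.
have dvd_cod q : q %| #|A / B : cfker 'chi_k| -> q %| cod i.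
  move/dvd_idx/dvdn_trans; apply.
  exact: dvd_index_cod nsAG (subset_trans A'B sBi).
by exists i; rewrite !dvd_idx ?dvd_cod.
Qed.

Lemma nontrivial_of_dvd (gT : finGroupType) (A D : {group gT}) q :
  prime q -> q %| #|A : A :&: D| -> ~~ (A \subset D).
Proof.
move=> q_pr; apply: contraL => /setIidPl->; rewrite indexgg dvdn1.
by case: (q) q_pr => [|[]].
Qed.

Lemma exists_prime_cod (gT : finGroupType) (G A B : {group gT}) (i : Iirr G) :
    A <| G -> B \subset A -> A^`(1) \subset cfker 'chi_i ->
    B \subset cfker 'chi_i -> ~~ (A \subset cfker 'chi_i) ->
  exists q, [/\ prime q, q %| #|A : B| & q %| cod i].
Proof.
move=> nsAG sBA A'i Bi Ai; have := dvd_index_cod nsAG A'i.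
set n := #|_ : _| => dvd_n.
have n1 : 1 < n by rewrite indexg_gt1 subsetI subxx.
exists (pdiv n); split; first exact: pdiv_prime.
  apply: dvdn_trans (pdiv_dvd n) _; apply: indexgS.
  by rewrite subsetI sBA.
exact: dvdn_trans (pdiv_dvd n) dvd_n.
Qed.

Lemma prime_dvd_pnat (p q n : nat) : p.-nat n -> prime q -> q %| n -> q = p.
Proof.
move=> pn q_pr qn; have n_gt0 : 0 < n by case/andP: pn.
have := pnatPpi pn (_ : q \in \pi(n)); rewrite mem_primes q_pr n_gt0 qn.
by move/(_ isT); rewrite inE => /eqP.
Qed.

Lemma minnormal_TI (gT : finGroupType) (G K M : {group gT}) :
  minnormal K G -> K \subset G -> M <| G -> ~~ (K \subset M) -> K :&: M = 1.
Proof.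
move=> minK sKG nsMG; apply: contraNeq => ntKM; have [/andP[_ nKG] minK'] := mingroupP minK.
rewrite -(minK' (K :&: M)%G) ?subsetIl ?subsetIr //.
by rewrite ntKM normsI // normal_norm.
Qed.

(** * Solvability *)

Definition coprime_cods (gT : finGroupType) (G : {group gT}) :=
  forall i j : Iirr G,
    ~~ (G^`(1) \subset cfker 'chi_i) -> ~~ (G^`(1) \subset cfker 'chi_j) ->
  cod i <> cod j -> coprime (cod i) (cod j).

Section CoprimeCods.

Variables (gT : finGroupType) (G : {group gT}).
Hypothesis cG : coprime_cods G.

Lemma coprime_cods_quotient (N : {group gT}) :
  N <| G -> coprime_cods (G / N).
Proof.
move=> nsNG i j; rewrite !nonlinear_mod // => ni nj.
by rewrite -!(cod_mod _ nsNG); apply: cG.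
Qed.

(** Every comparison of codegrees below goes through this lemma or the next one. *)
Lemma cod_eq_dvd (i j : Iirr G) q :
    ~~ (G^`(1) \subset cfker 'chi_i) -> ~~ (G^`(1) \subset cfker 'chi_j) ->
  prime q -> q %| cod i -> q %| cod j -> cod i = cod j.
Proof.
move=> ni nj q_pr qi qj; apply/eqP/idPn => /eqP/(cG ni nj)/eqP co.
by have := dvdn_gcd q (cod i) (cod j); rewrite qi qj co dvdn1; case: (q) q_pr => [|[]].
Qed.

(** Two coprime codegrees [a] and [b] of characters with the same kernel [D]
    have [a * b <= #|G : D|], while each is at least the square root of that
    index: so codegrees, hence degrees, are determined by the kernel. *)
Lemma cod_eq_ker (i j : Iirr G) :
    ~~ (G^`(1) \subset cfker 'chi_i) -> ~~ (G^`(1) \subset cfker 'chi_j) ->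
  cfker 'chi_i = cfker 'chi_j -> cod i = cod j.
Proof.
move=> ni nj eqK; apply/eqP/idPn => /eqP/(cG ni nj) co.
have le_ab : (cod i * cod j)%N <= #|G : cfker 'chi_i|.
  apply: dvdn_leq; first exact: indexg_gt0.
  by rewrite Gauss_dvd // -{1}cod_deg eqK -(cod_deg j) !dvdn_mulr.
have := leq_trans le_ab (index_le_sqr_cod i).
have := leq_trans le_ab; rewrite eqK => /(_ _ (index_le_sqr_cod j)).
rewrite -!mulnn leq_pmul2r ?cod_gt0 // leq_pmul2l ?cod_gt0 // => le1 le2.
have eqc : cod i = cod j by apply/eqP; rewrite eqn_leq le1.
have := index_le_sqr_cod i; move: co; rewrite eqc /coprime gcdnn => /eqP c1.
rewrite c1 leqNgt indexg_gt1 negbK => sGi.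
by case/negP: ni; apply: subset_trans (der_sub 1 G) sGi.
Qed.

Lemma deg_eq_ker (i j : Iirr G) :
    ~~ (G^`(1) \subset cfker 'chi_i) -> ~~ (G^`(1) \subset cfker 'chi_j) ->
  cfker 'chi_i = cfker 'chi_j -> deg i = deg j.
Proof.
move=> ni nj eqK; apply/eqP; rewrite -(eqn_pmul2l (cod_gt0 i)).
by rewrite {2}(cod_eq_ker ni nj eqK) !cod_deg eqK.
Qed.

End CoprimeCods.

Definition monolith (gT : finGroupType) (K G : {group gT}) :=
  forall M : {group gT}, M <| G -> M :!=: 1 -> K \subset M.

Lemma monolith_faithful (gT : finGroupType) (K G : {group gT}) (i : Iirr G) :
  monolith K G -> ~~ (K \subset cfker 'chi_i) -> cfker 'chi_i = 1.
Proof.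
move=> mono; apply: contraNeq => nt.
by apply: (mono (cfker_group 'chi_i)) nt; apply: cfker_normal.
Qed.

(** A group [P] of [p]-power order acting on the nontrivial irreducible
    characters of [N], where [p] divides [#|N|], fixes one of degree prime to
    [p]: the squares of those degrees add up to [#|N| - 1]. *)
Lemma exists_inv_irr_p'deg (gT : finGroupType) (N P : {group gT}) p :
    prime p -> p.-group P -> P \subset 'N(N) -> p %| #|N| ->
  exists t : Iirr N, [/\ t != 0%R, P \subset 'I['chi_t] & ~~ (p %| deg t)].
Proof.
move=> p_pr pP nNP pN.
have actI : is_action P (@conjg_Iirr _ N).
  split=> [y j k eq_jk | j y z Py Pz].
    by apply/irr_inj/(can_inj (cfConjgK y)); rewrite -!conjg_IirrE eq_jk.
  apply: irr_inj; rewrite !conjg_IirrE.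
  have nsN : N <| N <*> P by rewrite /normal joing_subl join_subG normG nNP.
  by rewrite (cfConjgM _ nsN) // (subsetP (joing_subr N P)).
pose to := Action actI.
pose A r := [set t : Iirr N | (t != 0%R) && (deg t %% p == r)].
have actA r : [acts P, on A r | to].
  apply/subsetP=> y Py; rewrite 2!inE Py; apply/subsetP=> t; rewrite !inE /=.
  by rewrite conjg_Iirr_eq0 /deg conjg_IirrE cfConjg1.
case: (pickP [pred t : Iirr N | [&& t != 0%R, P \subset 'I['chi_t] & ~~ (p %| deg t)]]).
  by move=> t /and3P[]; exists t.
move=> none; have := sum_sqr_deg N; rewrite (bigD1 0%R) //=.
have -> : deg (0 : Iirr N)%R = 1%N.
  by apply/eqP; rewrite -(eqr_nat algC) -degE irr0 cfun11.
have fixA r : 0 < r < p -> p %| #|A r|.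
  case/andP => r0 rp; have := pgroup_fix_mod pP (actA r).
  have -> : 'Fix_(A r | to)(P) = set0.
    apply/setP=> t; rewrite in_setI in_set0 [t \in A r]inE.
    apply/negP=> /andP[/andP[t0 /eqP rt] /afixP fixt].
    have := none t; rewrite /= t0 /dvdn rt -lt0n r0 andbT => /negP[].
    apply/subsetP=> y Py; rewrite inE (subsetP nNP) //=.
    by rewrite -conjg_IirrE (congr_irr (fixt y Py)).
  by rewrite cards0 mod0n /dvdn => ->.
have sumA : p %| (\sum_(t : Iirr N | t != 0%R) deg t ^ 2)%N.
  rewrite (partition_big (fun t : Iirr N => inord (deg t %% p) : 'I_p.-1.+1) xpredT) //=.
  apply: dvdn_sum => r _.
  have [r0 | r0] := posnP r.
    apply: dvdn_sum => t /andP[_ /eqP/(congr1 val) /=].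
    rewrite inordK ?prednK ?ltn_pmod ?prime_gt0 // r0 => /eqP pt.
    by rewrite dvdn_exp.
  rewrite (eq_bigl (mem (A r))); last first.
    move=> t; rewrite -[RHS]/(t \in A r) inE; congr (_ && _).
    by rewrite -val_eqE /= inordK // prednK ?ltn_pmod ?prime_gt0.
  rewrite /dvdn -modn_summ (eq_bigr (fun=> (r ^ 2 %% p)%N)); last first.
    by move=> t; rewrite -[X in is_true X -> _]/(t \in A r) inE => /andP[_ /eqP <-]; rewrite modnXm.
  rewrite sum_nat_const; apply: dvdn_mulr; apply: fixA; rewrite r0 /=.
  by rewrite -[X in _ < X](prednK (prime_gt0 p_pr)).
move=> sumN; have := pN; rewrite -sumN dvdn_addl // dvdn1 => /eqP p1.
by rewrite p1 in p_pr.
Qed.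

Lemma dvd_deg_constt_Ind (gT : finGroupType) (G K : {group gT}) (t : Iirr K)
    (i : Iirr G) :
  K <| G -> i \in irr_constt ('Ind[G] 'chi_t) -> deg t %| deg i.
Proof.
move=> nsKG; rewrite constt_Ind_Res => /(dvdn_constt_Res1_irr1 nsKG)[n].
rewrite !degE -natrM => /eqP; rewrite eqr_nat => /eqP->.
exact: dvdn_mull.
Qed.

(** All the degrees in [Irr(G|K)] are equal, to [d] say, and [d] is not [1]. For a
    prime [p] dividing [d], a [P]-invariant irreducible character of [K] of degree
    prime to [p], where [P] is a Sylow [p]-subgroup, extends to [K <*> P] because
    [K] is perfect; inducing the extension to [G] gives a character of degree prime
    to [p] all of whose constituents lie in [Irr(G|K)]. *)
Lemma no_perfect_monolith (gT : finGroupType) (G K : {group gT}) :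
    coprime_cods G -> K <| G -> K :!=: 1 -> monolith K G ->
  K^`(1) != K.
Proof.
move=> cG nsKG ntK mono; apply/eqP => perfK.
have [sKG nKG] := andP nsKG.
have sKG' : K \subset G^`(1) by rewrite -perfK dergS.
have nonlinK (i : Iirr G) : ~~ (K \subset cfker 'chi_i) -> ~~ (G^`(1) \subset cfker 'chi_i).
  by apply: contra; apply: subset_trans.
have [|t1 t1K] := @exists_irr_nontrivial _ K K; first by rewrite subG1.
have d1 : deg t1 != 1%N by rewrite -deg_nonlinear perfK.
pose p := pdiv (deg t1).
have p_pr : prime p by apply: pdiv_prime; rewrite ltn_neqAle eq_sym d1 deg_gt0.
have dvd_p (i : Iirr G) : ~~ (K \subset cfker 'chi_i) -> p %| deg i.
  move=> Ki; have [i1 ti1] := constt_cfInd_irr t1 sKG.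
  have Ki1 : ~~ (K \subset cfker 'chi_i1) by exact: constt_Ind_ker ti1 t1K.
  rewrite (deg_eq_ker cG (nonlinK i Ki) (nonlinK i1 Ki1)).
    exact: dvdn_trans (pdiv_dvd _) (dvd_deg_constt_Ind nsKG ti1).
  by rewrite (monolith_faithful mono Ki) (monolith_faithful mono Ki1).
have pK : p %| #|K|.
  apply: dvdn_trans (pdiv_dvd _) _.
  by have := dvd_irr1_cardG t1; rewrite degE dvdC_nat.
have [P sylP] := Sylow_exists p G; have [sPG pP _] := and3P sylP.
have nKP := subset_trans sPG nKG.
have [t [t0 invt p't]] := exists_inv_irr_p'deg p_pr pP nKP pK.
pose S := (K <*> P)%G.
have sSG : S \subset G by rewrite join_subG sKG.
have sKS : K \subset S by exact: joing_subl.
have nsKS : K <| S := normalS sKS sSG nsKG.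
have defSK : (S / K)%g = (P / K)%g by rewrite quotientYidl.
have pSK : p.-group (S / K) by rewrite defSK quotient_pgroup.
have invS : S \subset 'I['chi_t] by rewrite join_subG sub_inertia.
have o1 : 'o('chi_t)%CF = 1%N.
  suffices det1 : (cfDet ('chi_t) = 1)%R.
    apply/eqP; rewrite -dvdn1; apply/dvdn_cforderP; rewrite det1 => x Kx.
    by rewrite expr1 cfun1E Kx.
  have lin_det := cfDet_lin_char ('chi_t)%R.
  have /irrP[k def_k] := lin_char_irr lin_det.
  have := lin_char_der1 lin_det; rewrite perfK def_k subGcfker => /eqP->.
  exact: irr0.
have [c [Resc _ _]] : exists c : Iirr S, [/\ 'Res[K] 'chi_c = 'chi_t,
    'o('chi_c)%CF = 'o('chi_t)%CF & forall d, 'Res 'chi_d = 'chi_t ->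
     coprime #|S : K| 'o('chi_d)%CF -> d = c]%R.
  apply: extend_solvable_coprime_irr => //; first exact: pgroup_sol pSK.
  rewrite o1 mul1n -/(deg t) -card_quotient ?normal_norm //.
  by have [m ->] := p_natP pSK; rewrite coprimeXl // prime_coprime.
have dc : deg c = deg t.
  by apply/eqP; rewrite -(eqr_nat algC) -!degE -Resc cfRes1.
have Kc : ~~ (K \subset cfker 'chi_c).
  apply: contra t0 => sKc; rewrite -subGcfker -Resc cfker_Res ?irr_char //.
  by rewrite subsetI subxx.
have := dvd_deg_Ind sKS sSG Kc dvd_p; rewrite dc Euclid_dvdM // (negPf p't) orbF.
apply/negP; rewrite -p'natE // ?indexg_gt0 //.
apply: pnat_dvd (_ : p^'.-nat #|G : P|); first exact/indexgS/joing_subr.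
by case/and3P: sylP.
Qed.

(** By induction all proper quotients are solvable, so that a nonsolvable minimal
    normal subgroup is perfect, and it is contained in every normal subgroup [M]
    because it embeds in [G / M] otherwise. *)
Theorem coprime_cods_solvable (gT : finGroupType) (G : {group gT}) :
  coprime_cods G -> solvable G.
Proof.
have [n] := ubnP #|G|; elim: n => // n IHn in gT G * => leGn cG.
have [-> | ntG] := eqsVneq G 1; first exact: solvable1.
have IHq (N : {group gT}) : N <| G -> N :!=: 1 -> solvable (G / N).
  move=> nsNG ntN; apply: IHn; last exact: coprime_cods_quotient.
  rewrite ltnS in leGn; apply: leq_trans leGn.
  by rewrite ltn_quotient ?normal_sub.
have [K minK sKG] := minnormal_exists ntG (normG G).
have [/andP[ntK nKG] _] := mingroupP minK.
have nsKG : K <| G by apply/andP.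
have [solK | nsolK] := boolP (solvable K); first by rewrite (series_sol nsKG) solK IHq.
have perfK : K^`(1) = K.
  have [_ minK'] := mingroupP minK; apply: minK' (der_sub 1 K).
  rewrite (char_norm_trans (der_char 1 K)) // andbT.
  by apply: contraNneq nsolK => K'1; apply: abelian_sol; apply/derG1P.
suffices mono : monolith K G by have := no_perfect_monolith cG nsKG ntK mono; rewrite perfK eqxx.
move=> M nsMG ntM; apply/idPn => nsKM; case/negP: nsolK.
have tiKM := minnormal_TI minK sKG nsMG nsKM.
have nMK : K \subset 'N(M) := subset_trans sKG (normal_norm nsMG).
rewrite (isog_sol (quotient_isog nMK _)) 1?setIC //.
by apply: solvableS (quotientS _ sKG) (IHq M nsMG ntM).
Qed.

(** * The codegree of the metabelian quotient *)

Lemma comm_inertia_ker (gT : finGroupType) (A T : {group gT}) (t : Iirr A) :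
  deg t = 1%N -> T \subset 'I['chi_t] -> [~: A, T] \subset cfker 'chi_t.
Proof.
move=> dt sTI; rewrite gen_subG; apply/subsetP=> _ /imset2P[x y Ax Ty ->].
have Iy := subsetP sTI y Ty; have nAy := subsetP (norm_inertia _) y Iy.
have lin_t : 'chi_t \is a linear_char by rewrite lin_irr_der1 deg_nonlinear dt.
have Axy : x ^ y \in A by rewrite memJ_norm.
rewrite /= cfkerEirr inE commgEl lin_charM ?groupV // inertia_valJ //.
by rewrite lin_charV // mulVf ?lin_char_neq0 // lin_char1.
Qed.

Lemma constt_Res_nontrivial (gT : finGroupType) (G A : {group gT}) (i : Iirr G)
    (t : Iirr A) :
  A <| G -> ~~ (A \subset cfker 'chi_i) -> t \in irr_constt ('Res[A] 'chi_i) ->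
  t != 0%R.
Proof.
move=> nsAG Ai tA; apply: contraNneq Ai => t0.
by rewrite constt0_Res_cfker // -t0.
Qed.

(** When [G^`(1)] is the only minimal normal subgroup, the inertia group [T] of a
    nontrivial linear character of [G^`(1)] centralizes it, so that [T] is
    nilpotent, hence a [p]-group; a faithful character of [G] is induced from
    [T], and its codegree divides [#|T|]. *)
Lemma just_nonabelian_cod (gT : finGroupType) (G : {group gT}) :
    solvable G -> G^`(1) != 1 -> monolith G^`(1) G ->
  exists2 p, prime p & p.-group G^`(1) /\
    forall i : Iirr G, ~~ (G^`(1) \subset cfker 'chi_i) -> p.-nat (cod i).
Proof.
move=> solG ntG' mono; set A := G^`(1)%G in mono *.
have nsAG : A <| G := der_normal 1 G; have [sAG nAG] := andP nsAG.
have minA : minnormal A G.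
  apply/mingroupP; split=> [|M /andP[ntM nMG] sMA]; first by rewrite ntG' nAG.
  apply/eqP; rewrite eqEsubset sMA mono // /normal nMG.
  by rewrite (subset_trans sMA).
have [_ _ /is_abelemP[p p_pr abelA]] := minnormal_solvable minA sAG solG.
have [pA cAA _] := and3P abelA; exists p => //; split=> // i Ai.
have [t iAt] := constt_cfRes_irr A i.
have [s [_ chi_i dgi]] := Clifford_correspondent nsAG iAt.
have t0 := constt_Res_nontrivial nsAG Ai iAt.
have dt : deg t = 1%N by apply/eqP; rewrite -deg_nonlinear (derG1P cAA) sub1G.
set T := ('I_G['chi_t])%G in s chi_i dgi *.
have sTG : T \subset G := Inertia_sub _ _.
have sAT : A \subset T by rewrite sub_Inertia.
have nsTG : T <| G by exact: sub_der1_normal.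
have cAT : A \subset 'Z(T).
  rewrite subsetI sAT; apply/commG1P/eqP; apply: contraNT t0 => ntAT.
  have nsAT : [~: A, T] <| G.
    by rewrite /normal comm_subG // normsR // normal_norm.
  have := mono [~: A, T]%G nsAT ntAT => /subset_trans/(_ (comm_inertia_ker dt _)).
  by rewrite subGcfker; apply; rewrite subsetIr.
have nilT : nilpotent T.
  rewrite -quotient_center_nil abelian_nil // sub_der1_abelian //.
  exact: subset_trans (dergS 1 sTG) cAT.
have pT : p.-group T.
  have := nilpotent_pcoreC p nilT.
  suffices -> : 'O_p^'(T) = 1 by rewrite dprodg1 => <-; apply: pcore_pgroup.
  apply: contraNeq ntG' => ntO.
  have nsOG : 'O_p^'(T) <| G := char_normal_trans (pcore_char _ _) nsTG.
  have := mono ('O_p^'(T))%G nsOG ntO => sAO; rewrite trivg_card1.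
  by apply/eqP/(@pnat_1 p); last exact: pgroupS sAO (pcore_pgroup _ _).
have := cod_deg i; rewrite (monolith_faithful mono Ai) indexg1 dgi.
rewrite -(Lagrange sTG) mulnCA mulnC => /eqP; rewrite eqn_pmul2r ?indexg_gt0 //.
by move=> /eqP eqT; apply: pnat_dvd pT; rewrite -eqT dvdn_mulr.
Qed.

(** [M] is maximal among the normal subgroups containing [L] but not [G^`(1)]. *)
Lemma exists_just_nonabelian (gT : finGroupType) (G L : {group gT}) :
    L <| G -> ~~ (G^`(1) \subset L) ->
  exists M : {group gT}, [/\ M <| G, L \subset M, ~~ (G^`(1) \subset M)
    & monolith (G / M)^`(1) (G / M)].
Proof.
move=> nsLG nsG'L.
pose gP (M : {group gT}) := (M <| G) && ~~ (G^`(1) \subset M).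
have [|M /maxgroupP[/andP[nsMG G'M] maxM] sLM] := @maxgroup_exists _ gP L.
  by rewrite /gP nsLG.
exists M; split=> // Nb nsNb ntN.
have [N defN sMN nsNG] := inv_quotientN nsMG nsNb.
rewrite /= -quotient_der ?normal_norm // defN quotientS //.
apply: contraNT ntN => G'N; rewrite defN (_ : N :=: M) ?trivg_quotient //.
by apply: maxM => //; rewrite /gP nsNG.
Qed.

Section Metabelian.

Variables (gT : finGroupType) (G : {group gT}).
Hypotheses (cG : coprime_cods G).

Let solG : solvable G := coprime_cods_solvable cG.

(** The codegrees of [i] and [j] have prime divisors [q] and [r] in the abelian
    section [G^`(1) / G^`(2)], so both meet a codegree divisible by [q * r]. *)
Lemma metabelian_cod_eq (i j : Iirr G) :
    ~~ (G^`(1) \subset cfker 'chi_i) -> ~~ (G^`(1) \subset cfker 'chi_j) ->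
    G^`(2) \subset cfker 'chi_i -> G^`(2) \subset cfker 'chi_j ->
  cod i = cod j.
Proof.
have nsG' := der_normal 1 G.
move=> ni nj G''i G''j; have [q [q_pr qG qi]] := exists_prime_cod nsG' (der_sub 1 _) G''i G''i ni.
have [r [r_pr rG rj]] 
  := exists_prime_cod nsG' (der_sub 1 _) G''j G''j nj.
have [k [_ /(nontrivial_of_dvd q_pr) nk _ qk rk]] := exists_cod_dvd2 nsG' (der_normal 2 G) (der_sub 1 _)
  (subxx _) q_pr r_pr qG rG.
by rewrite (cod_eq_dvd cG ni nk q_pr qi qk) (cod_eq_dvd cG nk nj r_pr rk rj).
Qed.

(** The common codegree of the nonlinear characters of [G / G^`(2)] can be
    computed in a just nonabelian quotient, where it is a prime power. *)
Lemma metabelian_cod :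
    G^`(1) != 1 ->
  exists p a, [/\ prime p, p.-nat a, p.-nat #|G^`(1) : G^`(2)|
    & forall i : Iirr G, ~~ (G^`(1) \subset cfker 'chi_i) ->
        G^`(2) \subset cfker 'chi_i -> p %| cod i /\ cod i = a].
Proof.
move=> ntG'; have nsG' := der_normal 1 G; have nsG'' := der_normal 2 G.
have prG' : G^`(2) \proper G^`(1) by apply: sol_der1_proper (der_sub 1 G) _.
have [|M [nsMG sG''M G'M mono]] := exists_just_nonabelian nsG''.
  by case/andP: prG'.
have nMG := normal_norm nsMG; have nMG' := subset_trans (der_sub 1 G) nMG.
have solGM : solvable (G / M) := quotient_sol M solG.
have ntGM : (G / M)^`(1) != 1.
  by rewrite -quotient_der // -subG1 quotient_sub1.
have [p p_pr [pG'M pcod]] := just_nonabelian_cod solGM ntGM mono.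
have [|j nj] := @exists_irr_nontrivial _ (G / M)%G (G / M)^`(1).
  by rewrite subG1.
pose i := mod_Iirr j; have ni : ~~ (G^`(1) \subset cfker 'chi_i).
  by rewrite -nonlinear_mod.
have sMi : M \subset cfker 'chi_i by rewrite mod_IirrE // cfker_mod.
have G''i : G^`(2) \subset cfker 'chi_i by exact: subset_trans sMi.
have pi : p.-nat (cod i) by rewrite cod_mod // pcod.
have eq_i (k : Iirr G) : ~~ (G^`(1) \subset cfker 'chi_k) ->
    G^`(2) \subset cfker 'chi_k -> cod k = cod i.
  by move=> nk G''k; apply: metabelian_cod_eq.
have p_cod : p %| cod i.
  have := dvd_index_cod nsG' G''i; set n := #|_ : _| => dvd_n.
  have n1 : 1 < n by rewrite indexg_gt1 subsetI subxx.
  have pn : p.-nat n := pnat_dvd dvd_n pi.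
  apply: dvdn_trans dvd_n; have [m def_n] := p_natP pn.
  rewrite def_n in n1 *; case: m n1 {def_n} => // m _.
  by rewrite expnS dvdn_mulr.
exists p, (cod i); split=> // [|k nk G''k]; last by rewrite eq_i.
apply/pnatP=> [|q q_pr qG']; first exact: indexg_gt0.
have [k [G''k /(nontrivial_of_dvd q_pr) nk _ qk _]] := exists_cod_dvd2 nsG' nsG'' (der_sub 1 _)
  (subxx _) q_pr q_pr qG' qG'.
apply: (pnatPpi pi); rewrite mem_primes q_pr cod_gt0 /=.
by rewrite -(eq_i k).
Qed.

End Metabelian.

(** * The distinguished prime and its codegree *)

(** [p] and [a] are the prime and the codegree of [metabelian_cod]. *)
Definition metab_cod (gT : finGroupType) (G : {group gT}) (p a : nat) :=
  [/\ prime p, p.-nat a, p.-nat #|G^`(1) : G^`(2)|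
    & forall i : Iirr G, ~~ (G^`(1) \subset cfker 'chi_i) ->
        G^`(2) \subset cfker 'chi_i -> p %| cod i /\ cod i = a].

Lemma eq_in_subset (T : finType) (A B C : {set T}) :
  {in A, B =i C} -> (A \subset B) = (A \subset C).
Proof.
by move=> eqBC; apply/subsetP/subsetP => sA x Ax; move: (sA x Ax); rewrite eqBC.
Qed.

Lemma twist_irr (gT : finGroupType) (G : {group gT}) (k i : Iirr G) :
    deg k = 1%N ->
  exists l : Iirr G, [/\ 'chi_l = ('chi_k * 'chi_i)%R, deg l = deg i,
      forall A : {set gT}, A \subset cfker 'chi_k ->
        (A \subset cfker 'chi_l) = (A \subset cfker 'chi_i)
    & forall A : {set gT}, A \subset cfker 'chi_i ->
        (A \subset cfker 'chi_l) = (A \subset cfker 'chi_k)].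
Proof.
move=> dk; have lin_k : 'chi_k \is a linear_char.
  by rewrite lin_irr_der1 deg_nonlinear dk.
have /irrP[l def_l] := mul_lin_irr lin_k (mem_irr i); exists l.
have l1 : 'chi_l 1%g = 'chi_i 1%g by rewrite -def_l cfunE lin_char1 // mul1r.
split=> //; first by rewrite /deg l1.
- move=> A /subsetP Ak; rewrite !cfkerEirr; apply: eq_in_subset => x Ax.
  by rewrite !inE l1 -def_l cfunE (cfker1 (Ak x Ax)) (lin_char1 lin_k) mul1r.
- move=> A /subsetP Ai; rewrite !cfkerEirr; apply: eq_in_subset => x Ax.
  rewrite !inE l1 -def_l cfunE (cfker1 (Ai x Ax)) (lin_char1 lin_k).
  by rewrite -[X in (_ == X) = _]mul1r (inj_eq (mulIf (irr1_neq0 i))).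
Qed.

Section MetabCod.

Variables (gT : finGroupType) (G : {group gT}) (p a : nat).
Hypotheses (cG : coprime_cods G) (mG : metab_cod G p a).

Let solG : solvable G := coprime_cods_solvable cG.
Let p_pr : prime p. Proof. by case: mG. Qed.

Lemma metab_exists : G^`(1) != 1 ->
  exists2 i : Iirr G, ~~ (G^`(1) \subset cfker 'chi_i) &
    G^`(2) \subset cfker 'chi_i /\ (p %| cod i /\ cod i = a).
Proof.
move=> ntG'; case: mG => _ _ _ codG.
have [||i /andP[G''i G'i]] := @exists_irr_sep _ G G^`(2) G^`(1).
- exact: der_normal.
- by case/andP: (sol_der1_proper solG (der_sub 1 G) ntG').
by exists i => //; split=> //; apply: codG.
Qed.

Lemma metab_quotient (N : {group gT}) :
  N <| G -> ~~ (G^`(1) \subset N) -> metab_cod (G / N) p a.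
Proof.
move=> nsNG nsG'N; have nNG := normal_norm nsNG.
have cGN := coprime_cods_quotient cG nsNG.
have ntGN : (G / N)^`(1) != 1.
  by rewrite -quotient_der // -subG1 quotient_sub1 // (subset_trans (der_sub 1 G)).
have [p1 [a1 mGN]] := metabelian_cod cGN ntGN.
have [p1_pr pa1 _ codGN] := mGN.
have solGN := coprime_cods_solvable cGN.
have [||j /andP[G''j G'j]] := @exists_irr_sep _ (G / N)%G (G / N)^`(2) (G / N)^`(1).
- exact: der_normal.
- by case/andP: (sol_der1_proper solGN (der_sub 1 _) ntGN).
have [p1j cod_j] := codGN j G'j G''j.
have [_ _ _ codG] := mG.
have [||pj cod_j1] := codG (mod_Iirr j); first by rewrite -nonlinear_mod.
  by rewrite sub_ker_mod ?der_sub // quotient_der.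
rewrite cod_mod // in pj cod_j1; have pp1 : p1 = p.
  have p_a1 : p %| a1 by rewrite -cod_j.
  exact/esym/(prime_dvd_pnat pa1 p_pr p_a1).
by move: mGN; rewrite pp1 -cod_j cod_j1.
Qed.

(** Twisting a character of [G / M] of codegree [a], where [G / M] is just
    nonabelian, by a linear character trivial on [G^`(1) <*> L] and not on [O],
    would give a character with a codegree divisible by [p] and by a prime
    divisor of [#|O : L|]. *)
Lemma p'_section_sub_der1 (L O : {group gT}) :
    L <| G -> O <| G -> L \subset O -> ~~ (p %| #|O : L|) ->
    ~~ (G^`(1) \subset L) ->
  O \subset G^`(1) <*> L.
Proof.
move=> nsLG nsOG sLO p'OL nsG'L; apply/idPn => nsO.
have [M [nsMG sLM G'M mono]] := exists_just_nonabelian nsLG nsG'L.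
have nMG := normal_norm nsMG; have nMG' := subset_trans (der_sub 1 G) nMG.
have solGM : solvable (G / M) := quotient_sol M solG.
have ntGM : (G / M)^`(1) != 1.
  by rewrite -quotient_der // -subG1 quotient_sub1.
have [_ pa pG'G'' codG] := mG.
have sG''M : G^`(2) \subset M.
  rewrite -quotient_sub1 ?(subset_trans (der_sub 2 G)) // quotient_der //.
  have := sol_der1_proper solGM (der_sub 1 _) ntGM.
  apply: contraTT; rewrite subG1 => ntG''.
  by rewrite properE (mono (G / M)^`(2)%G (der_normal 2 _) ntG'') andbF.
have sOM : O \subset M.
  have nMO := subset_trans (normal_sub nsOG) nMG.
  rewrite -quotient_sub1 // subG1; apply: contraNT p'OL => ntOM.
  have := mono (O / M)%G (quotient_normal M nsOG) ntOM => sG'O.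
  have : p %| #|(G / M)^`(1)|.
    have : p.-group (G / M)^`(1).
      rewrite -quotient_der // /pgroup card_quotient // -indexgI.
      apply: pnat_dvd pG'G''; apply: indexgS.
      by rewrite subsetI der_subS.
    by move/pgroup_pdiv/(_ ntGM) => [].
  move/dvdn_trans; apply; apply: dvdn_trans (cardSg sG'O) _.
  rewrite card_quotient // -indexgI; apply: indexgS.
  by rewrite subsetI sLO sLM.
have [|j nj] := @exists_irr_nontrivial _ (G / M)%G (G / M)^`(1).
  by rewrite subG1.
pose i := mod_Iirr j; have ni : ~~ (G^`(1) \subset cfker 'chi_i).
  by rewrite -nonlinear_mod.
have sMi : M \subset cfker 'chi_i by rewrite mod_IirrE // cfker_mod.
have nsN : (G^`(1) <*> L)%G <| G.
  by rewrite /normal normsY ?(normal_norm nsLG) ?gFnorm // join_subG der_sub normal_sub.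
have [k /andP[]] := exists_irr_sep nsN nsO.
rewrite join_subG => /andP[G'k Lk] Ok.
have dk : deg k = 1%N by apply/eqP; rewrite -deg_nonlinear.
have [l [_ _ lk li]] := twist_irr i dk.
have nl : ~~ (G^`(1) \subset cfker 'chi_l) by rewrite lk.
have [||_ cod_l] := codG l; rewrite ?lk //.
- exact: subset_trans sG''M sMi.
- by rewrite (subset_trans (der_subS 1 G)).
have Ol : ~~ (O \subset cfker 'chi_l) by rewrite li // (subset_trans sOM).
have O'l : O^`(1) \subset cfker 'chi_l.
  rewrite li; first exact: subset_trans (dergS 1 (normal_sub nsOG)) G'k.
  by rewrite (subset_trans (der_sub 1 O)) // (subset_trans sOM).
have [|q [q_pr qOL ql]] := exists_prime_cod nsOG sLO O'l _ Ol.
  by rewrite li // (subset_trans sLM).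
case/negP: p'OL; rewrite cod_l in ql.
by rewrite -(prime_dvd_pnat pa q_pr ql).
Qed.

(** So a character nontrivial on a [p']-section is nonlinear. Its codegree has a
    prime divisor other than [p], hence is not [a], hence is prime to [p]. *)
Lemma p'_section_cod (L O : {group gT}) (i : Iirr G) :
    L <| G -> O <| G -> L \subset O -> ~~ (p %| #|O : L|) -> O^`(1) \subset L ->
    ~~ (G^`(1) \subset L) -> L \subset cfker 'chi_i -> ~~ (O \subset cfker 'chi_i) ->
  [/\ ~~ (G^`(1) \subset cfker 'chi_i), cod i != a, ~~ (p %| cod i)
    & exists q, [/\ prime q, q %| #|O : L| & q %| cod i]].
Proof.
move=> nsLG nsOG sLO p'OL O'L nsG'L Li Oi.
have ni : ~~ (G^`(1) \subset cfker 'chi_i).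
  apply: contra Oi => G'i.
  apply: subset_trans (p'_section_sub_der1 nsLG nsOG sLO p'OL nsG'L) _.
  by rewrite join_subG G'i.
have [q [q_pr qOL qi]] := exists_prime_cod nsOG sLO (subset_trans O'L Li) Li Oi.
have cod_a : cod i != a.
  apply: contraNneq p'OL => cod_i; case: mG => _ pa _ _.
  by rewrite -cod_i in pa; rewrite -(prime_dvd_pnat pa q_pr qi).
split=> //; last by exists q.
apply: contra cod_a => pi; have ntG' : G^`(1) != 1.
  by apply: contraNneq nsG'L => ->; apply: sub1G.
have [k nk [_ [pk <-]]] := metab_exists ntG'.
by rewrite (cod_eq_dvd cG ni nk p_pr pi pk).
Qed.

End MetabCod.

(** * Fixed points of groups acting on an abelian group *)

Section OrbitSums.

Import FiniteModule.

Variables (gT : finGroupType) (K : {group gT}) (cKK : abelian K).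

(** The orbit sum of [u] is fixed by [A]. *)
Lemma sum_actr_eq0 (A : {group gT}) (u : fmod_of cKK) :
  A \subset 'N(K) -> 'C_K(A) = 1 -> (\sum_(a in A) u ^@ a = 0)%R.
Proof.
move=> nKA regA; set v := (\sum_(a in A) _)%R.
have fix_v b : b \in A -> (v ^@ b = v)%R.
  move=> Ab; rewrite /v actr_sum [RHS](reindex_inj (mulIg b)) /=.
  apply: eq_big => [a | a Aa]; first by rewrite groupMr.
  by rewrite actrM ?(subsetP nKA).
apply: fmod_inj; rewrite fmval0; apply/set1P; rewrite -[[set 1]]/[1] -regA.
rewrite inE fmodP; apply/centP => b Ab.
by apply/commgP/conjg_fixP; rewrite -fmvalJ ?(subsetP nKA) // fix_v.
Qed.

(** If the nontrivial elements of [F] are partitioned by the subgroups in [P], the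
    sums over these subgroups and over [F] differ by [#|P|.-1] copies of [u]. *)
Lemma cover_cent_trivial (F : {group gT}) (P : {set {group gT}}) :
    F \subset 'N(K) -> F :!=: 1 ->
    {in P, forall A : {group gT}, [/\ A \subset F, A :!=: 1 & 'C_K(A) = 1]} ->
    {in F^#, forall a, #|[set A in P | a \in gval A]| = 1%N} ->
    coprime #|K| #|P|.-1 ->
  'C_K(F) = 1 -> K :=: 1.
Proof.
move=> nKF ntF regP partP coKP regF.
have [a Fa nta] : exists2 a, a \in F & a != 1 by apply/trivgPn.
have P_gt0 : 0 < #|P|.
  have : 0 < #|[set A in P | a \in gval A]| by rewrite partP // !inE nta.
  by move/leq_trans; apply; apply: subset_leq_card; apply/subsetP=> A; rewrite inE => /andP[].
apply/trivgP/subsetP => x Kx; apply/set1P.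
pose u := fmod cKK x.
have sumP : (\sum_(A in P) \sum_(a in gval A) u ^@ a = 0)%R.
  rewrite big1 // => A /regP[sAF _ regA].
  by apply: sum_actr_eq0 => //; apply: subset_trans sAF nKF.
have sumPF : (\sum_(A in P) \sum_(a in gval A) u ^@ a =
              \sum_(a in F) u ^@ a *+ #|[set A in P | a \in gval A]|)%R.
  rewrite (exchange_big_dep (mem F)) /= => [|A b /regP[sAF _ _] /(subsetP sAF)//].
  apply: eq_bigr => b Fb; rewrite -sumr_const; apply: eq_bigl => A.
  by rewrite inE.
have {sumPF} : (u *+ #|P|.-1 = 0)%R.
  rewrite -sumP sumPF (bigD1 1) ?group1 //= actr1.
  have -> : [set A in P | 1 \in gval A] = P.
    by apply/setP=> A; rewrite inE group1 andbT.
  rewrite -{2}(prednK P_gt0) mulrS addrAC.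
  rewrite (eq_bigr (fun b => u ^@ b)%R) => [|b /andP[Fb ntb]]; last first.
    by rewrite partP ?mulr1n // !inE ntb.
  have := sum_actr_eq0 u nKF regF; rewrite (bigD1 1) ?group1 //= actr1 => ->.
  by rewrite add0r.
move/(congr1 val); rewrite /= fmvalZ fmodK // => xP1.
apply/eqP; rewrite -order_eq1 -dvdn1 -(eqP coKP) dvdn_gcd order_dvdG //=.
by rewrite order_dvdn xP1.
Qed.

End OrbitSums.

(** A Frobenius group acting on an abelian group [K] so that its kernel has no
    fixed points other than [1] cannot act so that its complement has none
    either: the kernel and the conjugates of the complement partition the group,
    so that adding up orbits gives a relation [u *+ n = 0] where [n] counts these
    conjugates. *)
Lemma Frobenius_compl_cent (gT : finGroupType) (K F W B : {group gT}) :
    abelian K -> [Frobenius F = W ><| B] -> F \subset 'N(K) ->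
    coprime #|K| #|W| -> 'C_K(W) = 1 -> 'C_K(B) = 1 -> K :=: 1.
Proof.
move=> cKK frobF nKF coKW regW regB.
have [defF ntW ntB prWF prBF] := Frobenius_context frobF.
have [sWF sBF] := (proper_sub prWF, proper_sub prBF).
have regF : 'C_K(F) = 1 by apply/trivgP; rewrite -regW setIS // centS.
have /and3P[/eqP coverF tiF _] := Frobenius_partition frobF.
have nW : gval W \notin B^# :^: W.
  apply/imsetP=> [[w _ defW]]; have := group1 W.
  by rewrite defW mem_conjg conj1g !inE eqxx.
apply/trivgP/subsetP => x Kx; apply/set1P.
pose u := FiniteModule.fmod cKK x.
have := sum_actr_eq0 u nKF regF.
rewrite -coverF big_trivIset //= big_setU1 //= sum_actr_eq0 ?(subset_trans sWF) //.
rewrite add0r (eq_bigr (fun=> - u)%R) => [|_ /imsetP[w Ww ->]]; last first.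
  have regBw : 'C_K(B :^ w) = 1.
    have nKw : w \in 'N(K) by rewrite (subsetP nKF) ?(subsetP sWF).
    by rewrite -(normP nKw) centJ -conjIg regB conjs1g.
  have nKBw : B :^ w \subset 'N(K).
    by rewrite (subset_trans _ nKF) // -(conjGid (subsetP sWF w Ww)) conjSg.
  have := sum_actr_eq0 u (A := (B :^ w)%G) nKBw regBw.
  rewrite (bigD1 1) ?group1 //= FiniteModule.actr1 => sumB.
  apply: (addrI u); rewrite subrr -[RHS]sumB; congr (_ + _)%R; apply: eq_bigl => a.
  by rewrite conjD1g !inE andbC.
rewrite sumr_const mulNrn => /eqP; rewrite oppr_eq0 => /eqP/(congr1 val).
rewrite /= FiniteModule.fmvalZ FiniteModule.fmodK // => xn1.
apply/eqP; rewrite -order_eq1 -dvdn1 -(eqP coKW) dvdn_gcd order_dvdG //=.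
apply: dvdn_trans (_ : #|B^# :^: W| %| _); first by rewrite order_dvdn xn1.
by rewrite card_conjugates dvdn_indexg.
Qed.

Lemma semiregular_prime_elts (gT : finGroupType) (K P : {group gT}) (p : nat) :
    p.-group P -> {in P, forall y, #[y] = p -> 'C_K[y] = 1} -> semiregular K P.
Proof.
move=> pP regP x /setD1P[ntx Px]; have p_x := mem_p_elt pP Px.
have ntX : <[x]> != 1 by rewrite cycle_eq1.
have [p_pr pX _] := pgroup_pdiv p_x ntX.
have [y Xy oy] := Cauchy p_pr pX.
have Py : y \in P by rewrite (subsetP _ y Xy) // cycle_subG.
apply/trivgP; rewrite /= -(regP y Py oy) -(cent_cycle x) -(cent_cycle y).
by rewrite setIS // centS // cycle_subG.
Qed.

(** The [p + 1] subgroups of order [p] of [E] partition its nontrivial elements and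
    have no fixed points, and [p] is prime to [#|K|], so that [cover_cent_trivial]
    applies. *)
Lemma abelem_regular_rank1 (gT : finGroupType) (K E : {group gT}) (p : nat) :
    prime p -> abelian K -> K :!=: 1 -> p.-abelem E -> E \subset 'N(K) ->
    coprime #|K| p -> logn p #|E| = 2 -> ~ semiregular K E.
Proof.
move=> p_pr cKK ntK abelE nKE coKp E2 regE; have [pE cEE expE] := and3P abelE.
have oE : #|E| = (p ^ 2)%N by rewrite -E2; apply: card_pgroup.
have ntE : E :!=: 1.
  by rewrite -cardG_gt1 oE (leq_trans (prime_gt1 p_pr)) // -{1}[p]expn1 leq_exp2l ?prime_gt1.
have regA (A : {group gT}) : A \subset E -> A :!=: 1 -> 'C_K(A) = 1.
  move=> sAE /trivgPn[x Ax ntx]; apply/trivgP; rewrite -(regE x).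
    by rewrite -(cent_cycle x) setIS // centS // cycle_subG.
  by rewrite !inE ntx (subsetP sAE).
have ordE x : x \in E -> x != 1 -> #[x] = p.
  by move=> Ex ntx; apply: (abelem_order_p abelE).
pose P : {set {group gT}} := [set <[x]>%G | x in E^#].
have PA A : A \in P -> [/\ A \subset E, #|A| = p & exists2 x, x \in E^# & A = <[x]>%G].
  case/imsetP=> x Ex ->; have /setD1P[ntx Ex'] := Ex.
  by split; [rewrite cycle_subG | apply: ordE | exists x].
have partP : {in E^#, forall a, #|[set A in P | a \in gval A]| = 1%N}.
  move=> a /setD1P[nta Ea]; apply/eqP/cards1P; exists <[a]>%G.
  apply/setP=> A; rewrite !inE; apply/andP/eqP => [[/PA[_ oA _] Aa] | ->].
    apply/val_inj/eqP; rewrite eq_sym eqEcard cycle_subG Aa /= oA.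
    by rewrite -orderE ordE.
  by rewrite cycle_id imset_f // !inE nta.
have cardP : (\sum_(A in P) #|A| = #|E^#| + #|P|)%N.
  rewrite (eq_bigr (fun A : {group gT} => \sum_(a in E) (a \in gval A))%N) => [|A /PA[sAE _ _]].
    rewrite exchange_big /= (bigD1 1) ?group1 //= addnC; congr (_ + _)%N.
      rewrite -sum1_card; apply: eq_big => [a | a /andP[Ea nta]]; first by rewrite !inE andbC.
      rewrite -(partP a); last by rewrite !inE nta.
      by rewrite -sum1dep_card big_mkcondr; apply: eq_bigr => A _; case: (a \in _).
    by rewrite -sum1_card; apply: eq_bigr => A _; rewrite group1.
  rewrite -sum1_card big_mkcond [RHS]big_mkcond /=.
  apply: eq_bigr => a _; case: ifP => [/(subsetP sAE)-> | ] //.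
  by case: ifP.
have cP : #|P| = p.+1.
  have c1 : (#|P| * p = #|E^#| + #|P|)%N.
    by rewrite -cardP -sum_nat_const; apply: eq_bigr => A /PA[_ ->].
  have p1 := prime_gt1 p_pr.
  move: c1 oE; rewrite (cardsD1 1 E) group1 -mulnn.
  move: #|P| #|E^#| => c e; case: (p) p1 => // q q_gt0 c1 e1.
  by apply/eqP; rewrite -(eqn_pmul2r q_gt0); apply/eqP; nia.
move: ntK; rewrite (cover_cent_trivial cKK nKE ntE _ partP) ?eqxx //.
- by move=> A /PA[sAE oA _]; split; rewrite // ?regA // -?cardG_gt1 oA prime_gt1.
- by rewrite cP.
- exact: regA.
Qed.

(** * Groups all of whose proper quotients have at most one codegree *)

(** The two possible structures; [p] is the prime of [metab_cod].
    The second one is that of a 2-Frobenius group by [typeII_two_Frobenius]. *)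
Definition typeI (gT : finGroupType) (G N Q : {group gT}) (s : nat) :=
  [/\ prime s, s.-abelem N, Q \isog 'Q_8 & [Frobenius G = N ><| Q]].

Definition typeII (gT : finGroupType) (G K H : {group gT}) (p s : nat) :=
  [/\ [/\ prime p, prime s, s.-abelem K & minnormal K G],
      [/\ K <| G, H <| G, #|H : K| = p & H \proper G],
      [Frobenius H with kernel K], cyclic (G / H)
    & 'C_(G / K)(H / K) \subset H / K].

(** Otherwise [#|G|`_p] would divide the index of [K <*> <[y]>] by
    [dvd_deg_index], as [K] is not contained in the derived subgroup
    [[~: K, <[y]>]]. *)
Lemma nfree_exists_deg (gT : finGroupType) (G K : {group gT}) (p : nat) y :
    prime p -> K <| G -> abelian K -> coprime #|K| p -> y \in G -> #[y] = p ->
    'C_K[y] != 1 ->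
  exists2 j : Iirr G, ~~ (K \subset cfker 'chi_j) & ~~ (#|G|`_p %| deg j).
Proof.
move=> p_pr nsKG cKK coKp Gy oy nregy; have [sKG nKG] := andP nsKG.
have nKY : <[y]> \subset 'N(K) by rewrite cycle_subG (subsetP nKG).
pose S := (K <*> <[y]>)%G.
have sKS : K \subset S := joing_subl _ _.
have sYS : <[y]> \subset S := joing_subr _ _.
have sSG : S \subset G by rewrite join_subG sKG cycle_subG.
have nsKS' : ~~ (K \subset S^`(1)).
  apply: contra nregy => sKS'; rewrite -cent_cycle.
  have nR : S \subset 'N([~: K, <[y]>]).
    by rewrite join_subG commg_norml commg_normr.
  have sS'R : S^`(1) \subset [~: K, <[y]>].
    rewrite der1_min // quotientY ?commg_norml ?commg_normr // abelianY.
    rewrite !quotient_abelian ?cycle_abelian //= centsC.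
    by rewrite quotient_cents2 ?commg_norml ?commg_normr.
  have defR : [~: K, <[y]>] = K.
    by apply/eqP; rewrite eqEsubset commg_subl nKY (subset_trans sKS').
  by rewrite -{1}defR coprime_abel_cent_TI // [#|<[y]>|]oy.
case: (pickP [pred j : Iirr G |
    ~~ (K \subset cfker 'chi_j) && ~~ (#|G|`_p %| deg j)]) => [j /andP[]|none].
  by exists j.
have dvdG j : ~~ (K \subset cfker 'chi[G]_j) -> #|G|`_p %| deg j.
  by move=> Kj; have := none j; rewrite /= Kj => /negbFE.
have := dvd_deg_index sKS sSG nsKS' dvdG.
rewrite p_part pfactor_dvdn ?indexg_gt0 // -(Lagrange sSG) lognM ?cardG_gt0 //.
rewrite -{2}[logn p #|G : S|]add0n leq_add2r leqn0 lognE p_pr cardG_gt0 /=.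
by rewrite -oy cardSg.
Qed.

(** Minimal normal subgroups are elementary abelian [p]-groups here, hence of
    order [p], and the product of two of them would have rank 2. *)
Lemma rank1_monolith (gT : finGroupType) (G : {group gT}) (p : nat) :
    solvable G -> prime p -> 'r_p(G) <= 1 -> 'O_p^'(G) = 1 -> G :!=: 1 ->
  exists Z : {group gT}, [/\ Z <| G, #|Z| = p & monolith Z G].
Proof.
move=> solG p_pr rG Op'G ntG.
have minZp (Z : {group gT}) : minnormal Z G -> Z \subset G -> p.-abelem Z /\ #|Z| = p.
  move=> minZ sZG; have [nZG ntZ /is_abelemP[q q_pr abelZ]] := minnormal_solvable minZ sZG solG.
  have qp : q = p.
    apply: contraNeq ntZ => qp; rewrite -subG1 -Op'G pcore_max ?/normal ?sZG //.
    by apply: sub_in_pnat (abelem_pgroup abelZ) => r _ /eqnP->; rewrite !inE.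
  rewrite qp in abelZ; split=> //.
  have := leq_trans (p_rankS p sZG) rG; rewrite p_rank_abelem // => logZ.
  have := card_pgroup (abelem_pgroup abelZ).
  have : 0 < logn p #|Z|.
    rewrite logn_gt0 mem_primes p_pr cardG_gt0 /=.
    by have [] := pgroup_pdiv (abelem_pgroup abelZ) ntZ.
  by case: (logn _ _) logZ => [|[|]].
have [Z minZ sZG] := minnormal_exists ntG (normG G).
have [abelZ oZ] := minZp Z minZ sZG.
have [/andP[ntZ nZG] _] := mingroupP minZ.
have nsZG : Z <| G by apply/andP.
exists Z; split=> // M nsMG ntM; have [sMG nMG] := andP nsMG.
have [Z2 minZ2 sZ2M] := minnormal_exists ntM nMG.
have sZ2G := subset_trans sZ2M sMG.
have [abelZ2 oZ2] := minZp Z2 minZ2 sZ2G.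
have [/andP[ntZ2 nZ2G] _] := mingroupP minZ2.
apply: subset_trans sZ2M; apply: prime_meetG; rewrite ?oZ //.
apply: contraL rG => /eqP tiZ; rewrite -ltnNge.
have cZ : Z2 \subset 'C(Z).
  apply/commG1P/trivgP; rewrite -tiZ subsetI commg_subr commg_subl.
  by rewrite (subset_trans sZG) // (subset_trans sZ2G).
have defE := dprodEY cZ tiZ.
have abelE : p.-abelem (Z <*> Z2) by rewrite (dprod_abelem _ defE) abelZ.
have sEG : Z <*> Z2 \subset G by rewrite join_subG sZG.
apply: leq_trans (p_rankS p sEG); rewrite p_rank_abelem //.
by rewrite -(dprod_card defE) oZ oZ2 mulnn pfactorK.
Qed.

(** Every nonlinear irreducible character has codegree [a]. If [S] contains [Z] and
    [Z] is not contained in [S^`(1)], the order of [S] divides [a], by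
    [dvd_deg_index]; in particular the centralizer of
    [Z] is a [p]-group, and it is the Sylow [p]-subgroup, of rank 1. If it is cyclic
    it has order [p], because [G / Z] is abelian or has characters of codegree [a];
    if it is quaternion then it is [G], and it has order 8 by the same comparison. *)
Lemma single_cod_structure (gT : finGroupType) (G Z : {group gT}) (p a : nat) :
    prime p -> p.-nat a -> solvable G -> G^`(1) != 1 -> 'r_p(G) <= 1 ->
    Z <| G -> #|Z| = p -> monolith Z G ->
    (forall j : Iirr G, ~~ (G^`(1) \subset cfker 'chi_j) -> cod j = a) ->
  p = 2 /\ G \isog 'Q_8 \/
  exists P : {group gT},
    [/\ P <| G, #|P| = p, 'C_G(P) \subset P, cyclic (G / P) & P \proper G].
Proof.
move=> p_pr pa solG ntG' rG nsZG oZ mono codG.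
have [sZG nZG] := andP nsZG.
have ntZ : Z :!=: 1 by rewrite -cardG_gt1 oZ prime_gt1.
have cZZ : abelian Z by rewrite cyclic_abelian ?prime_cyclic ?oZ.
have sZG' : Z \subset G^`(1) by apply: (mono G^`(1)%G) => //; apply: der_normal.
have nlZ (j : Iirr G) : ~~ (Z \subset cfker 'chi_j) -> ~~ (G^`(1) \subset cfker 'chi_j).
  by apply: contra; apply: subset_trans.
have a_gt0 : 0 < a.
  have [|j Zj] := @exists_irr_nontrivial _ G Z; first by rewrite subG1.
  by rewrite -(codG j) ?cod_gt0 // nlZ.
have card_a (S : {group gT}) :
    Z \subset S -> S \subset G -> ~~ (Z \subset S^`(1)) -> #|S| %| a.
  move=> sZS sSG nsZS'; pose d := (#|G| %/ a)%N.
  have degZ (j : Iirr G) : ~~ (Z \subset cfker 'chi_j) -> (a * deg j)%N = #|G|.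
    by move=> Zj; rewrite -(codG j (nlZ j Zj)) cod_deg (monolith_faithful mono Zj) indexg1.
  have [|j0 Zj0] := @exists_irr_nontrivial _ G Z; first by rewrite subG1.
  have da : (a * d)%N = #|G| by rewrite mulnC divnK // -(degZ j0) // dvdn_mulr.
  have := dvd_deg_index sZS sSG nsZS' (d := d) _ => /(_ _)/dvdnP[|k def_k].
    by move=> j Zj; rewrite /d -(degZ j Zj) mulKn.
  have d_gt0 : 0 < d by move: (cardG_gt0 G); rewrite -da muln_gt0 => /andP[].
  apply/dvdnP; exists k; apply/eqP; rewrite -(eqn_pmul2r d_gt0) da -(Lagrange sSG).
  by rewrite def_k mulnA [(#|S| * k)%N]mulnC.
set C := 'C_G(Z)%G.
have sZC : Z \subset C by rewrite subsetI sZG.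
have pC : p.-group C.
  apply/pgroupP => q q_pr qC; have [x Cx ox] := Cauchy q_pr qC.
  have [Gx cZx] := setIP Cx; pose S := (Z <*> <[x]>)%G.
  have cSS : abelian S.
    by rewrite abelianY cycle_abelian cZZ /= cycle_subG.
  have sSG : S \subset G by rewrite join_subG sZG cycle_subG.
  have qa : q %| a.
    apply: dvdn_trans (card_a S (joing_subl _ _) sSG _).
      by rewrite -ox cardSg // joing_subr.
    by rewrite (derG1P cSS) subG1.
  by have := pnatPpi pa (_ : q \in \pi(a)); apply; rewrite mem_primes q_pr a_gt0.
have [P sylP] := Sylow_exists p G; have [sPG pP _] := and3P sylP.
have nsCG : C <| G by rewrite /normal subsetIl normsI ?normG ?norms_cent.
have defC : C :=: P.
  have sCP : C \subset P.
    apply: subset_trans (pcore_max pC nsCG) _.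
    by rewrite pcore_sub_Hall.
  apply/eqP; rewrite eqEsubset sCP subsetI sPG /=.
  have sZP : Z \subset P := subset_trans sZC sCP.
  have : Z :&: 'Z(P) != 1.
    apply: meet_center_nil ntZ; first exact: pgroup_nil pP.
    exact: normalS sZP sPG nsZG.
  move/prime_meetG; rewrite oZ => /(_ p_pr) sZZ.
  by rewrite centsC (subset_trans sZZ) // subsetIr.
have nsPG : P <| G by rewrite -defC.
have [_ nPG] := andP nsPG.
have sZP : Z \subset P by rewrite -defC.
have cycGP : cyclic (G / P) /\ #|G / P| %| p.-1.
  have kerG : 'ker_G (conj_aut Z) = P by rewrite ker_conj_aut -defC.
  have isoGP := first_isog_loc (conj_aut_morphism Z) nZG.
  rewrite kerG in isoGP.
  have sAut : conj_aut Z @* G \subset Aut Z by apply: Aut_conj_aut.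
  rewrite (isog_cyclic isoGP) (card_isog isoGP); split.
    by apply: cyclicS sAut _; apply: Aut_prime_cyclic; rewrite oZ.
  apply: dvdn_trans (cardSg sAut) _.
  by rewrite card_Aut_cyclic ?prime_cyclic ?oZ // totient_prime.
(* [d] is the degree of a nonlinear character of [G / Z], whose kernel supplies [p] *)
have quoZ (S : {group gT}) : S \subset G -> Z \subset S -> ~~ (Z \subset S^`(1)) ->
    ~~ (G^`(1) \subset Z) -> exists2 d, 1 < d & (p * #|S| * d)%N %| #|G|.
  move=> sSG sZS nsZS' nsG'Z.
  have [j /andP[Zj nj]] := exists_irr_sep nsZG nsG'Z.
  exists (deg j); first by rewrite ltn_neqAle eq_sym -deg_nonlinear nj deg_gt0.
  have sjG := cfker_sub ('chi_j).
  rewrite -(Lagrange sjG) -mulnA dvdn_mul //; first by rewrite -oZ cardSg.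
  by rewrite -cod_deg (codG j nj) dvdn_mul // card_a.
have rP : 'r_p(P) <= 1 by apply: leq_trans (p_rankS p sPG) rG.
have ntP : P :!=: 1 by apply: contraNneq ntZ => P1; rewrite -subG1 -P1.
have [cycP | ncycP] := boolP (cyclic P).
  right; exists P.
  suffices oP : #|P| = p.
    split=> //; [by rewrite -{2}defC setIS // centS | by case: cycGP | ].
    rewrite properE sPG; apply: contra ntG' => sGP; apply/eqP/derG1P.
    exact: abelianS sGP (cyclic_abelian cycP).
  have [m oP] := p_natP pP; case: m => [|[|m]] in oP *.
  - by case/negP: ntP; rewrite trivg_card1 oP.
  - by rewrite oP expn1.
  have nsZP' : ~~ (Z \subset P^`(1)).
    by rewrite (derG1P (cyclic_abelian cycP)) subG1.
  have sG'Z : G^`(1) \subset Z.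
    apply/idPn => /(quoZ P sPG sZP nsZP')[d _ dvdG].
    have : (#|P| * p)%N %| #|G| by apply: dvdn_trans dvdG; rewrite mulnC dvdn_mulr.
    rewrite -(Lagrange sPG) dvdn_pmul2l ?cardG_gt0 // => p_i.
    by have /and3P[_ _] := sylP; rewrite p'natE // p_i.
  (* [x ^+ p] is central because [x ^ g = x * [~ x, g]] with [[~ x, g]] in [Z] *)
  have [x defP] := cyclicP cycP.
  have Px : x \in P by rewrite defP cycle_id.
  have cxp g : g \in G -> commute g (x ^+ p).
    move=> Gg; have Zc : [~ x, g] \in Z.
      apply: (subsetP sG'Z); apply: mem_commg => //; exact: (subsetP sPG).
    apply/commute_sym/commgP/conjg_fixP; rewrite conjXg conjg_mulR expgMn.
      by rewrite (_ : [~ x, g] ^+ p = 1) ?mulg1 // -oZ expg_cardG.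
    apply: (centsP (cyclic_abelian cycP)) => //; exact: (subsetP sZP).
  case/eqP: ntG'; apply/derG1P; apply: abelianS (cyclic_abelian cycP).
  rewrite -defC subsetI subxx centsC; apply/subsetP => z Zz.
  have : z \in <[x]> by rewrite -defP (subsetP sZP).
  case/cycleP=> k def_z; have : x ^+ (k * p) = 1.
    by rewrite expgM -def_z -oZ expg_cardG.
  move/eqP; rewrite -order_dvdn -[#[x]]/(#|<[x]>|) -defP oP (expnSr p m.+1).
  rewrite dvdn_pmul2r ?prime_gt0 // expnS => /(dvdn_trans (dvdn_mulr _ (dvdnn p))).
  case/dvdnP=> l def_k; apply/centP => g Gg.
  by rewrite def_z def_k mulnC expgM; apply/commute_sym/commuteX/cxp.
left.
have Ohm1P : #|'Ohm_1(P)| = p.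
  suffices -> : 'Ohm_1(P) = Z by [].
  have sOZ : 'Ohm_1(P) \subset Z.
    rewrite (OhmE 1 pP) gen_subG; apply/subsetP => x; rewrite !inE expn1 => /andP[Px xp].
    have [-> // | ntx] := eqVneq x 1.
    pose A := (Z <*> <[x]>)%G.
    have cxZ : x \in 'C(Z) by have := Px; rewrite -defC inE => /andP[].
    have cAA : abelian A.
      by rewrite abelianY cycle_abelian cZZ /= cycle_subG.
    have sAP : A \subset P by rewrite join_subG sZP cycle_subG.
    have pA := pgroupS sAP pP.
    have ntA : A :!=: 1.
      by apply: contraNneq ntZ => A1; rewrite -subG1 -A1 joing_subl.
    have Op'A : 'O_p^'(A) = 1.
      apply/trivgP; rewrite -(coprime_TIg (pnat_coprime pA (pcore_pgroup p^' A))).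
      by rewrite subsetI pcore_sub subxx.
    have rA : 'r_p(A) <= 1 by apply: leq_trans (p_rankS p sAP) rP.
    have [Y [_ oY monoY]] := rank1_monolith (abelian_sol cAA) p_pr rA Op'A ntA.
    have ox : #[x] = p by apply: nt_prime_order => //; apply/eqP.
    have sYx : Y \subset <[x]>.
      by apply: monoY; rewrite ?cycle_eq1 // -sub_abelian_normal // joing_subr.
    have sYZ : Y \subset Z.
      by apply: monoY; rewrite // -sub_abelian_normal // joing_subl.
    have -> : x \in Z = (<[x]> \subset Z) by rewrite cycle_subG.
    suffices <- : Y :=: <[x]> by [].
    by apply/eqP; rewrite eqEcard sYx oY -[#|<[x]>|]/#[x] ox leqnn.
  apply/eqP; rewrite eqEsubset sOZ prime_meetG ?oZ //.
  by rewrite (setIidPr sOZ) Ohm1_eq1.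
have /prime_Ohm1P := Ohm1P; rewrite (negPf ncycP) /= => /(_ pP ntP)/andP[/eqP p2 /eqP].
case/quaternion_classP => n n_gt2 isoP; split=> //.
have defG : G :=: P.
  have [_] := cycGP; rewrite p2 dvdn1 card_quotient // => /eqP.
  move/eqP; rewrite indexg_eq1 => sGP; apply/eqP.
  by rewrite eqEsubset sGP sPG.
have [[x y] genP _] := generators_quaternion n_gt2 isoP.
have [oP Px ox _] := genP.
have [_ [_ _ oP' _] [_ _ invol _ _] _ _] := quaternion_structure n_gt2 genP isoP.
have sZx : Z \subset <[x]>.
  apply/subsetP => z Zz; have [-> // | ntz] := eqVneq z 1.
  rewrite (invol z) ?mem_cycle ?(subsetP sZP) //.
  by apply: nt_prime_order ntz; rewrite // -p2 -oZ expg_cardG.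
have sG'Z : G^`(1) \subset Z.
  apply/idPn => nsG'Z; have [|||d d_gt1] := quoZ <[x]>%G _ _ _ nsG'Z.
  - by rewrite cycle_subG (subsetP sPG).
  - exact: sZx.
  - by rewrite (derG1P (cycle_abelian x)) subG1.
  rewrite defG oP [#|_|]ox p2 -expnS prednK ?(ltn_trans _ n_gt2) //.
  by rewrite -{2}[(2 ^ n)%N]muln1 dvdn_pmul2l ?expn_gt0 // dvdn1 gtn_eqF.
have := cardSg sG'Z; rewrite /= oZ p2 defG /= oP' => /dvdn_leq.
move=> /(_ isT); rewrite -[X in _ <= X](expn1 2) leq_exp2l // => le_n.
have n3 : n = 3 by case: (n) n_gt2 le_n => [|[|[|[|]]]].
by move: isoP; rewrite n3.
Qed.

Lemma card_Q8 : #|[set: gsort 'Q_8]| = 8.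
Proof. exact: (@card_quaternion 3). Qed.

(** The characters of codegree other than [a] are nontrivial on the unique minimal
    normal subgroup [K], a [p']-group, and their codegrees are prime to [p], so that
    [p]-elements act freely on [K] by [nfree_exists_deg]. Hence [G] and [G / K] have
    [p]-rank 1, and [single_cod_structure] applies to [G / K]. *)
Lemma minimal_two_cods (gT : finGroupType) (G : {group gT}) (p a : nat) :
    coprime_cods G -> metab_cod G p a ->
    (exists2 i : Iirr G, ~~ (G^`(1) \subset cfker 'chi_i) & cod i != a) ->
    (forall M : {group gT}, M <| G -> M :!=: 1 -> forall j : Iirr G,
       ~~ (G^`(1) \subset cfker 'chi_j) -> M \subset cfker 'chi_j -> cod j = a) ->
  (exists N Q s, typeI G N Q s) \/ (exists K H s, typeII G K H p s).
Proof.
move=> cG mG [i0 ni0 cod_i0] codG; have solG := coprime_cods_solvable cG.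
have [p_pr pa pG'G'' _] := mG.
have ntG' : G^`(1) != 1 by apply: contraNneq ni0 => ->; apply: sub1G.
have prG'' : G^`(2) \proper G^`(1) by apply: sol_der1_proper (der_sub 1 G) _.
have [i1 ni1 [G''i1 [pi1 cod_i1]]] := metab_exists cG mG ntG'.
have ntG'' : G^`(2) != 1.
  apply: contraNneq cod_i0 => G''1; case: mG => _ _ _ /(_ i0 ni0) [] //.
    by rewrite [G^`(2)]G''1 sub1G.
  by move=> _ ->.
have [K minK sKG''] := minnormal_exists ntG'' (der_norm 2 G).
have sKG := subset_trans sKG'' (der_sub 2 G).
have sKG' := subset_trans sKG'' (der_subS 1 G).
have [/andP[ntK nKG] _] := mingroupP minK; have nsKG : K <| G by apply/andP.
have [_ _ /is_abelemP[r r_pr abelK]] := minnormal_solvable minK sKG solG.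
have [rK cKK _] := and3P abelK.
have nsG'K : ~~ (G^`(1) \subset K).
  by apply: contraL prG'' => /subset_trans/(_ sKG''); rewrite properE => ->; rewrite andbF.
have nlK (j : Iirr G) : ~~ (K \subset cfker 'chi_j) -> ~~ (G^`(1) \subset cfker 'chi_j).
  by apply: contra; apply: subset_trans.
have rp : r != p.
  apply: contraNneq cod_i0 => rp; have [Ki0 | Ki0] := boolP (K \subset cfker 'chi_i0).
    by rewrite (codG K).
  have K'1 : K^`(1) \subset cfker 'chi_i0 by rewrite (derG1P cKK) sub1G.
  have [q [q_pr]] := exists_prime_cod nsKG (sub1G K) K'1 (sub1G _) Ki0.
  rewrite indexg1 => qK qi0; have qp := prime_dvd_pnat rK q_pr qK; rewrite rp in qp.
  by rewrite -cod_i1 (cod_eq_dvd cG ni0 ni1 p_pr _ pi1) // -qp.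
have p'K : p^'.-group K.
  by apply: sub_in_pnat rK => q _ /eqnP->; rewrite !inE.
have coKp : coprime #|K| p by rewrite coprime_sym prime_coprime // -p'natE.
have monoK : monolith K G.
  move=> M nsMG ntM; apply/idPn => nsKM.
  have nsKMG : (K <*> M)%G <| G by rewrite normalY.
  have iKM : #|K <*> M : M| = #|K|.
    have tiKM := minnormal_TI minK sKG nsMG nsKM.
    rewrite joingC norm_joinEr ?(subset_trans sKG) ?normal_norm //.
    by rewrite indexMg -indexgI tiKM indexg1.
  have p'KM : ~~ (p %| #|K <*> M : M|) by rewrite iKM -p'natE.
  have KM' : (K <*> M)^`(1) \subset M.
    have nMK : K \subset 'N(M) by rewrite (subset_trans sKG) ?normal_norm.
    rewrite der1_min ?join_subG ?nMK ?normG // quotientYidr //.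
    exact: quotient_abelian.
  have nsG'M : ~~ (G^`(1) \subset M).
    by apply: contra nsKM; apply: subset_trans.
  have [j /andP[Mj Kj]] := exists_irr_sep nsMG nsKM.
  have KMj : ~~ (K <*> M \subset cfker 'chi_j).
    by apply: contra Kj; apply: subset_trans (joing_subl _ _).
  have [nj /eqP] := p'_section_cod cG mG nsMG nsKMG (joing_subr _ _) p'KM KM' nsG'M Mj KMj.
  by rewrite (codG M).
have Op'G : 'O_p^'(G) = K.
  apply/eqP; rewrite eq_sym eqEsubset pcore_max //=; apply/idPn => nsOK.
  have nsOG : 'O_p^'(G) <| G := pcore_normal _ _.
  have ntOK : 'O_p^'(G) / K != 1.
    by rewrite -subG1 quotient_sub1 // (subset_trans (normal_sub nsOG)).
  have [Eb minEb sEbO] := minnormal_exists ntOK (quotient_norms K (normal_norm nsOG)).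
  have sEbG := subset_trans sEbO (quotientS K (normal_sub nsOG)).
  have solGK : solvable (G / K) := quotient_sol K solG.
  have [nEbG ntEb /is_abelemP[q q_pr abelEb]] := minnormal_solvable minEb sEbG solGK.
  have nsEb : Eb <| G / K by apply/andP.
  have [E defE sKE nsEG] := inv_quotientN nsKG nsEb.
  have nKE : E \subset 'N(K) := subset_trans (normal_sub nsEG) nKG.
  have iEK : #|E : K| = #|Eb| by rewrite defE card_quotient.
  have p'E : ~~ (p %| #|E : K|).
    rewrite iEK -p'natE //; apply: pgroupS sEbO _.
    exact: quotient_pgroup (pcore_pgroup _ _).
  have E'K : E^`(1) \subset K.
    by rewrite der1_min // -defE (abelem_abelian abelEb).
  have nsEK : ~~ (E \subset K).
    by apply: contraNN ntEb => sEK; rewrite defE -subG1 quotient_sub1.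
  have [j /andP[Kj Ej]] := exists_irr_sep nsKG nsEK.
  have [nj /eqP] := p'_section_cod cG mG nsKG nsEG sKE p'E E'K nsG'K Kj Ej.
  by rewrite (codG K).
have p'codK (j : Iirr G) : ~~ (K \subset cfker 'chi_j) -> ~~ (p %| cod j).
  move=> Kj; have K'1 : K^`(1) \subset [1 gT] by rewrite (derG1P cKK).
  have p'K1 : ~~ (p %| #|K : [1 gT]|) by rewrite indexg1 -p'natE.
  have nsG'1 : ~~ (G^`(1) \subset [1 gT]) by rewrite subG1.
  by case: (p'_section_cod cG mG (normal1 G) nsKG (sub1G K) p'K1 K'1 nsG'1 (sub1G _) Kj).
have regK y : y \in G -> #[y] = p -> 'C_K[y] = 1.
  move=> Gy oy; apply/eqP/idPn => /(nfree_exists_deg p_pr nsKG cKK coKp Gy oy)[j Kj].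
  case/negP; have := cod_deg j; rewrite (monolith_faithful monoK Kj) indexg1 => <-.
  have p'j := p'codK j Kj.
  rewrite p_part lognM ?cod_gt0 ?deg_gt0 // lognE (negPf p'j) !andbF add0n.
  by rewrite -p_part dvdn_part.
have rG : 'r_p(G) <= 1.
  rewrite leqNgt; apply/p_rank_geP => [[E /pnElemP[sEG abelE E2]]].
  apply: (abelem_regular_rank1 p_pr cKK ntK abelE _ coKp E2).
    exact: subset_trans sEG nKG.
  apply: (semiregular_prime_elts (abelem_pgroup abelE)) => y Ey.
  by apply: regK; rewrite (subsetP sEG).
have rGK : 'r_p(G / K) <= 1 by rewrite p_rank_p'quotient.
have Op'GK : 'O_p^'(G / K) = 1 by rewrite pquotient_pcore // Op'G trivg_quotient.
have solGK : solvable (G / K) := quotient_sol K solG.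
have ntGK' : (G / K)^`(1) != 1.
  by rewrite -quotient_der // -subG1 quotient_sub1 // (subset_trans (der_sub 1 G)).
have ntGK : G / K != 1.
  by apply: contraNneq ntGK' => GK1; apply/eqP/trivgP; rewrite -GK1 der_sub.
have [Z [nsZ oZ monoZ]] := rank1_monolith solGK p_pr rGK Op'GK ntGK.
have codGK (j : Iirr (G / K)) : ~~ ((G / K)^`(1) \subset cfker 'chi_j) -> cod j = a.
  move=> nj; rewrite -(cod_mod j nsKG) (codG K) // -?nonlinear_mod //.
  by rewrite mod_IirrE // cfker_mod.
have [P sylP] := Sylow_exists p G; have [sPG pP _] := and3P sylP.
have regP : semiregular K P.
  by apply: semiregular_prime_elts pP _ => y Py; apply: regK; rewrite (subsetP sPG).
have nKP := subset_trans sPG nKG.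
have tiKP : K :&: P = 1 by rewrite setIC coprime_TIg // (pnat_coprime pP).
have [[p2 isoQ] | [Pb [nsPb oPb cPb cycPb prPb]]] :=
  single_cod_structure p_pr pa solGK ntGK' rGK nsZ oZ monoZ codGK.
- left; exists K, P, r.
  have pGK : p.-group (G / K).
    by rewrite /pgroup (card_isog isoQ) p2 card_Q8.
  have defPK : P / K = G / K.
    apply/eqP; rewrite eqEcard quotientS //= -(part_pnat_id pGK).
    by rewrite -(card_Hall (quotient_pHall nKP sylP)).
  have isoPQ : P \isog 'Q_8.
    by apply: (isog_trans _ isoQ); rewrite /= -defPK quotient_isog.
  have defG : K ><| P = G.
    rewrite sdprodE //; apply/eqP; rewrite eqEsubset mul_subG //=.
    by rewrite -quotientSK // defPK.
  have ntP : P :!=: 1.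
    by rewrite -cardG_gt1 (card_isog isoPQ) card_Q8.
  by split=> //; apply/(Frobenius_semiregularP defG).
right; have [H defH sKH nsHG] := inv_quotientN nsKG nsPb.
have [sHG nHG] := andP nsHG.
have nKH : H \subset 'N(K) := subset_trans sHG nKG.
have iHK : #|H : K| = p by rewrite -card_quotient // -defH.
have pH : p %| #|H| by rewrite -(Lagrange sKH) iHK dvdn_mull.
have [y Hy oy] := Cauchy p_pr pH.
have nKy : <[y]> \subset 'N(K) by rewrite cycle_subG (subsetP nKH).
have defH1 : K ><| <[y]> = H.
  have tiKy : K :&: <[y]> = 1 by rewrite coprime_TIg // -[#|<[y]>|]/#[y] oy.
  rewrite sdprodE //; apply/eqP; rewrite eqEcard mul_subG ?cycle_subG //=.
  by rewrite TI_cardMg // -(Lagrange sKH) iHK -[#|<[y]>|]/#[y] oy.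
exists K, H, r; split; [by [] | split=> // | | | by rewrite -defH].
- rewrite properE sHG; apply: contraTN prPb => sGH.
  by rewrite properE defH (quotientS K sGH) andbF.
- apply/existsP; exists <[y]>%G; apply/prime_FrobeniusP => //.
    by rewrite [#|_|]oy.
  by rewrite cent_cycle regK // (subsetP sHG).
by rewrite -(isog_cyclic (third_isog sKH nsKG nsHG)) -defH.
Qed.

(** * Inertia groups and centralizers *)

(** Brauer's permutation lemma for an abelian normal subgroup. *)
Lemma card_fixed_irr (gT : finGroupType) (G K : {group gT}) g :
    K <| G -> abelian K -> g \in G ->
  #|[set t : Iirr K | conjg_Iirr t g == t]| = #|'C_K[g]|.
Proof.
move=> nsKG cKK Gg; have [sKG nKG] := andP nsKG.
have actIirrK : is_action G (@conjg_Iirr _ K).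
  split=> [y j k eq_jk | j y z Gy Gz].
    by apply/irr_inj/(can_inj (cfConjgK y)); rewrite -!conjg_IirrE eq_jk.
  by apply: irr_inj; rewrite !conjg_IirrE (cfConjgM _ nsKG).
pose ito := Action actIirrK; pose cto := ('Js \ (subsetT G))%act.
have acts_Js : [acts G, on classes K | 'Js].
  apply/subsetP=> y Gy; have nKy := subsetP nKG y Gy.
  rewrite !inE; apply/subsetP=> _ /imsetP[z Gz ->] /[!inE]/=.
  rewrite -class_rcoset norm_rlcoset // class_lcoset.
  by apply: imset_f; rewrite memJ_norm.
have acts_cto : [acts G, on classes K | cto] by rewrite astabs_ract subsetIidl.
have classK : {in K, forall x, x ^: K = [set x]} by apply/abelian_classP.
transitivity #|'Fix_ito[g]|.
  by apply: eq_card => t; rewrite !inE sub1set inE.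
rewrite (card_afix_irr_classes (cto := cto)) //; last first.
  move=> j y _ Ky /imsetP[_ /imsetP[z Kz ->] ->].
  by have nKg := subsetP nKG g Gg; rewrite conjg_IirrE cfConjgEJ // cfunJ.
rewrite -(card_imset _ (@set1_inj gT)); apply: eq_card => C.
rewrite in_setI; apply/andP/imsetP => [[/imsetP[x Kx ->]] | [x]].
  rewrite classK // => /afix1P /= /eqP; rewrite conjg_set1 (inj_eq set1_inj) => /eqP xg.
  exists x => //; rewrite inE Kx; apply/cent1P/commgP/conjg_fixP.
  exact: xg.
rewrite inE => /andP[Kx /cent1P/commgP/conjg_fixP xg] ->; split.
  by rewrite -classK // mem_classes.
by apply/afix1P; rewrite /= conjg_set1 xg.
Qed.

(** Both sums count fixed points of all elements of [G], on [K] and on [Iirr K]. *)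
Lemma sum_card_cent_inertia (gT : finGroupType) (G K : {group gT}) :
    K <| G -> abelian K ->
  (\sum_(x in K) #|'C_G[x]| = \sum_(t : Iirr K) #|'I_G['chi_t]|)%N.
Proof.
move=> nsKG cKK; have [sKG nKG] := andP nsKG.
transitivity (\sum_(g in G) #|'C_K[g]|)%N.
  rewrite (eq_bigr (fun x => \sum_(g in G) (g \in 'C[x]))%N) => [|x Kx].
    rewrite exchange_big; apply: eq_bigr => g Gg; rewrite -sum1_card.
    rewrite [LHS]big_mkcond [RHS]big_mkcond; apply: eq_bigr => x _.
    by rewrite in_setI cent1C; case: (x \in K); case: (x \in 'C[g]).
  rewrite -sum1_card [LHS]big_mkcond [RHS]big_mkcond; apply: eq_bigr => g _.
  by rewrite in_setI; case: (g \in G); case: (g \in 'C[x]).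
rewrite (eq_bigr (fun g => \sum_(t : Iirr K) (g \in 'I_G['chi_t]))%N) => [|g Gg].
  rewrite exchange_big; apply: eq_bigr => t _; rewrite -sum1_card.
  rewrite [LHS]big_mkcond [RHS]big_mkcond; apply: eq_bigr => g _.
  by rewrite in_setI; case: (g \in G); case: (g \in 'I['chi_t]).
rewrite -(card_fixed_irr nsKG cKK Gg) -sum1_card big_mkcond.
apply: eq_bigr => t _; rewrite inE in_setI Gg [g \in 'I['chi_t]]inE.
by rewrite (subsetP nKG g Gg) -conjg_IirrE (inj_eq irr_inj); case: eqP.
Qed.

(** * Inertia groups in the two-step structure *)

Section TypeII.

Variables (gT : finGroupType) (G K H : {group gT}) (p s : nat).
Hypothesis tG : typeII G K H p s.

Let p_pr : prime p. Proof. by case: tG => [[]]. Qed.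
Let s_pr : prime s. Proof. by case: tG => [[]]. Qed.
Let abelK : s.-abelem K. Proof. by case: tG => [[]]. Qed.
Let minK : minnormal K G. Proof. by case: tG => [[]]. Qed.
Let nsKG : K <| G. Proof. by case: tG => _ []. Qed.
Let nsHG : H <| G. Proof. by case: tG => _ []. Qed.
Let iHK : #|H : K| = p. Proof. by case: tG => _ []. Qed.
Let frobHK : [Frobenius H with kernel K]. Proof. by case: tG. Qed.
Let cycGH : cyclic (G / H). Proof. by case: tG. Qed.
Let cHK : 'C_(G / K)(H / K) \subset H / K. Proof. by case: tG. Qed.
Let cKK : abelian K := abelem_abelian abelK.
Let sKG : K \subset G := normal_sub nsKG.
Let nKG : G \subset 'N(K) := normal_norm nsKG.
Let sHG : H \subset G := normal_sub nsHG.

Lemma typeII_sub : K \subset H.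
Proof. by have [_ _ /andP[]] := Frobenius_kerP frobHK. Qed.
Let sKH := typeII_sub.

Lemma typeII_nt : K :!=: 1.
Proof. by have [/andP[]] := mingroupP minK. Qed.

Lemma typeII_coprime : coprime #|K| p.
Proof. by rewrite -iHK; apply: Frobenius_ker_coprime. Qed.

Lemma typeII_free x : x \in K -> x != 1 -> 'C_H[x] \subset K.
Proof.
move=> Kx ntx; have [_ _ _ regK] := Frobenius_kerP frobHK.
by apply: regK; rewrite !inE ntx.
Qed.

Lemma typeII_cent : 'C_G(K) \subset K.
Proof.
have tiCH : 'C_G(K) :&: H \subset K.
  have [x Kx ntx] := trivgPn _ typeII_nt.
  apply: subset_trans (typeII_free Kx ntx); rewrite setIC setIS // subIset //.
  by rewrite -(cent_cycle x) centS ?orbT // cycle_subG.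
have nsC : 'C_G(K) <| G by rewrite norm_normalI // norms_cent.
have nKC : 'C_G(K) \subset 'N(K) by rewrite (subset_trans (normal_sub nsC)).
have : 'C_G(K) / K \subset H / K.
  apply: subset_trans cHK; rewrite subsetI quotientS ?subsetIl //=.
  apply: quotient_cents2r; rewrite (subset_trans _ tiCH) // subsetI.
  rewrite commg_subl commg_subr (subset_trans sHG (normal_norm nsC)) /=.
  exact: subset_trans (normal_sub nsC) (normal_norm nsHG).
rewrite quotientSGK // => sCH; apply: subset_trans tiCH.
by rewrite subsetI subxx.
Qed.

Lemma typeII_monolith : monolith K G.
Proof.
move=> M nsMG ntM; apply/idPn => nsKM; case/negP: ntM.
have tiKM := minnormal_TI minK sKG nsMG nsKM.
rewrite -subG1 -tiKM subsetI subxx andbT.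
apply: subset_trans typeII_cent; rewrite subsetI normal_sub //=.
apply/commG1P/trivgP; rewrite -tiKM subsetI commg_subr commg_subl.
by rewrite (subset_trans (normal_sub nsMG) nKG) (subset_trans sKG (normal_norm nsMG)).
Qed.

(** Conjugation embeds [G / H] in the automorphism group of [H / K], of order
    [p.-1]. *)
Lemma typeII_index : #|G : H| %| p.-1.
Proof.
have nKH : H \subset 'N(K) := subset_trans sHG nKG.
have oHb : #|H / K| = p by rewrite card_quotient.
have nHb : G / K \subset 'N(H / K) by rewrite quotient_norms ?normal_norm.
have cycHb : cyclic (H / K) by rewrite prime_cyclic ?oHb.
have kerG : 'ker_(G / K) (conj_aut (H / K)) = H / K.
  rewrite ker_conj_aut; apply/eqP; rewrite eqEsubset cHK subsetI quotientS //=.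
  exact: cyclic_abelian.
have isoGH := first_isog_loc (conj_aut_morphism (H / K)) nHb.
rewrite kerG in isoGH.
rewrite -card_quotient ?normal_norm // -(card_isog (third_isog sKH nsKG nsHG)).
rewrite (card_isog isoGH); apply: dvdn_trans (cardSg (Aut_conj_aut _ _)) _.
by rewrite card_Aut_cyclic // oHb totient_prime.
Qed.

Lemma typeII_index_coprime : coprime #|G : H| p.
Proof.
apply: (coprime_dvdl typeII_index); rewrite -{2}(prednK (prime_gt0 p_pr)).
exact: coprimenS.
Qed.

Lemma typeII_index_gt1 : 1 < #|G : H|.
Proof. by rewrite indexg_gt1; case: tG => _ [_ _ _ /andP[]]. Qed.

Lemma typeII_p_elt y : y \in G -> #[y] = p -> y \in H.
Proof.
move=> Gy oy; apply: contraLR typeII_index_coprime => nHy.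
rewrite coprime_sym prime_coprime // negbK.
have nHy' : y \in 'N(H) by rewrite (subsetP (normal_norm nsHG)).
have -> : p = #[coset H y].
  have : #[coset H y] %| p by rewrite -oy morph_order.
  case/primeP: p_pr => _ /[apply] /orP[] /eqP // o1.
  by case/negP: nHy; apply: (coset_idr nHy'); apply/eqP; rewrite -order_eq1 o1.
by rewrite -card_quotient ?normal_norm // order_dvdG // mem_quotient.
Qed.

Lemma typeII_cyclic_quo (T : {group gT}) :
  K \subset T -> T \subset G -> T :&: H \subset K ->
  cyclic (T / K) /\ #|T : K| %| #|G : H|.
Proof.
move=> sKT sTG sTHK; have nHT := subset_trans sTG (normal_norm nsHG).
have eqK : H :&: T = K.
  by apply/eqP; rewrite eqEsubset setIC sTHK subsetI sKT sKH.
have := second_isog nHT; rewrite eqK => isoT.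
rewrite -card_quotient ?(subset_trans sTG) // (isog_cyclic isoT) (card_isog isoT).
by rewrite -card_quotient ?normal_norm // (cyclicS _ cycGH) ?cardSg ?quotientS.
Qed.

Lemma typeII_inertia_cap (t : Iirr K) : t != 0%R -> 'I_G['chi_t] :&: H \subset K.
Proof.
move=> t0; rewrite setIAC (setIidPr sHG).
by rewrite (inertia_Frobenius_ker frobHK t0).
Qed.

(** The inertia group [T] of a nontrivial [t] is abelian modulo [cfker 'chi_t],
    being central by cyclic, so that every character of [T] over [t] is linear
    and every character of [G] over [t] has degree [#|G : T|]. *)
Lemma typeII_cod (i : Iirr G) (t : Iirr K) :
    ~~ (K \subset cfker 'chi_i) -> t \in irr_constt ('Res[K] 'chi_i) ->
  cod i = #|'I_G['chi_t]|.
Proof.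
move=> Ki it; have t0 := constt_Res_nontrivial nsKG Ki it.
have [r [rt _ dgi]] := Clifford_correspondent nsKG it.
set T := ('I_G['chi_t])%G in r rt dgi *.
have sTG : T \subset G := Inertia_sub _ _.
have sKT : K \subset T by rewrite sub_Inertia.
have nsKT : K <| T := normal_Inertia _ sKG.
have [cycT _] := typeII_cyclic_quo sKT sTG (typeII_inertia_cap t0).
have dt : deg t = 1%N by apply/eqP; rewrite -deg_nonlinear (derG1P cKK) sub1G.
pose L := (cfker 'chi_t)%G; have sLK : L \subset K := cfker_sub _.
have sKTL : [~: K, T] \subset L by apply: comm_inertia_ker; rewrite ?subsetIr.
have nLT : T \subset 'N(L) by rewrite -commg_subl (subset_trans _ sKTL) ?commSg.
have nsLT : L <| T by rewrite /normal (subset_trans sLK).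
have cTL : abelian (T / L).
  apply: (@cyclic_factor_abelian _ (K / L)%G (T / L)%G).
    rewrite subsetI quotientS //= quotient_cents2 ?(subset_trans sKT) //.
  by rewrite (isog_cyclic (third_isog sLK nsLT nsKT)).
have dr : deg r = 1%N.
  apply/eqP; rewrite -deg_nonlinear (subset_trans (der1_min nLT cTL)) //.
  by rewrite (constt_Ind_normal_ker nsLT sKT _ (subxx _)) // constt_Ind_Res.
have := cod_deg i; rewrite (monolith_faithful typeII_monolith Ki) indexg1 dgi dr.
by rewrite muln1 -(Lagrange sTG) => /eqP; rewrite eqn_pmul2r ?indexg_gt0 // => /eqP.
Qed.

Lemma typeII_der1 : K \subset G^`(1).
Proof.
have [//|nsKG'] := boolP (K \subset G^`(1)).
have [i /andP[G'i Ki]] := exists_irr_sep (der_normal 1 G) nsKG'.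
have G'1 : G^`(1) = 1.
  apply: contraNeq nsKG' => ntG'.
  exact: (typeII_monolith (M := G^`(1)%G)) (der_normal 1 G) ntG'.
have := typeII_cent; rewrite (setIidPl _) => [sGK|].
  have := typeII_index_gt1; rewrite indexg_gt1; case/negP.
  exact: subset_trans sKH.
have /derG1P cGG := G'1; apply: subset_trans cGG _; exact: centS.
Qed.

Lemma typeII_constt (t : Iirr K) :
  t != 0%R -> exists2 i : Iirr G, ~~ (K \subset cfker 'chi_i)
     & t \in irr_constt ('Res[K] 'chi_i).
Proof.
move=> t0; have [i ti] := constt_cfInd_irr t sKG; exists i.
  by apply: constt_Ind_ker ti _; rewrite ?subGcfker.
by rewrite -constt_Ind_Res.
Qed.

End TypeII.

(** By the Frattini argument the normalizer [B] of a Sylow [p]-subgroup [P] of [H]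
    is a complement of [K]; in it [P] is its own centralizer, of prime order, whence
    a Frobenius group. *)
Lemma typeII_complement (gT : finGroupType) (G K H : {group gT}) (p s : nat) :
    typeII G K H p s ->
  exists B P R : {group gT},
    [/\ K ><| B = G, [Frobenius B = P ><| R], #|P| = p, 'C_K(P) = 1 & P \subset H]
    /\ cyclic R /\ #|R| = #|G : H|.
Proof.
move=> tG; have [[p_pr s_pr abelK minK] [nsKG nsHG iHK prHG] frobHK cycGH cHK] := tG.
have sKH := typeII_sub tG; have ntK := typeII_nt tG.
have [sKG nKG] := andP nsKG; have [sHG nHG] := andP nsHG.
have coKp := typeII_coprime tG; have coGHp := typeII_index_coprime tG.
have nKH := subset_trans sHG nKG.
have oH : #|H| = (#|K| * p)%N by rewrite -(Lagrange sKH) iHK.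
have pH : p %| #|H| by rewrite oH dvdn_mull.
have [y Hy oy] := Cauchy p_pr pH; pose P := <[y]>%G.
have oP : #|P| = p by rewrite [#|P|]oy.
have sPH : P \subset H by rewrite cycle_subG.
have sPG := subset_trans sPH sHG.
have tiKP : K :&: P = 1 by rewrite coprime_TIg // oP.
have sylP : p.-Sylow(H) P.
  have p'K : (#|K|`_p)%N = 1%N.
    by apply: part_p'nat; rewrite p'natE // -prime_coprime // coprime_sym.
  rewrite pHallE sPH oP oH partnM ?cardG_gt0 ?prime_gt0 // p'K mul1n /=.
  by rewrite part_pnat_id // pnat_id.
have cKP : 'C_K(P) = 1.
  apply/trivgP/subsetP => x /setIP[Kx cPx]; apply/set1P/eqP/idPn => ntx.
  have sPK : P \subset K.
    apply: subset_trans (typeII_free tG Kx ntx); rewrite subsetI sPH /=.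
    by rewrite sub_cent1.
  by move: oP p_pr; rewrite -(setIidPr sPK) tiKP cards1 => <-.
pose B := 'N_G(P)%G.
have sPB : P \subset B by rewrite subsetI sPG normG.
have nsPB : P <| B by rewrite /normal sPB subsetIr.
have sBG : B \subset G := subsetIl _ _.
have tiKB : K :&: B = 1.
  apply/trivgP; rewrite -cKP subsetI subsetIl; apply/commG1P/trivgP.
  rewrite -tiKP commg_subI // subsetI ?subxx ?subsetIl ?(subset_trans sPG) //=.
  by rewrite (subset_trans (subsetIr _ _)) ?subsetIr.
have defG : K ><| B = G.
  rewrite sdprodE ?(subset_trans sBG) //; apply/eqP; rewrite eqEsubset mul_subG //=.
  rewrite -{1}(Frattini_arg nsHG sylP).
  have [_ <- _ _] : [/\ True, K * P = H, True & True].
    split=> //; apply/eqP; rewrite eqEcard mul_subG //=.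
    by rewrite TI_cardMg // oH oP.
  by rewrite -mulgA mulgS // mul_subG.
have oB : #|B| = (p * #|G : H|)%N.
  have := sdprod_card defG; rewrite -(Lagrange sHG) oH -mulnA => /eqP.
  by rewrite eqn_pmul2l ?cardG_gt0 // => /eqP.
have iBP : #|B : P| = #|G : H|.
  apply/eqP; rewrite -(eqn_pmul2l (prime_gt0 p_pr)) -{1}oP Lagrange // oB.
  by [].
have defBH : B :&: H = P.
  apply/eqP; rewrite eq_sym eqEcard subsetI sPB sPH /= oP.
  have nKBH : B :&: H \subset 'N(K) by rewrite subIset // (subset_trans sBG).
  have tiBHK : K :&: (B :&: H) = 1 by rewrite setIA tiKB (setIidPl (sub1G _)).
  have := quotient_isog nKBH tiBHK => /card_isog ->; rewrite -iHK.
  by rewrite -card_quotient // subset_leq_card // quotientS ?subsetIr.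
have cBP : 'C_B(P) \subset P.
  rewrite -{2}defBH subsetI subsetIl /=.
  have sCG : 'C_B(P) \subset G by rewrite subIset ?sBG.
  have defHK : H / K = P / K.
    by apply/eqP; rewrite eq_sym eqEcard quotientS //= card_quotient // iHK
      -(card_isog (quotient_isog (subset_trans sPG nKG) tiKP)) oP.
  have : 'C_B(P) / K \subset H / K.
    apply: subset_trans cHK; rewrite subsetI quotientS //=.
    by rewrite defHK quotient_cents ?subsetIr.
  by rewrite quotientSGK // (subset_trans sCG).
have hallP : Hall B P by rewrite /Hall sPB oP iBP coprime_sym.
have /splitsP[R /complP[tiPR defPR]] := SchurZassenhaus_split hallP nsPB.
have sRB : R \subset B by rewrite -defPR mulG_subr.
have defB : P ><| R = B.
  by rewrite sdprodE // (subset_trans sRB) // normal_norm.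
have oR : #|R| = #|G : H|.
  apply/eqP; rewrite -(eqn_pmul2l (prime_gt0 p_pr)) -{1}oP (sdprod_card defB) oB.
  by [].
have ntR : R :!=: 1 by rewrite -cardG_gt1 oR (typeII_index_gt1 tG).
have nHB : B \subset 'N(H) by rewrite (subset_trans sBG).
have cycR : cyclic R.
  rewrite (isog_cyclic (sdprod_isog defB)).
  have := second_isog nHB; rewrite setIC defBH => isoB.
  by rewrite (isog_cyclic isoB) (cyclicS _ cycGH) ?quotientS.
exists B, P, R; split=> //; split=> //.
apply/(Frobenius_semiregularP defB) => // [|g /setD1P[ntg Rg]].
  by rewrite -cardG_gt1 oP prime_gt1.
apply: contraNeq ntg => nreg.
have sPC : P \subset 'C[g] by apply: prime_meetG nreg; rewrite oP.
rewrite -cycle_eq1 -subG1 -tiPR subsetI !cycle_subG Rg andbT.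
rewrite (subsetP cBP) // inE (subsetP sRB) //=.
by rewrite -sub_cent1.
Qed.

Section TypeIICod.

Variables (gT : finGroupType) (G K H : {group gT}) (p s c : nat).
Hypotheses (tG : typeII G K H p s).
Hypothesis codG : forall i : Iirr G, ~~ (K \subset cfker 'chi_i) -> cod i = c.

Let nsKG : K <| G. Proof. by case: tG => _ []. Qed.
Let sKG : K \subset G := normal_sub nsKG.
Let nKG : G \subset 'N(K) := normal_norm nsKG.
Let nsHG : H <| G. Proof. by case: tG => _ []. Qed.
Let cKK : abelian K.
Proof. by case: tG => [[_ _ /abelem_abelian]]. Qed.
Let ntK : K :!=: 1 := typeII_nt tG.
Let p_pr : prime p. Proof. by case: tG => [[]]. Qed.

Lemma typeII_inertia (t : Iirr K) : t != 0%R -> #|'I_G['chi_t]| = c.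
Proof.
move=> t0; have [i Ki it] := typeII_constt tG t0.
by rewrite -(typeII_cod tG Ki it) codG.
Qed.

(** By [card_fixed_irr], [g] fixes a nontrivial character of [K]. *)
Lemma typeII_fix g : g \in G -> 'C_K[g] != 1 -> (#|K <*> <[g]>| %| c)%N.
Proof.
move=> Gg; rewrite -cardG_gt1 -(card_fixed_irr nsKG cKK Gg) (cardD1 (0 : Iirr K)%R).
rewrite inE conjg_Iirr0 eqxx ltnS => /card_gt0P[t].
rewrite !inE => /andP[t0 /eqP tg]; rewrite -(typeII_inertia t0) cardSg //.
rewrite join_subG sub_Inertia // cycle_subG inE Gg inE (subsetP nKG) //=.
by rewrite -conjg_IirrE tg.
Qed.

Lemma typeII_exists_nontrivial : exists t : Iirr K, t != 0%R.
Proof. by have [t] := has_nonprincipal_irr ntK; exists t. Qed.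

(** The centralizers [C] of the nontrivial elements of [K] are cyclic modulo [K],
    hence are generated by [K] and an element with nontrivial fixed points in
    [K]; so their orders divide [c], and the sum of their orders forces equality. *)
Lemma typeII_cent_card x : x \in K -> x != 1 -> #|'C_G[x]| = c.
Proof.
have dvd_c y : y \in K -> y != 1 -> #|'C_G[y]| %| c.
  move=> Ky nty; have sCG : 'C_G[y] \subset G := subsetIl _ _.
  have sKC : K \subset 'C_G[y] by rewrite subsetI sKG sub_cent1 (subsetP cKK).
  have sCHK : 'C_G[y] :&: H \subset K.
    by rewrite setIAC (setIidPr (normal_sub nsHG)) (typeII_free tG).
  have [/cyclicP[gb defC] _] := typeII_cyclic_quo tG sKC sCG sCHK.
  have : gb \in 'C_G[y] / K by rewrite defC cycle_id.
  case/morphimP => g nKg Cg def_gb; have [Gg cyg] := setIP Cg.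
  suffices -> : 'C_G[y] = K <*> <[g]>.
    apply: typeII_fix Gg _; apply/trivgPn; exists y => //.
    by rewrite inE Ky cent1C.
  apply/eqP; rewrite eq_sym eqEsubset join_subG sKC cycle_subG Cg /=.
  rewrite -(quotientSGK _ (joing_subl _ _)) ?(subset_trans sCG) //.
  by rewrite quotientYidl ?cycle_subG // quotient_cycle // defC def_gb.
have [t0 nt0] := typeII_exists_nontrivial.
have c_gt0 : 0 < c by rewrite -(typeII_inertia nt0).
have le_c y : y \in K^# -> #|'C_G[y]| <= c ?= iff (#|'C_G[y]| == c).
  by case/setD1P=> nty Ky; split=> //; apply: dvdn_leq => //; apply: dvd_c.
have := sum_card_cent_inertia nsKG cKK.
rewrite (bigD1 1) ?group1 //= (bigD1 (0 : Iirr K)%R) //=.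
have -> : 'C_G[1] = G by rewrite (setIidPl _) // sub_cent1 group1.
rewrite irr0 Inertia1 // => /eqP; rewrite eqn_add2l => /eqP sumC.
move=> Kx ntx; have [_] := leqif_sum le_c.
rewrite sum_nat_const.
have -> : (\sum_(y in K^#) #|'C_G[y]| = \sum_(y in K | y != 1%g) #|'C_G[y]|)%N.
  by apply: eq_bigl => y; rewrite !inE andbC.
rewrite sumC (eq_bigr (fun=> c)) => [|t nt]; last exact: typeII_inertia.
rewrite sum_nat_const.
have -> : #|[pred t : Iirr K | t != 0%R]| = #|K^#|.
  have := card_Iirr_abelian cKK; rewrite (cardsD1 1 K) group1 (cardD1 0%R) inE /=.
  move=> /addnI <-; by apply: eq_card => t; rewrite !inE andbT.
rewrite eqxx => /esym/forall_inP eqc; apply/eqP/eqc.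
by rewrite !inE ntx.
Qed.

Lemma typeII_dvd_c : (#|K| %| c)%N.
Proof.
have [t nt] := typeII_exists_nontrivial.
by rewrite -(typeII_inertia nt) cardSg // sub_Inertia.
Qed.

Lemma typeII_dvd_index : (c %/ #|K|)%N %| #|G : H|.
Proof.
have [t nt] := typeII_exists_nontrivial.
have sKT : K \subset 'I_G['chi_t] by rewrite sub_Inertia.
have [_] := typeII_cyclic_quo tG sKT (Inertia_sub _ _) (typeII_inertia_cap tG nt).
by rewrite -divgS // (typeII_inertia nt).
Qed.

(** An element of prime order [l] of the complement [R] of the Frobenius group
    [B] has nontrivial fixed points in [K], by [Frobenius_compl_cent]. *)
Lemma typeII_prime_dvd l : prime l -> l %| #|G : H| -> l %| (c %/ #|K|)%N.
Proof.
move=> l_pr lGH.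
have [B [P [R [[defG frobB oP cKP sPH] [cycR oR]]]]] := typeII_complement tG.
have [_ sBG _ nKB tiKB] := sdprod_context defG.
have [defB _ _ _ /proper_sub sRB] := Frobenius_context frobB.
have [nsPB _ _ _ _] := sdprod_context defB; have sPB := normal_sub nsPB.
rewrite -oR in lGH; have [g Rg og] := Cauchy l_pr lGH.
have ntg : <[g]> != 1 by rewrite cycle_eq1 -order_gt1 og prime_gt1.
have sgR : <[g]> \subset R by rewrite cycle_subG.
have sgB := subset_trans sgR sRB.
have frobF := Frobenius_subr ntg sgR frobB.
have Gg : g \in G by rewrite (subsetP sBG) // -cycle_subG.
have nreg : 'C_K[g] != 1.
  apply: contraNneq ntK => regg; apply/eqP.
  apply: (Frobenius_compl_cent cKK frobF _ _ cKP); last by rewrite cent_cycle.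
    by rewrite (subset_trans _ nKB) // join_subG sPB.
  by rewrite oP (typeII_coprime tG).
have := typeII_fix Gg nreg.
have tig : K :&: <[g]> = 1.
  by apply/trivgP; rewrite -tiKB setIS.
rewrite norm_joinEr ?(subset_trans sgB) // TI_cardMg // [#|<[g]>|]og.
by rewrite -{1}(divnK typeII_dvd_c) mulnC dvdn_pmul2r ?cardG_gt0.
Qed.

End TypeIICod.

(** ** Arithmetic of fixed points *)

(** In [typeII_count], [q] is the order of [K] and [x] is the number of elements of
    [K] fixed by a subgroup that has [p] conjugates. *)
Section FixedPointArithmetic.

Variables (s p q x : nat).
Hypotheses (s_pr : prime s) (p_gt1 : 1 < p) (sq : s.-nat q) (q_gt1 : 1 < q).
Hypotheses (x_q : x %| q) (eq_px : (p * x.-1)%N = q.-1).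

Let x_gt1 : 1 < x.
Proof. by case: x eq_px => [|[|n]] //; rewrite muln0; case: q q_gt1 => [|[]]. Qed.

Let x1_gt0 : 0 < x.-1.
Proof. by rewrite -ltnS (ltn_predK x_gt1). Qed.

Let def_q : exists z, [/\ q = (x * z)%N, s.-nat z & 1 < z].
Proof.
have /dvdnP[z def_q] := x_q; exists z; split; first by rewrite mulnC.
  by apply: pnat_dvd sq; rewrite def_q dvdn_mulr.
case: z def_q => [|[|z]] //; first by rewrite mul0n => q0; move: q_gt1; rewrite q0.
rewrite mul1n => q_x; move: eq_px; rewrite q_x -{2}[x.-1]mul1n => /eqP.
by rewrite eqn_pmul2r // => /eqP p1; move: p_gt1; rewrite p1.
Qed.

Lemma fix_arith_sqr : (x * x)%N <= q.
Proof.
have [z [q_xz sz z_gt1]] := def_q; rewrite q_xz leq_pmul2l ?(ltnW x_gt1) //.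
rewrite leqNgt; apply/negP => z_x.
have eq1 : (p * x.-1 = z * x.-1 + z.-1)%N.
  rewrite eq_px q_xz; move: x_gt1 z_gt1; case: (x) => // u; case: (z) => // v _ _.
  by rewrite /= mulSn mulnS; lia.
have : x.-1 %| z.-1 by rewrite -(dvdn_addr _ (dvdn_mull z (dvdnn x.-1))) -eq1 dvdn_mull.
move/dvdn_leq => /(_ _) le; move: (le); rewrite -ltnS (ltn_predK z_gt1).
by move/(_ z_gt1); rewrite leqNgt -ltnS (ltn_predK x_gt1) (ltn_predK z_gt1) z_x.
Qed.

Lemma fix_arith_part m : m %| p.-1 -> (m`_s)%N %| x.
Proof.
move=> mp; have [z [q_xz sz z_gt1]] := def_q.
have eq2 : (p.-1 * x.-1 = x * z.-1)%N.
  move: eq_px; rewrite q_xz; move: x_gt1 z_gt1 p_gt1.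
  case: (x) => // u; case: (z) => // v; case: (p) => // r _ _ _ /=.
  by rewrite mulSn mulnS; lia.
have sz' : s %| z.
  have [k def_z] := p_natP sz; case: k def_z z_gt1 => [->//|k ->] _.
  by rewrite expnS dvdn_mulr.
have co : coprime (m`_s)%N z.-1.
  rewrite p_part coprimeXl // prime_coprime //; apply: contraL s_pr => sz1.
  have : s %| 1 by rewrite -(dvdn_addr _ sz1) addn1 (ltn_predK z_gt1).
  by rewrite dvdn1 => /eqP->.
rewrite -(Gauss_dvdl _ co) -eq2 dvdn_mulr //.
exact: dvdn_trans (dvdn_part _ _) mp.
Qed.

(** A smaller power [y] of [s] with [p %| y.-1] makes [p] less than both [y] and
    [q %/ y], so that [q > p ^ 2], whereas [x ^ 2 <= q] gives [x <= p] and [q <= p ^ 2]. *)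
Lemma fix_arith_min y : prime p -> s != p -> s.-nat y -> 1 < y -> p %| y.-1 -> q <= y.
Proof.
move=> p_pr sp sy y_gt1 py; rewrite leqNgt; apply/negP => y_q.
have [k def_y] := p_natP sy; have [n defq] := p_natP sq.
have kn : k < n by rewrite -(ltn_exp2l _ _ (prime_gt1 s_pr)) -def_y -defq.
pose w := (s ^ (n - k))%N.
have q_yw : q = (y * w)%N by rewrite defq def_y -expnD subnKC // ltnW.
have w_gt1 : 1 < w by rewrite -(expn0 s) ltn_exp2l ?prime_gt1 // subn_gt0.
have co : coprime p y.
  by rewrite def_y coprimeXr // prime_coprime // dvdn_prime2 // eq_sym.
have pw : p %| w.-1.
  rewrite -(Gauss_dvdr _ co).
  have eq3 : (q.-1 = y * w.-1 + y.-1)%N.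
    rewrite q_yw; move: y_gt1 w_gt1; case: (y) => // u; case: (w) => // v _ _ /=.
    by rewrite mulSn mulnS; lia.
  by rewrite -(dvdn_addl _ py) -eq3 -eq_px dvdn_mulr.
have le_w : p < w.
  by rewrite -(ltn_predK w_gt1) ltnS dvdn_leq // -ltnS (ltn_predK w_gt1).
have le_y : p < y.
  by rewrite -(ltn_predK y_gt1) ltnS dvdn_leq // -ltnS (ltn_predK y_gt1).
have le_q : (p.+1 * p.+1)%N <= q by rewrite q_yw leq_mul.
have le_x : x.+1 <= p.
  rewrite -(leq_pmul2r x1_gt0) eq_px -ltnS (ltn_predK q_gt1).
  apply: leq_trans fix_arith_sqr; rewrite -[X in (X.+1 * _)%N](ltn_predK x_gt1).
  by rewrite -[X in _ <= (X * X)%N](ltn_predK x_gt1); move: x.-1 => u; lia.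
have := leq_trans le_q (eq_leq (esym (ltn_predK q_gt1))).
rewrite -eq_px => le1.
have le2 : (p * x.-1).+1 <= (p * p).+1.
  by rewrite ltnS leq_mul // (leq_trans (leq_pred _)) // ltnW.
have := leq_trans le1 le2; rewrite mulSn mulnS; move: p_gt1 => p1 {le1 le2}; lia.
Qed.

End FixedPointArithmetic.

(** With [R0] the subgroup of order [m] of the Frobenius complement [R], the
    nontrivial elements of [K] fixed by [R0] and their conjugates under [P]
    make up [K^#], without repetitions. *)
Lemma typeII_count (gT : finGroupType) (G K H : {group gT}) (p s c : nat) :
    solvable G -> typeII G K H p s ->
    (forall i : Iirr G, ~~ (K \subset cfker 'chi_i) -> cod i = c) ->
  exists2 x, x %| #|K| & (p * x.-1)%N = #|K|.-1.
Proof.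
move=> solG tG codG.
have [[p_pr s_pr abelK minK] [nsKG nsHG iHK prHG] frobHK cycGH cHK] := tG.
have ntK := typeII_nt tG; have cKK := abelem_abelian abelK.
have [sKG nKG] := andP nsKG; have coGHp := typeII_index_coprime tG.
have [B [P [R [[defG frobB oP cKP sPH] [cycR oR]]]]] := typeII_complement tG.
have [_ sBG defKB nKB tiKB] := sdprod_context defG.
have [defB ntP ntR _ /proper_sub sRB] := Frobenius_context frobB.
have [nsPB _ defPR _ tiPR] := sdprod_context defB; have sPB := normal_sub nsPB.
pose m := (c %/ #|K|)%N.
have c_eq : c = (m * #|K|)%N by rewrite divnK // (typeII_dvd_c tG codG).
have m_gt1 : 1 < m.
  have i_gt1 := typeII_index_gt1 tG.
  have l_pr := pdiv_prime i_gt1.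
  have m_l := typeII_prime_dvd tG codG l_pr (pdiv_dvd _).
  apply: leq_trans (prime_gt1 l_pr) (dvdn_leq _ m_l).
  rewrite lt0n; apply: contraTneq (typeII_dvd_index tG codG) => ->.
  by rewrite dvd0n -lt0n indexg_gt0.
have cardCB w : w \in K -> w != 1 -> #|'C_B[w]| = m.
  move=> Kw ntw; have := typeII_cent_card tG codG Kw ntw.
  have sKC : K \subset 'C[w] by rewrite sub_cent1 (subsetP cKK).
  have -> : 'C_G[w] = K * 'C_B[w].
    by rewrite (group_modl _ sKC) defKB.
  rewrite TI_cardMg; last first.
    by apply/trivgP; rewrite -tiKB setIS ?subsetIl.
  by rewrite c_eq mulnC => /eqP; rewrite eqn_pmul2r ?cardG_gt0 // => /eqP.
have p'm : p^'.-nat m.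
  rewrite p'natE // ?(ltnW m_gt1) // -prime_coprime // coprime_sym.
  exact: coprime_dvdl (typeII_dvd_index tG codG) coGHp.
have hallR : p^'.-Hall(B) R.
  rewrite /pHall sRB /pgroup oR p'natE ?indexg_gt0 // -prime_coprime //.
  rewrite coprime_sym coGHp /= -divgS // -(sdprod_card defB) mulnK ?cardG_gt0 //.
  by rewrite oP pnatNK pnat_id.
have solB : solvable B := solvableS sBG solG.
have conjR w : w \in K -> w != 1 -> exists2 u, u \in P & 'C_B[w] :^ u \subset R.
  move=> Kw ntw; have p'C : p^'.-group 'C_B[w] by rewrite /pgroup cardCB.
  have [b Bb sCR] := Hall_Jsub solB hallR (subsetIl _ _) p'C.
  have /mulsgP[u r Pu Rr def_b] : b \in P * R by rewrite defPR.
  by exists u => //; rewrite -(conjSg _ _ r) -conjsgM -def_b conjGid.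
have [w0 Kw0 ntw0] := trivgPn _ ntK.
have [u0 Pu0 sC0R] := conjR w0 Kw0 ntw0.
pose R0 := ('C_B[w0] :^ u0)%G.
have oR0 : #|R0| = m by rewrite cardJg cardCB.
have ntR0 : R0 :!=: 1 by rewrite -cardG_gt1 oR0.
have sR0B : R0 \subset B := subset_trans sC0R sRB.
have CB_R0 w : w \in K -> w != 1 -> exists2 u, u \in P & 'C_B[w] :^ u = R0.
  move=> Kw ntw; have [u Pu sCR] := conjR w Kw ntw; exists u => //; apply/eqP.
  by rewrite (@eq_subG_cyclic _ R ('C_B[w] :^ u)%G R0) // oR0 cardJg cardCB.
have CB_fix v : v \in 'C_K(R0)^# -> 'C_B[v] = R0.
  case/setD1P=> ntv /setIP[Kv cRv]; apply/eqP; rewrite eq_sym eqEcard oR0 cardCB //.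
  by rewrite subsetI sR0B /= leqnn andbT sub_cent1.
have NPR0 n : n \in P -> R0 :^ n = R0 -> n = 1.
  move=> Pn nR0; have [a R0a nta] := trivgPn _ ntR0.
  have Ra : a \in R^# by rewrite !inE nta (subsetP sC0R).
  have : n \in 'C_P[a].
    rewrite inE Pn; apply/cent1P/commgP; rewrite -in_set1 -[[set 1]]/[1] -tiPR inE.
    apply/andP; split.
      have nPa : a \in 'N(P) by rewrite (subsetP (normal_norm nsPB)) // (subsetP sR0B).
      by rewrite commgEl groupM ?groupV // memJ_norm.
    rewrite (subsetP sC0R) // commgEr groupM //.
    have : a^-1 ^ n \in R0 :^ n by rewrite memJ_conjg groupV.
    by rewrite nR0.
  by rewrite (Frobenius_reg_ker frobB Ra) => /set1P.
exists #|'C_K(R0)|; first by rewrite cardSg ?subsetIl.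
pose f (uv : gT * gT) := uv.2 ^ uv.1.
have KB u v : u \in P -> v \in K -> v ^ u \in K.
  by move=> Pu Kv; rewrite memJ_norm // (subsetP nKB) // (subsetP sPB).
have injf : {in setX P 'C_K(R0)^# &, injective f}.
  move=> [u v] [u' v'] /setXP[/= Pu Cv] /setXP[/= Pu' Cv']; rewrite /f /= => eqvv.
  have eqR u1 v1 : u1 \in P -> v1 \in 'C_K(R0)^# -> 'C_B[v1 ^ u1] = R0 :^ u1.
    by move=> Pu1 Cv1; rewrite -(CB_fix v1) // conjIg conjGid ?(subsetP sPB) // cent1J.
  have : R0 :^ (u * u'^-1) = R0.
    by rewrite conjsgM -(eqR u v) // eqvv (eqR u' v') // conjsgK.
  move/(NPR0 _ (groupM Pu (groupVr Pu')))/(canRL (mulgKV _)); rewrite mul1g => eqU.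
  by rewrite eqU in eqvv *; rewrite (@conjg_inj _ u' _ _ eqvv).
have imf : f @: setX P 'C_K(R0)^# = K^#.
  apply/setP=> w; apply/imsetP/setD1P => [[[u v] /setXP[/= Pu /setD1P[ntv /setIP[Kv _]]] ->] | [ntw Kw]].
    by rewrite /f /= conjg_eq1 ntv KB.
  have [u Pu defR0] := CB_R0 w Kw ntw.
  exists (u^-1, w ^ u); last by rewrite /f /= conjgK.
  rewrite inE /= groupV Pu !inE conjg_eq1 ntw KB //=.
  rewrite -sub_cent1 -defR0 cent1J conjSg subsetIr //.
have := card_in_imset injf; rewrite imf cardsX oP => eqc.
have -> : #|K|.-1 = #|K^#| by rewrite (cardsD1 1 K) group1.
by rewrite eqc (cardsD1 1 'C_K(R0)) group1.
Qed.

(** * Lifting the structure from the quotient by a minimal normal subgroup *)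

Lemma metab_p_cod (gT : finGroupType) (G : {group gT}) (p a q : nat) (i : Iirr G) :
    coprime_cods G -> metab_cod G p a -> ~~ (G^`(1) \subset cfker 'chi_i) ->
    p %| cod i ->
  cod i = a /\ (prime q -> q %| cod i -> q = p).
Proof.
move=> cG mG ni pi; have [p_pr pa _ _] := mG.
have ntG' : G^`(1) != 1 by apply: contraNneq ni => ->; apply: sub1G.
have [k nk [_ [pk cod_k]]] := metab_exists cG mG ntG'.
have cod_i : cod i = a by rewrite (cod_eq_dvd cG ni nk p_pr pi pk).
by split=> // q_pr qi; apply: prime_dvd_pnat pa q_pr _; rewrite -cod_i.
Qed.

Lemma comm_cent1_free (gT : finGroupType) (A : {group gT}) z :
  z \in 'N(A) -> 'C_A[z] = 1 -> [set [~ x, z] | x in A] = A.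
Proof.
move=> nAz regz; apply/eqP; rewrite eqEcard; apply/andP; split.
  by apply/subsetP=> _ /imsetP[x Ax ->]; rewrite commgEl groupM ?groupV // memJ_norm.
rewrite card_in_imset // => x y Ax Ay eqf.
apply/eqP; rewrite eq_mulgV1 -in_set1 -[[set 1]]/[1] -regz.
rewrite inE groupM ?groupV //=; apply/cent1P/commute_sym/commgP/conjg_fixP.
move: eqf; rewrite !commgEr !conjVg => /mulIg/invg_inj eqf.
by rewrite conjgM eqf conjgK.
Qed.

Lemma subset_comm_cent1_free (gT : finGroupType) (A : {group gT}) z :
  z \in 'N(A) -> 'C_A[z] = 1 -> A \subset [~: A, <[z]>].
Proof.
move=> nAz regz; rewrite -{1}(comm_cent1_free nAz regz).
by apply/subsetP=> _ /imsetP[x Ax ->]; rewrite mem_commg ?cycle_id.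
Qed.

(** [M] is a minimal normal subgroup of [G], and [N / M] is the minimal normal
    subgroup of a quotient [G / M] with one of the two structures. *)
Definition lifting (gT : finGroupType) (G M N : {group gT}) (p a s : nat) :=
  [/\ [/\ coprime_cods G, metab_cod G p a & (a ^ 2)%N < #|G|],
      [/\ minnormal M G, M \subset G, N <| G & M \subset N],
      [/\ prime s, s != p, s.-abelem (N / M) & ~~ (N \subset M)],
      forall z, z \in G / M -> #[z] = p ->
        'C_(N / M)[z] = 1 /\ (N / M) <*> <[z]> <| G / M
    & 'C_(G / M)(N / M) \subset N / M /\ ~~ (G^`(1) \subset N)].

Section Lift.

Variables (gT : finGroupType) (G M N : {group gT}) (p a s : nat).
Hypothesis liftN : lifting G M N p a s.

Let cG : coprime_cods G. Proof. by case: liftN => [[]]. Qed.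
Let mG : metab_cod G p a. Proof. by case: liftN => [[]]. Qed.
Let a2 : (a ^ 2)%N < #|G|. Proof. by case: liftN => [[]]. Qed.
Let minM : minnormal M G. Proof. by case: liftN => _ []. Qed.
Let sMG : M \subset G. Proof. by case: liftN => _ []. Qed.
Let nsNG : N <| G. Proof. by case: liftN => _ []. Qed.
Let sMN : M \subset N. Proof. by case: liftN => _ []. Qed.
Let s_pr : prime s. Proof. by case: liftN => _ _ []. Qed.
Let sp : s != p. Proof. by case: liftN => _ _ []. Qed.
Let abelNM : s.-abelem (N / M). Proof. by case: liftN => _ _ []. Qed.
Let nsNM : ~~ (N \subset M). Proof. by case: liftN => _ _ []. Qed.
Let regN z : z \in G / M -> #[z] = p ->
  'C_(N / M)[z] = 1 /\ (N / M) <*> <[z]> <| G / M.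
Proof. by case: liftN => _ _ _ regN _; apply: regN. Qed.
Let cNM : 'C_(G / M)(N / M) \subset N / M. Proof. by case: liftN => _ _ _ _ []. Qed.
Let nsG'N : ~~ (G^`(1) \subset N). Proof. by case: liftN => _ _ _ _ []. Qed.
Let p_pr : prime p. Proof. by case: mG. Qed.
Let solG : solvable G := coprime_cods_solvable cG.
Let ntM : M :!=: 1. Proof. by have [/andP[]] := mingroupP minM. Qed.
Let nMG : G \subset 'N(M). Proof. by have [/andP[]] := mingroupP minM. Qed.
Let nsMG : M <| G. Proof. exact/andP. Qed.
Let sNG : N \subset G := normal_sub nsNG.
Let nNG : G \subset 'N(N) := normal_norm nsNG.
Let nMN : N \subset 'N(M) := subset_trans sNG nMG.
Let nsMN : M <| N := normalS sMN sNG nsMG.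
Let nsG'M : ~~ (G^`(1) \subset M).
Proof. by apply: contra nsG'N => /subset_trans; apply. Qed.
Let nsG'1 : ~~ (G^`(1) \subset [1 gT]).
Proof. by apply: contra nsG'N => /subset_trans; apply; apply: sub1G. Qed.
Let sNM : s.-nat #|N : M|.
Proof. by rewrite -card_quotient //; case/and3P: abelNM. Qed.
Let p'NM : ~~ (p %| #|N : M|).
Proof.
by apply/negP => /(prime_dvd_pnat sNM p_pr) eq_ps; move: sp; rewrite eq_ps eqxx.
Qed.
Let N'M : N^`(1) \subset M.
Proof. by rewrite der1_min // (abelem_abelian abelNM). Qed.

Lemma lift_cod (i : Iirr G) :
    M \subset cfker 'chi_i -> ~~ (N \subset cfker 'chi_i) ->
  ~~ (G^`(1) \subset cfker 'chi_i) /\ s %| cod i.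
Proof.
move=> Mi Ni.
have [ni _ _ [q [q_pr qNM qi]]] := p'_section_cod cG mG nsMG nsNG sMN p'NM N'M nsG'M Mi Ni.
by split=> //; rewrite -(prime_dvd_pnat sNM q_pr qNM).
Qed.

Let sNG'M : N \subset G^`(1) <*> M.
Proof. exact: (p'_section_sub_der1 cG mG nsMG nsNG sMN p'NM nsG'M). Qed.

Let abelM : exists2 t : nat, prime t & t.-abelem M.
Proof.
by have [_ _ /is_abelemP[t t_pr abelM]] := minnormal_solvable minM sMG solG; exists t.
Qed.

Lemma lift_der1 : M \subset G^`(1).
Proof.
have [t t_pr abelM'] := abelM; have [tM cMM _] := and3P abelM'.
have tdvd q := @prime_dvd_pnat t q #|M| tM.
have [pM | p'M] := boolP (p %| #|M|); last first.
  have := p'_section_sub_der1 cG mG (normal1 G) nsMG (sub1G M).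
  by rewrite indexg1 p'M nsG'1 joingG1; apply.
have tp := tdvd p p_pr pM.
apply/idPn => nsMG'; have [k /andP[G'k Mk]] := exists_irr_sep (der_normal 1 G) nsMG'.
have dk : deg k = 1%N by apply/eqP; rewrite -deg_nonlinear.
have [i /andP[Mi Ni]] := exists_irr_sep nsMG nsNM.
have [ni _] := lift_cod Mi Ni.
have [l [_ _ lk li]] := twist_irr i dk.
have nl : ~~ (G^`(1) \subset cfker 'chi_l) by rewrite lk.
pose A := (N :&: G^`(1))%G.
have sAG' : A \subset G^`(1) := subsetIr _ _.
have sAN : A \subset N := subsetIl _ _.
have nsAG : A <| G by rewrite normalI ?der_normal.
have Ai : ~~ (A \subset cfker 'chi_i).
  apply: contra Ni => Ai.
  have -> : N :=: M * A.
    rewrite /= (setIC N) group_modl //; apply/esym/setIidPr.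
    by rewrite -norm_joinEr ?(subset_trans (der_sub 1 G)) // joingC.
  by rewrite mul_subG.
have [q [q_pr qA ql]] : exists q, [/\ prime q, q %| #|A : (A :&: M)%G| & q %| cod l].
  apply: (exists_prime_cod nsAG (subsetIl _ _)).
  - rewrite lk; last exact: subset_trans (der_sub 1 A) (subset_trans sAG' G'k).
    exact: subset_trans (dergS 1 sAN) (subset_trans N'M Mi).
  - rewrite lk; last by rewrite subIset ?(subset_trans sAG').
    exact: subset_trans (subsetIr _ _) Mi.
  - by rewrite lk // (subset_trans sAG').
have [r [r_pr rM rl]] : exists r, [/\ prime r, r %| #|M : [1 gT]| & r %| cod l].
  by apply: (exists_prime_cod nsMG); rewrite ?sub1G ?(derG1P cMM) ?sub1G // li.
rewrite indexg1 in rM; rewrite (tdvd r r_pr rM) -tp in rl.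
have [_ /(_ q_pr ql) qp] := metab_p_cod q cG mG nl rl.
case/negP: p'NM; rewrite -qp; apply: dvdn_trans qA _.
by rewrite indexgI -card_quotient ?(subset_trans sAN) // -card_quotient // cardSg ?quotientS.
Qed.

Lemma lift_sub_der1 : N \subset G^`(1).
Proof. by apply: subset_trans sNG'M _; rewrite join_subG subxx lift_der1. Qed.

Lemma lift_nonlinear (A : {group gT}) (i : Iirr G) :
  A \subset N -> ~~ (A \subset cfker 'chi_i) -> ~~ (G^`(1) \subset cfker 'chi_i).
Proof. by move=> sAN; apply/contra/subset_trans/(subset_trans sAN)/lift_sub_der1. Qed.

Let tiM (D : {group gT}) : D <| G -> ~~ (M \subset D) -> D :&: M = 1.
Proof.
by move=> nsDG nsMD; rewrite setIC; apply: minnormal_TI minM sMG nsDG nsMD.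
Qed.

(** A normal subgroup [D] meeting [M] trivially meets [N] nontrivially, as
    otherwise it would centralize [N / M]. *)
Lemma lift_cap (D : {group gT}) :
    D <| G -> D :!=: 1 -> ~~ (M \subset D) ->
  [/\ (D :&: N)%G <| G, D :&: N != 1, s.-group (D :&: N), M :&: (D :&: N) = 1
    & abelian (D :&: N) /\ D :&: N \subset 'C(M)].
Proof.
move=> nsDG ntD nsMD; have [sDG nDG] := andP nsDG; have tiDM := tiM nsDG nsMD.
have nsWG : (D :&: N)%G <| G by rewrite normalI.
have nMW : D :&: N \subset 'N(M) by rewrite subIset // (subset_trans sDG).
have tiMW : M :&: (D :&: N) = 1.
  by apply/trivgP; rewrite /= -tiDM setIA (setIC M) subsetIl.
have cM : D :&: N \subset 'C(M).
  apply/commG1P/trivgP; rewrite -tiMW subsetI commg_subr commg_subl nMW.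
  by rewrite (subset_trans sMG (normal_norm nsWG)).
split=> //.
- apply: contraNneq ntD => tiDN; rewrite -subG1 -tiDN subsetI subxx /=.
  have cDN : D \subset 'C(N).
    apply/commG1P/trivgP; rewrite -tiDN subsetI commg_subr commg_subl.
    by rewrite (subset_trans sDG) // (subset_trans sNG).
  rewrite -(quotientSGK (subset_trans sDG nMG) sMN).
  apply: subset_trans cNM; rewrite subsetI quotientS //=.
  by rewrite quotient_cents.
- rewrite /pgroup (card_isog (quotient_isog nMW tiMW)).
  apply: pnat_dvd sNM; rewrite -card_quotient // cardSg ?quotientS //.
  exact: subsetIr.
- split=> //; apply/derG1P/trivgP; rewrite -tiMW subsetI der_sub andbT.
  by apply: subset_trans N'M; rewrite dergS ?subsetIr.
Qed.

(** Otherwise a character nontrivial on [M] has codegree [a]; its kernel [D] is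
    not trivial, as [a ^ 2 < #|G|], and a character nontrivial on the [p]-group
    [M] and on the [s]-group [D :&: N] has a codegree divisible by [p] and [s]. *)
Lemma lift_p' : ~~ (p %| #|M|).
Proof.
apply/negP => pM; have [t t_pr abelM'] := abelM; have [tM cMM _] := and3P abelM'.
have tp := prime_dvd_pnat tM p_pr pM.
have [|i Mi] := @exists_irr_nontrivial _ G M; first by rewrite subG1.
have ni := lift_nonlinear sMN Mi.
have [r [r_pr rM ri]] : exists r, [/\ prime r, r %| #|M : [1 gT]| & r %| cod i].
  by apply: (exists_prime_cod nsMG); rewrite ?sub1G // (derG1P cMM) sub1G.
rewrite indexg1 in rM; rewrite (prime_dvd_pnat tM r_pr rM) -tp in ri.
have [cod_i _] := metab_p_cod p cG mG ni ri.
have := index_le_sqr_cod i; rewrite cod_i => le_a.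
have ntD : cfker 'chi_i != 1.
  by apply: contraL a2 => /eqP D1; rewrite -leqNgt; move: le_a; rewrite D1 indexg1.
have [nsWG ntW sW tiMW [cWW cMW]] := lift_cap (cfker_normal 'chi_i) ntD Mi.
set W := (cfker_group 'chi_i :&: N)%G in nsWG ntW sW cWW tiMW cMW.
pose A := (M <*> W)%G.
have cAA : abelian A by rewrite abelianY cMM cWW.
have nsAG : A <| G by rewrite normalY.
have sAN : A \subset N by rewrite join_subG sMN subsetIr.
have sdvd : s %| #|W| by have [] := pgroup_pdiv sW ntW.
have A'1 : A^`(1) \subset [1 gT] by rewrite (derG1P cAA).
have [||j [_ pA _ pj sj]] := exists_cod_dvd2 nsAG (normal1 G) (sub1G A) A'1 p_pr s_pr.
- by rewrite indexg1 (dvdn_trans pM) // cardSg ?joing_subl.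
- by rewrite indexg1 (dvdn_trans sdvd) // cardSg ?joing_subr.
have nj := lift_nonlinear sAN (nontrivial_of_dvd (D := cfker_group 'chi_j) p_pr pA).
have [_ /(_ s_pr sj) eq_sp] := metab_p_cod s cG mG nj pj.
by move: sp; rewrite eq_sp eqxx.
Qed.

Let p'N : ~~ (p %| #|N|).
Proof. by rewrite -(Lagrange sMN) Euclid_dvdM // negb_or lift_p'. Qed.

Let order_coset y : y \in G -> #[y] = p -> #[coset M y] = p.
Proof.
move=> Gy oy; have nMy := subsetP nMG y Gy.
have : #[coset M y] %| p by rewrite -oy morph_order.
case/primeP: (p_pr) => _ /[apply] /orP[] /eqP // o1.
case/negP: lift_p'; rewrite -oy order_dvdG //; apply: coset_idr => //.
by apply/eqP; rewrite -order_eq1 o1.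
Qed.

(** Otherwise some character nontrivial on [M] has a kernel [D] of order
    divisible by [p]. An element [z] of order [p] of [D] centralizes
    [M], whence [N = M * W] with [W = D :&: N]; as [N <*> <[z]>] is abelian
    modulo [W], it yields a codegree divisible by [p] and the prime of [M]. *)
Lemma lift_free y : y \in G -> #[y] = p -> 'C_M[y] = 1.
Proof.
move=> Gy oy; apply/eqP/idPn => nregy.
have [t t_pr abelM'] := abelM; have [tM cMM _] := and3P abelM'.
have [_ tM' _] := pgroup_pdiv tM ntM.
have coMp : coprime #|M| p by rewrite coprime_sym prime_coprime // lift_p'.
have [j Mj ndvd] := nfree_exists_deg p_pr nsMG cMM coMp Gy oy nregy.
pose D := (cfker_group 'chi_j)%G; have nsDG : D <| G := cfker_normal _.
have [sDG nDG] := andP nsDG.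
have pD : p %| #|D|.
  apply: contraR ndvd => p'D.
  have p'M1 : ~~ (p %| #|M : [1 gT]|) by rewrite indexg1 lift_p'.
  have M'1 : M^`(1) \subset [1 gT] by rewrite (derG1P cMM).
  have [_ _ p'j _] := p'_section_cod cG mG (normal1 G) nsMG (sub1G M) p'M1 M'1 nsG'1 (sub1G _) Mj.
  have : #|G|`_p %| (cod j * deg j)%N.
    rewrite cod_deg -(Lagrange sDG) partnM ?cardG_gt0 // part_p'nat ?mul1n ?dvdn_part //.
    by rewrite p'natE.
  rewrite Gauss_dvdr // p_part coprimeXl // prime_coprime //.
have ntD : D :!=: 1.
  by apply: contraTneq pD => ->; rewrite cards1 dvdn1; case: (p) p_pr => [|[]].
have tiDM := tiM nsDG Mj.
have [nsWG ntW sW tiMW [cWW cMW]] := lift_cap nsDG ntD Mj.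
set W := (D :&: N)%G in nsWG ntW sW cWW tiMW cMW.
have sWN : W \subset N := subsetIr _ _.
have [z Dz oz] := Cauchy p_pr pD; have Gz := subsetP sDG z Dz.
have oz' := order_coset Gz oz.
have [regz nsNz] := regN (mem_quotient M Gz) oz'.
have sNzW : [~: N, <[z]>] \subset W.
  rewrite subsetI commg_subl cycle_subG (subsetP nNG) // andbT.
  apply: subset_trans (_ : [~: N, D] \subset _); first by rewrite commgS ?cycle_subG.
  by rewrite commg_subr (subset_trans sNG).
have nMz : <[z]> \subset 'N(M) by rewrite cycle_subG (subsetP nMG).
have defN : N :=: M <*> W.
  apply/eqP; rewrite eqEsubset join_subG sMN sWN !andbT.
  rewrite -(quotientSGK nMN (joing_subl _ _)) quotientYidl ?(subset_trans sWN) //.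
  apply: subset_trans (quotientS M sNzW); rewrite quotientR // quotient_cycle ?(subsetP nMG) //.
  by apply: subset_comm_cent1_free; rewrite // (subsetP (quotient_norms M nNG)) ?mem_quotient.
have cNN : abelian N by rewrite defN abelianY cMM cWW.
pose A := (N <*> <[z]>)%G.
have sNA : N \subset A := joing_subl _ _.
have sAG : A \subset G by rewrite join_subG sNG cycle_subG.
have nsAG : A <| G.
  have nsMA : M <| A := normalS (subset_trans sMN sNA) sAG nsMG.
  rewrite -(quotientGK nsMA) -(quotientGK nsMG) cosetpre_normal.
  by rewrite quotientY // quotient_cycle ?(subsetP nMG).
have sWA := subset_trans sWN sNA.
have nWG := normal_norm nsWG; have nWN := subset_trans sNG nWG.
have nWz : <[z]> \subset 'N(W) by rewrite cycle_subG (subsetP nWG).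
have A'W : A^`(1) \subset W.
  rewrite der1_min ?(subset_trans sAG) // quotientY // abelianY.
  rewrite !quotient_abelian ?cycle_abelian //= centsC.
  exact: quotient_cents2r.
have nNz : <[z]> \subset 'N(N) by rewrite cycle_subG (subsetP nNG).
have iAN : #|A : N| = p.
  have tiNz : N :&: <[z]> = 1.
    by rewrite coprime_TIg // -orderE oz coprime_sym prime_coprime.
  by rewrite /= norm_joinEr // indexMg -indexgI setIC tiNz indexg1 -orderE oz.
have iAW : #|A : W| = (p * #|M|)%N.
  rewrite -(Lagrange_index sNA sWN) iAN; congr (_ * _)%N.
  apply/eqP; rewrite -(eqn_pmul2l (cardG_gt0 W)) Lagrange // defN.
  by rewrite norm_joinEr ?(subset_trans sWN) // TI_cardMg // mulnC.
have [||i [Wi tA _ ti pi]] := exists_cod_dvd2 nsAG nsWG sWA A'W t_pr p_pr.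
- by rewrite iAW dvdn_mull.
- by rewrite iAW dvdn_mulr.
have tp : t != p by apply: contraNneq lift_p' => <-.
have ni : ~~ (G^`(1) \subset cfker 'chi_i).
  apply: contra tp => G'i; rewrite -(dvdn_prime2 t_pr p_pr) -iAN.
  apply: dvdn_trans tA (indexgS _ _).
  by rewrite subsetI sNA (subset_trans lift_sub_der1).
have [_ /(_ t_pr ti) eq_tp] := metab_p_cod t cG mG ni pi.
by rewrite eq_tp eqxx in tp.
Qed.

Lemma lift_freeN y : y \in G -> #[y] = p -> 'C_N[y] = 1.
Proof.
move=> Gy oy; have [regy _] := regN (mem_quotient M Gy) (order_coset Gy oy).
apply/trivgP; rewrite /= -(lift_free Gy oy); apply/subsetP=> x /setIP[Nx cyx].
have nMx := subsetP nMN x Nx.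
rewrite inE cyx andbT; apply: coset_idr => //; apply/set1P.
rewrite -[[set 1]]/[1] -regy inE mem_quotient //=.
have := quotient_cent1 M y; move/subsetP; apply.
by rewrite mem_quotient.
Qed.

Lemma lift_p_dvd : p %| #|G|.
Proof.
have ntG' : G^`(1) != 1 by rewrite -subG1.
have [k _ [_ [pk _]]] := metab_exists cG mG ntG'.
apply: dvdn_trans pk _; apply: dvdn_trans (dvdn_indexg G (cfker_group 'chi_k)).
by rewrite -cod_deg dvdn_mulr.
Qed.

(** A Sylow [s]-subgroup [W] of [N] normalized by an element [y] of order [p]
    forms a Frobenius group with [<[y]>] that acts on [[~: M, W]], where neither [W]
    nor [y] has fixed points; so [[~: M, W]] is trivial by [Frobenius_compl_cent]. *)
Lemma lift_abelian : ~~ (s %| #|M|) -> abelian N.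
Proof.
move=> s'M; have [t t_pr abelM'] := abelM; have [tM cMM _] := and3P abelM'.
have [y Gy oy] := Cauchy p_pr lift_p_dvd.
have nNy : <[y]> \subset 'N(N) by rewrite cycle_subG (subsetP nNG).
have coNy : coprime #|N| #|<[y]>| by rewrite [#|<[y]>|]oy coprime_sym prime_coprime.
have solN := solvableS sNG solG.
have [W hallW nWy] := coprime_Hall_exists s nNy coNy solN.
have [sWN sW _] := and3P hallW.
have nMW := subset_trans sWN nMN.
have s'M1 : s^'.-nat #|M| by rewrite p'natE.
have coMW : coprime #|M| #|W|.
  by rewrite coprime_sym (pnat_coprime sW).
have tiMW : M :&: W = 1 by rewrite coprime_TIg.
have defN : N :=: M <*> W.
  apply/eqP; rewrite eq_sym eqEcard join_subG sMN sWN norm_joinEr //.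
  rewrite TI_cardMg // (card_Hall hallW) -(Lagrange sMN) leq_pmul2l ?cardG_gt0 //.
  rewrite partnM ?cardG_gt0 ?indexg_gt0 // (part_p'nat s'M1) mul1n.
  by rewrite part_pnat_id /=.
have cWW : abelian W.
  apply/derG1P/trivgP; rewrite -tiMW subsetI der_sub andbT.
  by apply: subset_trans N'M; rewrite dergS.
have ntW : W :!=: 1.
  by apply: contraNneq nsNM => W1; rewrite defN W1 joingG1.
have regW : 'C_W[y] = 1 by apply/trivgP; rewrite -(lift_freeN Gy oy) setSI.
have frobF : [Frobenius W <*> <[y]> = W ><| <[y]>].
  have defF : W ><| <[y]> = W <*> <[y]>.
    rewrite sdprodEY //; apply: coprime_TIg.
    exact: coprimeSg sWN coNy.
  apply/prime_FrobeniusP => //; first by rewrite [#|_|]oy.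
  by rewrite cent_cycle.
pose L := [~: M, W]%G.
have sLM : L \subset M by rewrite commg_subl.
have nLF : W <*> <[y]> \subset 'N(L).
  rewrite join_subG commg_normr /= normsR // cycle_subG.
  by rewrite (subsetP nMG).
have CLW : 'C_L(W) = 1 by rewrite coprime_abel_cent_TI.
have L1 : L :=: 1.
  apply: (Frobenius_compl_cent (abelianS sLM cMM) frobF nLF _ CLW).
    exact: coprimeSg sLM coMW.
  by apply/trivgP; rewrite /= cent_cycle -(lift_free Gy oy) setSI.
by rewrite defN abelianY cMM cWW /=; apply/commG1P; rewrite commGC.
Qed.

(** If [M] is an [s]-group too, codegrees of characters nontrivial on [N] are all
    divisible by [s], hence equal. *)
Lemma lift_cod_eq : s %| #|M| -> forall i j : Iirr G,
  ~~ (N \subset cfker 'chi_i) -> ~~ (N \subset cfker 'chi_j) -> cod i = cod j.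
Proof.
move=> sM; have [t t_pr abelM'] := abelM; have [tM cMM _] := and3P abelM'.
suffices nls k : ~~ (N \subset cfker 'chi[G]_k) ->
    ~~ (G^`(1) \subset cfker 'chi_k) /\ s %| cod k.
  move=> i j /nls[ni si] /nls[nj sj]; exact: (cod_eq_dvd cG ni nj s_pr si sj).
move=> Nk; have [Mk | Mk] := boolP (M \subset cfker 'chi_k); first exact: lift_cod.
split; first exact: lift_nonlinear sMN Mk.
have [r [r_pr rM rk]] : exists r, [/\ prime r, r %| #|M : [1 gT]| & r %| cod k].
  by apply: (exists_prime_cod nsMG); rewrite ?sub1G // (derG1P cMM) sub1G.
rewrite indexg1 in rM.
have tdvd q := @prime_dvd_pnat t q #|M| tM.
by rewrite (tdvd s s_pr sM) -(tdvd r r_pr rM).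
Qed.

End Lift.

(** ** The quaternion case *)

Lemma Q8_facts (gT : finGroupType) (X : {group gT}) :
    X \isog 'Q_8 ->
  [/\ #|X| = 8, 2.-group X, X^`(1) != 1
    & forall z, z \in X -> #[z] = 2 -> <[z]> <| X].
Proof.
move=> isoX; have oX : #|X| = 8 by rewrite (card_isog isoX) card_Q8.
have [[x y] genX _] := @generators_quaternion _ X 3 isT isoX.
have [_ [_ _ oX' _] [defZ _ invol _ _] _ _] := quaternion_structure (isT : 2 < 3) genX isoX.
split=> //; first by rewrite /pgroup oX.
  by rewrite -cardG_gt1 oX'.
by move=> z Xz oz; rewrite (invol z Xz oz) -defZ center_normal.
Qed.

Lemma typeI_facts (gT : finGroupType) (G N Q : {group gT}) (p a s : nat) :
    coprime_cods G -> metab_cod G p a -> typeI G N Q s ->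
  [/\ [/\ N <| G, N :!=: 1 & G / N \isog 'Q_8], p = 2, a <= 4,
      s != 2 & ~~ (G^`(1) \subset N)].
Proof.
move=> cG mG [s_pr abelN isoQ frobG].
have [defG ntN ntQ _ _] := Frobenius_context frobG.
have [nsNG _ _ nNQ _] := sdprod_context defG.
have isoGN : G / N \isog 'Q_8.
  by apply: isog_trans isoQ; rewrite isog_sym; apply: sdprod_isog.
have [oGN _ ntGN' _] := Q8_facts isoGN.
have nG'N : ~~ (G^`(1) \subset N).
  by rewrite -quotient_sub1 ?(subset_trans (der_sub 1 G)) ?normal_norm // quotient_der
    ?normal_norm // subG1.
have mGN := metab_quotient cG mG nsNG nG'N.
have p_pr : prime p by case: mG.
have [i ni [_ [pi cod_i]]] := metab_exists (coprime_cods_quotient cG nsNG) mGN ntGN'.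
have dvd8 : (a * deg i)%N %| 8.
  by rewrite -cod_i cod_deg -oGN dvdn_indexg.
have p2 : p = 2.
  have : p %| 2 ^ 3 by apply: dvdn_trans pi _; rewrite cod_i (dvdn_trans (dvdn_mulr _ _) dvd8).
  by rewrite Euclid_dvdX // andbT dvdn_prime2 // => /eqP.
split=> //.
  have d2 : 1 < deg i by rewrite ltn_neqAle eq_sym -deg_nonlinear ni deg_gt0.
  rewrite -(leq_pmul2r (isT : 0 < 2)); apply: leq_trans (dvdn_leq (isT : 0 < 8) dvd8).
  by rewrite leq_mul2l d2 orbT.
have [_ sN _] := pgroup_pdiv (abelem_pgroup abelN) ntN.
have coNQ : coprime #|N| #|Q| := Frobenius_coprime frobG.
apply: contraTneq coNQ => s2; rewrite s2 in sN.
have Q2 : 2 %| #|Q| by rewrite (card_isog isoQ) card_Q8.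
by apply/negP => /eqP co; have := dvdn_gcd 2 #|N| #|Q|; rewrite sN Q2 co.
Qed.

(** Every element of [N] is a commutator [[~ u, y]] by [comm_cent1_free], so [y]
    acts on [N] by inversion. *)
Lemma invol_free_abelian (gT : finGroupType) (N : {group gT}) y :
  y \in 'N(N) -> #[y] = 2 -> 'C_N[y] = 1 -> abelian N.
Proof.
move=> nNy oy regy.
have y2 : y * y = 1 by rewrite -(expg_order y) oy.
have inv_y x : x \in N -> x ^ y = x^-1.
  rewrite -{1}(comm_cent1_free nNy regy) => /imsetP[u Nu ->].
  by rewrite commgEl conjMg conjVg -(conjgM u y y) y2 conjg1 [RHS]invMg invgK.
apply/centsP => u Nu v Nv; apply: (can_inj invgK).
by rewrite -inv_y ?groupM // conjMg !inv_y // invMg.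
Qed.

(** The involutions of [G] act without fixed points on the preimage [N], which is
    therefore abelian. It is an [s]-group: otherwise some codegree would be
    divisible by [s] and by another prime of [M], but codegrees divisible by [s] are
    codegrees of [G / M], of order [8 * #|N / M|]. All characters nontrivial on [N]
    have the same degree and codegree, so their kernels have the same order, which
    forces the Frattini subgroup of [N] to be trivial. *)
Lemma typeI_lift (gT : finGroupType) (G M : {group gT}) (p a : nat) :
    coprime_cods G -> metab_cod G p a -> minnormal M G -> M \subset G ->
    ~~ (G^`(1) \subset M) ->
    (exists N Q s, typeI (G / M) N Q s) ->
  exists N Q s, typeI G N Q s.
Proof.
move=> cG mG minM sMG nG'M [Nb [Qb [s tGM]]].
have [/andP[ntM nMG] _] := mingroupP minM.
have nsMG : M <| G by apply/andP.
have cGM := coprime_cods_quotient cG nsMG.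
have mGM := metab_quotient cG mG nsMG nG'M.
have [[nsNb ntNb isoGN] p2 a4 s2 nGM'N] := typeI_facts cGM mGM tGM.
have [s_pr abelNb isoQb frobGM] := tGM.
have [N defN sMN nsNG] := inv_quotientN nsMG nsNb.
have [sNG nNG] := andP nsNG.
have isoGN' : G / N \isog 'Q_8.
  apply: isog_trans isoGN; rewrite isog_sym defN.
  exact: (third_isog sMN nsMG nsNG).
have [oGN sylGN ntGN' cent2] := Q8_facts isoGN'.
have nG'N : ~~ (G^`(1) \subset N).
  by rewrite -quotient_sub1 ?(subset_trans (der_sub 1 G)) // quotient_der // subG1.
have iGN : #|G : N| = 8 by rewrite -card_quotient.
have ntNM : ~~ (N \subset M).
  by apply: contra ntNb => sNM; rewrite defN -subG1 quotient_sub1 // (subset_trans sNG).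
have oG : #|G| = (#|N| * 8)%N by rewrite -(Lagrange sNG) iGN.
have N1 : 1 < #|N|.
  by rewrite cardG_gt1; apply: contraNneq ntNM => ->; apply: sub1G.
have a2 : (a ^ 2)%N < #|G|.
  apply: leq_ltn_trans (_ : 4 ^ 2 < _); first by rewrite leq_exp2r.
  rewrite oG; apply: leq_trans (_ : 3 * 8 <= _); rewrite // leq_pmul2r //.
  rewrite ltn_neqAle N1 andbT eq_sym; apply: contraNneq s2 => N2.
  have [_ ] := pgroup_pdiv (abelem_pgroup abelNb) ntNb.
  have : #|Nb| %| 2 by rewrite defN card_quotient ?(subset_trans sNG) // -N2 dvdn_indexg.
  move=> + sNb _; move/(dvdn_trans sNb); by rewrite dvdn_prime2.
have kerF := FrobeniusWker frobGM.
have [_ _ _ freeN] := Frobenius_kerP kerF.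
have not_s2 z : #[z] = 2 -> z \notin Nb.
  move=> oz; apply: contra s2 => Nz.
  have := mem_p_elt (abelem_pgroup abelNb) Nz; rewrite /p_elt oz pnatE //.
  by rewrite inE eq_sym.
have liftN : lifting G M N p a s.
  split=> //; first by rewrite -defN p2.
    rewrite p2 -defN => z Gz oz; split.
      apply/trivgP/subsetP => x /setIP[Nx czx]; apply/set1P/eqP/idPn => ntx.
      have cxz : z \in 'C_(G / M)[x] by apply/setIP; rewrite cent1C.
      by case/negP: (not_s2 z oz); apply: (subsetP (freeN x _)) cxz; rewrite !inE ntx.
    have nNbG := normal_norm nsNb; have nNz := subsetP nNbG z Gz.
    have nsNbz : Nb <| Nb <*> <[z]>.
      by rewrite /normal joing_subl join_subG normG cycle_subG.
    rewrite -(quotientGK nsNbz) -(quotientGK nsNb) cosetpre_normal.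
    rewrite quotientYidl ?cycle_subG // quotient_cycle //.
    have [_ _ _ cent2b] := Q8_facts isoGN.
    apply: cent2b; first exact: mem_quotient.
    have : #[coset Nb z] %| 2 by rewrite -oz morph_order.
    case/primeP: (isT : prime 2) => _ /[apply] /orP[] /eqP // o1.
    case/negP: (not_s2 z oz); apply: coset_idr => //.
    by apply/eqP; rewrite -order_eq1 o1.
  split=> //; rewrite -defN.
  have [x Nx ntx] := trivgPn _ ntNb.
  apply: subset_trans (freeN x _); last by rewrite !inE ntx.
  by rewrite -cent_cycle setIS // centS // cycle_subG.
have := lift_p' liftN; rewrite p2 => oddM.
have p_pr : prime p by case: mG.
have [y Gy oy] := Cauchy p_pr (lift_p_dvd liftN).
have regN z : z \in G -> #[z] = 2 -> 'C_N[z] = 1.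
  by rewrite -p2 => Gz oz; apply: (lift_freeN liftN).
rewrite p2 in oy; have regy := regN y Gy oy.
have cNN : abelian N := invol_free_abelian (subsetP nNG y Gy) oy regy.
have nsM1 : ~~ (M \subset [1]) by rewrite subG1.
have iNM : #|N : M| = #|Nb| by rewrite defN card_quotient // (subset_trans sNG).
have sNb := abelem_pgroup abelNb; have [_ sdvd _] := pgroup_pdiv sNb ntNb.
have primeM t : prime t -> t %| #|M| -> t = s.
  move=> t_pr tM; have t2 : t != 2 by apply: contraNneq oddM => <-.
  have N'1 : N^`(1) \subset [1 gT] by rewrite (derG1P cNN).
  have [||i [_ si _ sci tci]] := exists_cod_dvd2 nsNG (normal1 G) (sub1G N) N'1 s_pr t_pr.
  - by rewrite indexg1 -(Lagrange sMN) iNM dvdn_mull.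
  - by rewrite indexg1 -(Lagrange sMN) dvdn_mulr.
  have ni := lift_nonlinear liftN (subxx N) (nontrivial_of_dvd (D := cfker_group 'chi_i) s_pr si).
  have [k /andP[Mk Nk]] := exists_irr_sep nsMG ntNM.
  have [nk sk] := lift_cod liftN Mk Nk.
  rewrite (cod_eq_dvd cG ni nk s_pr sci sk) in tci.
  have : t %| #|N : M| * 8.
    rewrite mulnC -iGN Lagrange_index // (dvdn_trans tci) //.
    apply: dvdn_trans (indexgS G Mk); by rewrite -cod_deg dvdn_mulr.
  rewrite Euclid_dvdM // (@Euclid_dvdX 2 3 t) // andbT (@dvdn_prime2 t 2) // (negPf t2) orbF.
  by rewrite iNM; apply: prime_dvd_pnat sNb t_pr.
have sN : s.-group N.
  rewrite /pgroup -(Lagrange sMN) pnatM iNM [X in _ && X]sNb andbT.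
  by apply/pgroupP => t t_pr /(primeM t t_pr) ->; rewrite inE.
have sM : s %| #|M|.
  have M1 : 1 < #|M| by rewrite cardG_gt1.
  by rewrite -{1}(primeM _ (pdiv_prime M1) (pdiv_dvd _)) pdiv_dvd.
have s'2 : 2 \in s^' by rewrite !inE eq_sym.
have coN8 : coprime #|N| #|G : N|.
  by rewrite iGN (pnat_coprime sN) // (@pnatX _ 2 3) pnatE // s'2.
have hallN : Hall G N by rewrite /Hall sNG.
have /splitsP[Q /complP[tiNQ defNQ]] := SchurZassenhaus_split hallN nsNG.
have sQG : Q \subset G by rewrite -defNQ mulG_subr.
have nNQ := subset_trans sQG nNG.
have defG : N ><| Q = G by rewrite sdprodE.
have isoQ : Q \isog 'Q_8 by apply: isog_trans isoGN'; apply: sdprod_isog.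
have [oQ pQ _ _] := Q8_facts isoQ.
have ntN : N :!=: 1 by rewrite -cardG_gt1.
have ntQ : Q :!=: 1 by rewrite -cardG_gt1 oQ.
have frobG : [Frobenius G = N ><| Q].
  apply/(Frobenius_semiregularP defG) => //.
  by apply: semiregular_prime_elts pQ _ => z Qz; apply: regN; rewrite (subsetP sQG).
have kerG := FrobeniusWker frobG.
have deg8 i : ~~ (N \subset cfker 'chi[G]_i) -> deg i = 8.
  move=> Ni; have [t it] := constt_cfRes_irr N i.
  have t0 := constt_Res_nontrivial nsNG Ni it.
  have [k [_ _ ->]] := Clifford_correspondent nsNG it.
  have IN := inertia_Frobenius_ker kerG t0.
  have -> : deg k = 1%N.
    have cII : abelian 'I_G['chi_t] by rewrite IN.
    by apply/eqP; rewrite -deg_nonlinear (derG1P cII) sub1G.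
  by rewrite /= IN iGN.
have index_eq i j : ~~ (N \subset cfker 'chi[G]_i) -> ~~ (N \subset cfker 'chi[G]_j) ->
    #|G : cfker 'chi_i| = #|G : cfker 'chi_j|.
  by move=> Ni Nj; rewrite -!cod_deg !deg8 // (lift_cod_eq liftN sM Ni Nj).
exists N, Q, s; split=> //; rewrite -trivg_Phi //.
apply/idPn => ntPhi; have nsPhi : 'Phi(N) <| G by apply: gFnormal_trans.
have [|i Pi] := @exists_irr_nontrivial _ G 'Phi(N); first by rewrite subG1.
have Ni : ~~ (N \subset cfker 'chi_i) by apply: contra Pi; apply/subset_trans/Phi_sub.
pose D := cfker_group 'chi_i; have nsDG : D <| G := cfker_normal _.
have sDN : D \subset N.
  have odd_D : ~~ (2 %| #|D|).
    apply/negP => D2; have [u Du ou] := Cauchy (isT : prime 2) D2.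
    have Gu := subsetP (normal_sub nsDG) u Du.
    case/negP: Ni; rewrite -(comm_cent1_free (subsetP nNG u Gu) (regN u Gu ou)).
    apply/subsetP=> _ /imsetP[v Nv ->]; rewrite commgEr groupM // memJ_norm ?groupV //.
    by rewrite (subsetP (normal_norm nsDG)) // (subsetP sNG).
  have nND := subset_trans (normal_sub nsDG) nNG.
  rewrite -quotient_sub1 // subG1 trivg_card1 -dvdn1.
  have co : coprime #|D / N| 8.
    apply: (@coprimeXr 3 _ 2); rewrite coprime_sym prime_coprime //.
    by apply: contra odd_D => /dvdn_trans->; rewrite ?dvdn_quotient.
  by rewrite -(eqP co) dvdn_gcd dvdnn -oGN cardSg // quotientS ?normal_sub.
pose E := ('Phi(N) <*> D)%G.
have nsEG : E <| G by rewrite normalY.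
have nsNE : ~~ (N \subset E).
  apply: contra Ni => sNE; have /Phi_nongen : 'Phi(N) <*> D = N.
    by apply/eqP; rewrite eqEsubset sNE join_subG Phi_sub sDN.
  by rewrite genGid => <-.
have [j /andP[Ej Nj]] := exists_irr_sep nsEG nsNE.
have := index_eq i j Ni Nj => eqij.
case/negP: Pi; apply: subset_trans (joing_subl _ D) _.
have sDj : cfker 'chi_i \subset cfker 'chi_j := subset_trans (joing_subr _ _) Ej.
suffices -> : cfker 'chi_i = cfker 'chi_j by [].
apply/eqP; rewrite eqEcard sDj /=.
rewrite -(leq_pmul2r (indexg_gt0 G (cfker_group 'chi_i))) Lagrange ?cfker_sub //.
by rewrite /= eqij Lagrange ?cfker_sub.
Qed.

(** ** The two-step case *)

Lemma typeII_cod_const (gT : finGroupType) (G K H : {group gT}) (p s : nat) :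
    coprime_cods G -> typeII G K H p s ->
  exists c, forall i : Iirr G, ~~ (K \subset cfker 'chi_i) -> cod i = c.
Proof.
move=> cG tG; have ntK := typeII_nt tG.
have [[_ s_pr abelK _] [nsKG _ _ _] _ _ _] := tG.
have [_ sK _] := pgroup_pdiv (abelem_pgroup abelK) ntK.
have sub_nl (i : Iirr G) : ~~ (K \subset cfker 'chi_i) -> ~~ (G^`(1) \subset cfker 'chi_i).
  by apply: contra; apply: subset_trans (typeII_der1 tG).
have s_cod (i : Iirr G) : ~~ (K \subset cfker 'chi_i) -> s %| cod i.
  move=> Ki; have [t it] := constt_cfRes_irr K i.
  rewrite (typeII_cod tG Ki it) (dvdn_trans sK) // cardSg // sub_Inertia //.
  exact: normal_sub.
have [|i Ki] := @exists_irr_nontrivial _ G K; first by rewrite subG1.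
by exists (cod i) => j Kj; apply: (cod_eq_dvd cG) s_pr _ _; rewrite ?sub_nl ?s_cod.
Qed.

Lemma typeII_facts (gT : finGroupType) (G K H : {group gT}) (p a s : nat) :
    coprime_cods G -> metab_cod G p a -> typeII G K H p s ->
  [/\ ~~ (G^`(1) \subset K), p %| #|K|.-1, p < #|K|, s != p & (a ^ 2)%N < #|G|].
Proof.
move=> cG mG tG; have ntK := typeII_nt tG; have sKH := typeII_sub tG.
have [[p_pr s_pr abelK _] [nsKG nsHG iHK prHG] frobHK cycGH cHK] := tG.
have [sKG nKG] := andP nsKG; have sHG := normal_sub nsHG.
have pK1 : p %| #|K|.-1 by rewrite -iHK Frobenius_ker_dvd_ker1.
have K1 : 1 < #|K| by rewrite cardG_gt1.
have ltpK : p < #|K|.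
  by rewrite -(ltn_predK K1) ltnS dvdn_leq // -ltnS (ltn_predK K1).
have nG'K : ~~ (G^`(1) \subset K).
  apply: contraL prHG => G'K; rewrite properE sHG /= negbK.
  rewrite -(quotientSGK nKG sKH); apply: subset_trans cHK; rewrite subsetI subxx.
  have cGK : abelian (G / K) by apply: sub_der1_abelian.
  by apply: subset_trans cGK (centS _); apply: quotientS.
have ntGK' : (G / K)^`(1) != 1.
  by rewrite -quotient_der // -subG1 quotient_sub1 // (subset_trans (der_sub 1 G)).
have mGK := metab_quotient cG mG nsKG nG'K.
have [i ni [_ [pi cod_i]]] := metab_exists (coprime_cods_quotient cG nsKG) mGK ntGK'.
have oGK : #|G / K| = (p * #|G : H|)%N.
  by rewrite card_quotient // -(Lagrange_index sHG sKH) iHK mulnC.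
have ap : a %| p.
  have a_dvd : a %| #|G / K|.
    by rewrite -cod_i (dvdn_trans (dvdn_mulr (deg i) (dvdnn _))) // cod_deg dvdn_indexg.
  rewrite oGK Gauss_dvdl // in a_dvd.
  have [_ pa _ _] := mG; rewrite (pnat_coprime pa) // p'natE // -prime_coprime //.
  by rewrite coprime_sym (typeII_index_coprime tG).
split=> //.
  apply: contraTneq (typeII_coprime tG) => <-; rewrite coprime_sym prime_coprime // negbK.
  by have [] := pgroup_pdiv (abelem_pgroup abelK) ntK.
apply: (@leq_ltn_trans (p ^ 2)); first by rewrite leq_exp2r // dvdn_leq // prime_gt0.
rewrite -(Lagrange sHG) -(Lagrange sKH) iHK -mulnn.
apply: leq_trans (leq_pmulr _ (indexg_gt0 G H)).
by rewrite ltn_pmul2r // prime_gt0.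
Qed.

(** An element that fixes [phi] fixes its restriction to [M], which determines
    [psi]. *)
Lemma inertia_sub_complement (gT : finGroupType) (G N M W : {group gT})
    (phi psi : 'CF(N)) :
    N <| G -> M <| G -> W <| G -> M * W = N ->
    W \subset cfker psi -> {in M, phi =1 psi} ->
  'I_G[phi] \subset 'I_G[psi].
Proof.
move=> nsNG nsMG nsWG defN kerW eqM.
have [[nNG nMG] nWG] := (normal_norm nsNG, normal_norm nsMG, normal_norm nsWG).
apply/subsetP=> g /setIP[Gg Ig]; rewrite inE Gg inE (subsetP nNG) //=.
apply/eqP/cfun_inP => x Nx; have Ig' : g^-1 \in 'I[phi] by rewrite groupV.
rewrite cfConjgE ?(subsetP nNG) //; move: Nx.
rewrite -{1}defN => /mulsgP[m w Mm Ww ->]; rewrite conjMg.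
have gG : g^-1 \in G by rewrite groupV.
have Mmg : m ^ g^-1 \in M by rewrite memJ_norm // (subsetP nMG).
have Wwg : w ^ g^-1 \in W by rewrite memJ_norm // (subsetP nWG).
rewrite (cfkerMr _ (subsetP kerW _ Wwg)) (cfkerMr _ (subsetP kerW _ Ww)) -(eqM _ Mmg) -(eqM _ Mm).
exact: inertia_valJ.
Qed.

Section TypeIILift.

Variables (gT : finGroupType) (G M N : {group gT}) (p a s : nat).
Variable H : {group coset_of M}.
Hypotheses (liftN : lifting G M N p a s) (tGM : typeII (G / M) (N / M) H p s).

Let cG : coprime_cods G. Proof. by case: liftN => [[]]. Qed.
Let mG : metab_cod G p a. Proof. by case: liftN => [[]]. Qed.
Let p_pr : prime p. Proof. by case: mG. Qed.
Let s_pr : prime s. Proof. by case: liftN => _ _ []. Qed.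
Let sp : s != p. Proof. by case: liftN => _ _ []. Qed.
Let minM : minnormal M G. Proof. by case: liftN => _ []. Qed.
Let sMG : M \subset G. Proof. by case: liftN => _ []. Qed.
Let nsNG : N <| G. Proof. by case: liftN => _ []. Qed.
Let sMN : M \subset N. Proof. by case: liftN => _ []. Qed.
Let nsNM : ~~ (N \subset M). Proof. by case: liftN => _ _ []. Qed.
Let abelNM : s.-abelem (N / M). Proof. by case: liftN => _ _ []. Qed.
Let ntM : M :!=: 1. Proof. by have [/andP[]] := mingroupP minM. Qed.
Let nMG : G \subset 'N(M). Proof. by have [/andP[]] := mingroupP minM. Qed.
Let nsMG : M <| G. Proof. exact/andP. Qed.
Let sNG : N \subset G := normal_sub nsNG.
Let nNG : G \subset 'N(N) := normal_norm nsNG.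
Let nMN : N \subset 'N(M) := subset_trans sNG nMG.
Let p'M : ~~ (p %| #|M|) := lift_p' liftN.
Let iNM : #|N : M| = #|N / M|. Proof. by rewrite card_quotient. Qed.

Let abelM : exists2 t : nat, prime t & t.-abelem M.
Proof.
have solG := coprime_cods_solvable cG.
by have [_ _ /is_abelemP[t t_pr abelM]] := minnormal_solvable minM sMG solG; exists t.
Qed.

Let genN (X : {group gT}) : X <| G -> X \subset N -> ~~ (X \subset M) -> M * X = N.
Proof.
move=> nsXG sXN nsXM; apply/eqP; rewrite eqEsubset mul_subG //=.
have [[_ _ _ minNM] _ _ _ _] := tGM; have [_ minN] := mingroupP minNM.
have nMX := subset_trans sXN nMN.
rewrite -quotientSK // (minN (X / M)%G) ?quotientS //.
by rewrite -subG1 quotient_sub1 // nsXM quotient_norms ?normal_norm.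
Qed.

Let tiM (D : {group gT}) : D <| G -> ~~ (M \subset D) -> D :&: M = 1.
Proof.
by move=> nsDG nsMD; rewrite setIC; apply: minnormal_TI minM sMG nsDG nsMD.
Qed.

Let pM1 : p %| #|M|.-1.
Proof.
have [y Gy oy] := Cauchy p_pr (lift_p_dvd liftN).
rewrite -oy regular_norm_dvd_pred ?cycle_subG ?(subsetP nMG) //.
apply: (@semiregular_prime_elts _ _ _ p); first by rewrite /pgroup -orderE oy pnat_id.
move=> z /cycleP[k ->] oz; apply/trivgP.
have Gz : y ^+ k \in G by rewrite groupX.
by rewrite -(lift_freeN liftN Gz oz) setSI.
Qed.

Let ltpM : p < #|M|.
Proof.
have M1 : 1 < #|M| by rewrite cardG_gt1.
by rewrite -(ltn_predK M1) ltnS dvdn_leq // -ltnS (ltn_predK M1).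
Qed.

Let f_dvd : #|G / M : H| %| p.-1 := typeII_index tGM.

Let index_lt x : x %| #|G / M : H| -> x < p.
Proof.
move=> x_f; rewrite -(prednK (prime_gt0 p_pr)) ltnS dvdn_leq //.
  by rewrite -ltnS prednK ?prime_gt0 ?prime_gt1.
exact: dvdn_trans x_f f_dvd.
Qed.

Let iGN : #|G : N| = (p * #|G / M : H|)%N.
Proof.
have [_ [nsK nsH <- _] _ _ _] := tGM.
rewrite mulnC (Lagrange_index (normal_sub nsH) (typeII_sub tGM)).
by rewrite index_quotient_eq // subIset // sMN orbT.
Qed.

(** Otherwise [#|N|] would divide the codegree, so that [#|M|] would divide
    [#|G : N|], which is [p] times a number less than [p < #|M|]. *)
Lemma lift_no_faithful (i k : Iirr G) :
    abelian N -> M \subset cfker 'chi_k -> cod i = cod k ->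
  cfker 'chi_i :&: N != 1.
Proof.
move=> cNN Mk eq_cod; apply/eqP => tiN.
have := @dvd_index_cod _ G N i nsNG; rewrite (derG1P cNN) sub1G setIC tiN indexg1.
move/(_ isT); rewrite eq_cod => N_cod.
have : #|N| %| #|G : M|.
  apply: dvdn_trans N_cod _; apply: dvdn_trans (indexgS G Mk).
  by rewrite -cod_deg dvdn_mulr.
rewrite -(Lagrange_index sNG sMN) -(Lagrange sMN) dvdn_pmul2r ?indexg_gt0 //.
rewrite iGN Gauss_dvdr; last by rewrite coprime_sym prime_coprime.
by move/index_lt; rewrite ltnNge ltnW.
Qed.

Lemma lift_ker : exists2 k : Iirr G, M \subset cfker 'chi_k
  & forall i : Iirr G, ~~ (G^`(1) \subset cfker 'chi_i) -> s %| cod i -> cod i = cod k.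
Proof.
have [k /andP[Mk Nk]] := exists_irr_sep nsMG nsNM.
have [nk sk] := lift_cod liftN Mk Nk.
by exists k => // i ni si; apply: (cod_eq_dvd cG ni nk s_pr si sk).
Qed.

(** If [M] is a [t]-group with [t <> s] then [N] is abelian and has a character
    with a codegree divisible by [s] and [t]; its kernel meets [N] trivially, as
    otherwise its complement [M] in [N] would be an [s']-group. *)
Lemma lift_sM : s %| #|M|.
Proof.
apply/idPn => s'M; have cNN := lift_abelian liftN s'M.
have M1 : 1 < #|M| by rewrite cardG_gt1.
pose t := pdiv #|M|; have t_pr : prime t := pdiv_prime M1.
have tM : t %| #|M| := pdiv_dvd _.
have N'1 : N^`(1) \subset [1 gT] by rewrite (derG1P cNN).
have sNM := abelem_pgroup abelNM.
have ntNM : N / M != 1 by rewrite -subG1 quotient_sub1.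
have [_ sNMd _] := pgroup_pdiv sNM ntNM.
have [||i [_ si ti sci _]] := exists_cod_dvd2 nsNG (normal1 G) (sub1G N) N'1 s_pr t_pr.
- by rewrite indexg1 -(Lagrange sMN) iNM dvdn_mull.
- by rewrite indexg1 -(Lagrange sMN) dvdn_mulr.
have ni := lift_nonlinear liftN (subxx N) (nontrivial_of_dvd (D := cfker_group 'chi_i) s_pr si).
have [k Mk eqk] := lift_ker; have := lift_no_faithful cNN Mk (eqk i ni sci).
have Mi : ~~ (M \subset cfker 'chi_i).
  apply: contra s'M => Mi; have : t %| #|N : M|.
    by apply: dvdn_trans ti (indexgS _ _); rewrite subsetI sMN.
  by rewrite iNM => tNM; rewrite -(prime_dvd_pnat sNM t_pr tNM).
have nsDG : cfker_group 'chi_i <| G := cfker_normal _.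
move=> ntW; have ntD : cfker 'chi_i != 1.
  by apply: contraNneq ntW => ->; rewrite -subG1 subsetIl.
have [nsWG _ _ tiMW _] := lift_cap liftN nsDG ntD Mi.
have defN : M * (cfker 'chi_i :&: N) = N.
  apply: (genN nsWG); first exact: subsetIr.
  by apply: contra ntW => /setIidPr; rewrite tiMW => <-.
case/negP: s'M; suffices <- : #|N : N :&: cfker 'chi_i| = #|M| by [].
apply/eqP; rewrite -(eqn_pmul2l (cardG_gt0 (N :&: cfker_group 'chi_i))) /=.
by rewrite Lagrange ?subsetIl // mulnC setIC -{1}defN -(TI_cardMg tiMW).
Qed.

Let sN : s.-group N.
Proof.
have [t t_pr abelM'] := abelM; have [tM _ _] := and3P abelM'.
have st := prime_dvd_pnat tM s_pr lift_sM.
rewrite /pgroup -(Lagrange sMN) pnatM iNM [X in _ && X](abelem_pgroup abelNM) andbT.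
by rewrite st.
Qed.

Let sMZ : M \subset 'Z(N).
Proof.
have nsZG : 'Z(N) <| G by apply: gFnormal_trans.
apply/idPn => nsMZ; have := meet_center_nil (pgroup_nil sN) (normalS sMN sNG nsMG) ntM.
by rewrite setIC (tiM nsZG nsMZ) eqxx.
Qed.

Let N'M : N^`(1) \subset M.
Proof. by rewrite der1_min // (abelem_abelian abelNM). Qed.

Variable c : nat.
Hypothesis codGM : forall j : Iirr (G / M), ~~ (N / M \subset cfker 'chi_j) -> cod j = c.

Let codN (i : Iirr G) : ~~ (N \subset cfker 'chi_i) -> cod i = c.
Proof.
move=> Ni; have [|j Nj] := @exists_irr_nontrivial _ (G / M)%G (N / M).
  by rewrite subG1 -subG1 quotient_sub1.
rewrite -(codGM Nj) -(cod_mod j nsMG).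
by apply: (lift_cod_eq liftN lift_sM) => //; rewrite sub_ker_mod.
Qed.

Let q := #|N / M|.
Let m := (c %/ q)%N.
Let c_eq : c = (q * m)%N.
Proof. by rewrite mulnC divnK // (typeII_dvd_c tGM codGM). Qed.
Let m_f : m %| #|G / M : H| := typeII_dvd_index tGM codGM.
Let q_gt0 : 0 < q. Proof. exact: cardG_gt0. Qed.
Let c_gt0 : 0 < c.
Proof.
have [|i Mi] := @exists_irr_nontrivial _ G M; first by rewrite subG1.
have Ni : ~~ (N \subset cfker 'chi_i) by apply: contra Mi; apply: subset_trans.
by rewrite -(codN Ni) cod_gt0.
Qed.
Let m_gt0 : 0 < m.
Proof. by move: c_gt0; rewrite c_eq muln_gt0 => /andP[]. Qed.

(** If the characters of [G] nontrivial on [M] are faithful, they all have degree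
    [#|G| %/ c]. The divisibility of induced degrees by this number makes the
    squares of the degrees of characters of [N] nontrivial on [M] at least
    [#|N : M|]. This fails for one that is trivial on all commutators with some [v]
    outside [M], as its center contains [M] and [v]; such a character exists because
    these commutators form a group of order less than [q <= #|M|]. *)
Lemma lift_faithful_false :
  ~ (forall i : Iirr G, ~~ (M \subset cfker 'chi_i) -> cfker 'chi_i = 1).
Proof.
move=> faithM; have solGM : solvable (G / M) := quotient_sol M (coprime_cods_solvable cG).
have [x x_q eq_px] := typeII_count solGM tGM codGM.
have p_gt1 := prime_gt1 p_pr.
have q_gt1 : 1 < q by rewrite cardG_gt1 -subG1 quotient_sub1.
have sq : s.-nat q := abelem_pgroup abelNM.
have sM : s.-nat #|M| := pgroupS sMN sN.
have M1 : 1 < #|M| by rewrite cardG_gt1.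
have x_gt0 : 0 < x by apply: dvdn_gt0 x_q.
have le_qM : q <= #|M| := fix_arith_min s_pr p_gt1 sq q_gt1 x_q eq_px p_pr sp sM M1 pM1.
have ms_x : (m`_s)%N %| x.
  exact: (fix_arith_part s_pr p_gt1 sq q_gt1 x_q eq_px (dvdn_trans m_f f_dvd)).
have x2_q := fix_arith_sqr s_pr p_gt1 sq q_gt1 x_q eq_px.
have [|i1 Mi1] := @exists_irr_nontrivial _ G M; first by rewrite subG1.
pose d := deg i1.
have cd (i : Iirr G) : ~~ (M \subset cfker 'chi_i) -> (c * deg i)%N = #|G|.
  move=> Mi; have Ni : ~~ (N \subset cfker 'chi_i) by apply: contra Mi; apply: subset_trans.
  by have := cod_deg i; rewrite (codN Ni) (faithM _ Mi) indexg1.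
have md : (m * d)%N = (#|M| * #|G : N|)%N.
  apply/eqP; rewrite -(eqn_pmul2l q_gt0) mulnA -c_eq cd // -(Lagrange sNG) -(Lagrange sMN).
  by rewrite iNM mulnA (mulnC #|M|).
have degN (t : Iirr N) : ~~ (M \subset cfker 'chi_t) -> q <= (deg t ^ 2)%N.
  move=> Mt; have dvd_d : d %| (#|G : N| * deg t)%N.
    apply: (dvd_deg_Ind sMN sNG Mt) => i Mi; rewrite -(@dvdn_pmul2l c) //.
    by rewrite !cd.
  have : #|M| %| (m * deg t)%N.
    rewrite -(@dvdn_pmul2r #|G : N|) ?indexg_gt0 // -md -mulnA (mulnC (deg t)).
    by rewrite dvdn_pmul2l.
  move/(partn_dvd s); rewrite muln_gt0 m_gt0 deg_gt0 => /(_ isT).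
  rewrite (part_pnat_id sM) partnM ?deg_gt0 // => dvdM.
  have le_M : #|M| <= (x * deg t)%N.
    rewrite dvdn_leq ?muln_gt0 ?x_gt0 ?deg_gt0 // (dvdn_trans dvdM) //.
    by rewrite dvdn_mul // dvdn_part.
  rewrite -(leq_pmul2l q_gt0); apply: leq_trans (_ : #|M| * #|M| <= _)%N.
    by rewrite leq_mul.
  apply: leq_trans (leq_mul le_M le_M) _.
  by rewrite mulnACA mulnn leq_mul2r x2_q orbT.
have [v Nv Mv] := subsetPn nsNM.
pose L0 := [set [~ v, n] | n in N].
have commZ n : n \in N -> [~ v, n] \in 'Z(N).
  by move=> Nn; rewrite (subsetP sMZ) // (subsetP N'M) // mem_commg.
have L0g : group_set L0.
  apply/group_setP; split; first by apply/imsetP; exists 1; rewrite ?comm1g ?commg1.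
  move=> _ _ /imsetP[n1 Nn1 ->] /imsetP[n2 Nn2 ->]; apply/imsetP.
  exists (n2 * n1); first exact: groupM.
  rewrite commgMJ; congr (_ * _).
  have /centerP[_ cn2] := commZ n2 Nn2.
  by apply/esym/conjg_fixP/commgP/cn2.
pose L := Group L0g.
have sLZ : L \subset 'Z(N) by apply/subsetP=> _ /imsetP[n Nn ->]; apply: commZ.
have index_v (Y : {group gT}) : M \subset Y -> Y \subset N -> v \in Y -> #|N : Y| < q.
  move=> sMY sYN Yv; rewrite -[q]iNM -(Lagrange_index sYN sMY).
  rewrite -{1}[#|N : Y|]muln1 ltn_pmul2l ?indexg_gt0 // indexg_gt1.
  by apply: contra Mv => /subsetP/(_ v Yv).
have cardL : #|L| = #|N : 'C_N[v]|.
  rewrite index_cent1 -[RHS](card_lcoset _ v^-1); congr #|pred_of_set _|.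
  apply/setP=> u; rewrite mem_lcoset invgK.
  apply/imsetP/imsetP => [[n Nn ->] | [n Nn def_u]]; exists n => //.
    by rewrite /= commgEl mulKVg.
  by rewrite /= commgEl -def_u mulKg.
have nsML : ~~ (M \subset L).
  apply/negP => /subset_leq_card; rewrite leqNgt cardL => /negP[].
  apply: leq_trans le_qM; apply: index_v; rewrite ?subsetIl //.
    rewrite subsetI sMN sub_cent1 (subsetP _ v Nv) // centsC.
    by rewrite (subset_trans sMZ) // subsetIr.
  by rewrite inE Nv cent1id.
have [t /andP[Lt Mt]] := exists_irr_sep (sub_center_normal sLZ) nsML.
have := degN t Mt; rewrite leqNgt => /negP[].
apply: leq_ltn_trans (sqr_deg_le_center t) _.
apply: (index_v (cfcenter_group 'chi_t)); rewrite ?cfcenter_sub //=.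
  by apply: subset_trans sMZ _; rewrite -cap_cfcenter_irr; apply: bigcap_inf.
pose D := cfker_group 'chi_t; have nDN : N \subset 'N(D) := normal_norm (cfker_normal _).
rewrite -cycle_subG -(quotientSGK _ (normal_sub (cfker_center_normal 'chi_t))); last first.
  by rewrite cycle_subG (subsetP nDN).
rewrite cfcenter_eq_center quotient_cycle ?(subsetP nDN) // cycle_subG.
rewrite inE mem_quotient //; apply/centP => _ /morphimP[n nDn Nn ->].
apply/commgP; rewrite -morphR ?(subsetP nDN) //=.
by apply/eqP/coset_id/(subsetP Lt)/imsetP; exists n.
Qed.

(** Otherwise [N = M * W] with [W] normal in [G], and [N] is abelian. Let [t] and [u]
    be characters of [N], trivial on [W] and on [M] respectively. The kernel of a
    character of [G] over [t * u] contains a common complement of [M] and [W] in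
    [N], so that [t], [t * u] and [u] have the same inertia group. Varying [u], this
    inertia group is normal in [G], whence it is [N]; but its index [m] over [N] is
    divisible by each prime divisor of [#|G / M : H|]. *)
Lemma lift_faithful (i0 : Iirr G) : ~~ (M \subset cfker 'chi_i0) -> cfker 'chi_i0 = 1.
Proof.
move=> Mi0; apply/eqP/idPn => ntD0.
have [nsWG ntW _ tiMW [cWW cMW]] := lift_cap liftN (cfker_normal 'chi_i0) ntD0 Mi0.
set W := (cfker_group 'chi_i0 :&: N)%G in nsWG ntW tiMW cWW cMW.
have sWN : W \subset N := subsetIr _ _.
have nsWM : ~~ (W \subset M) by apply: contra ntW => /setIidPr; rewrite tiMW => <-.
have defN : M * W = N := genN nsWG sWN nsWM.
have cMM : abelian M by have [t _ /abelem_abelian] := abelM.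
have cNN : abelian N.
  rewrite -defN -norm_joinEr ?(subset_trans sWN) // abelianY cMM cWW.
  exact: cMW.
have [k /andP[Mk Nk]] := exists_irr_sep nsMG nsNM.
have nsWN := normalS sWN sNG nsWG; have nsMN := normalS sMN sNG nsMG.
have nsMW : ~~ (M \subset W).
  by apply: contra ntM => /setIidPl; rewrite tiMW => <-.
have degN (t : Iirr N) : deg t = 1%N.
  by apply/eqP; rewrite -deg_nonlinear (derG1P cNN) sub1G.
have lin_one (t : Iirr N) x : x \in cfker 'chi_t -> 'chi_t x = 1%R.
  by move/cfker1->; rewrite degE degN.
have eq_inertia (t u : Iirr N) : W \subset cfker 'chi_t -> ~~ (M \subset cfker 'chi_t) ->
    M \subset cfker 'chi_u -> ~~ (W \subset cfker 'chi_u) -> 'I_G['chi_t] = 'I_G['chi_u].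
  move=> Wt Mt Mu Wu; have [l [def_l _ _ _]] := twist_irr u (degN t).
  have eqM : {in M, 'chi_l =1 'chi_t}.
    by move=> x Mx; rewrite def_l cfunE (lin_one u) ?mulr1 // (subsetP Mu).
  have eqW : {in W, 'chi_l =1 'chi_u}.
    by move=> x Wx; rewrite def_l cfunE (lin_one t) ?mul1r // (subsetP Wt).
  have kerE (A : {group gT}) (v : Iirr N) : A \subset N -> {in A, 'chi_l =1 'chi_v} ->
      (A \subset cfker 'chi_l) = (A \subset cfker 'chi_v).
    move=> sAN eqA; rewrite !cfkerEirr; apply: eq_in_subset => x Ax.
    by rewrite !inE eqA // !degE !degN.
  have Ml : ~~ (M \subset cfker 'chi_l) by rewrite (kerE M t).
  have Wl : ~~ (W \subset cfker 'chi_l) by rewrite (kerE W u).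
  have [i il] := constt_cfInd_irr l sNG.
  have Mi := constt_Ind_ker sMN sNG il Ml; have Wi := constt_Ind_ker sWN sNG il Wl.
  have Ni : ~~ (N \subset cfker 'chi_i) by apply: contra Mi; apply: subset_trans.
  have codi : cod i = cod k by rewrite !codN.
  have nsDG : cfker_group 'chi_i <| G := cfker_normal _.
  have ntW1 := lift_no_faithful cNN Mk codi.
  have ntD : cfker 'chi_i != 1.
    by apply: contraNneq ntW1 => ->; rewrite -subG1 subsetIl.
  have [nsW1G _ _ tiMW1 _] := lift_cap liftN nsDG ntD Mi.
  set W1 := (cfker_group 'chi_i :&: N)%G in nsW1G ntW1 tiMW1.
  have sW1N : W1 \subset N := subsetIr _ _.
  have W1l : W1 \subset cfker 'chi_l.
    have [//|W1l] := boolP (W1 \subset cfker 'chi_l).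
    by have := constt_Ind_ker sW1N sNG il W1l; rewrite subsetIl.
  have nsW1M : ~~ (W1 \subset M).
    by apply: contra ntW1 => /setIidPr; rewrite tiMW1 => <-.
  have defN1 : M * W1 = N := genN nsW1G sW1N nsW1M.
  have nsWW1 : ~~ (W \subset W1).
    by apply: contra Wl => /subset_trans; apply.
  have defN2 : W * W1 = N.
    have nW1W : W \subset 'N(W1) by rewrite (subset_trans sWN) // (subset_trans sNG) // normal_norm.
    have sMWW1 : M \subset (W <*> W1)%G.
      apply/idPn => nsM; case/negP: nsWW1.
      have nsYG : (W <*> W1)%G <| G by rewrite normalY.
      have tiYM := tiM nsYG nsM.
      have sW1Y : W1 \subset W <*> W1 := joing_subr _ _.
      apply: subset_trans (joing_subl W W1) _.
      suffices: W <*> W1 \subset ((W <*> W1) :&: M) * W1 by rewrite tiYM mul1g.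
      by rewrite (group_modr M sW1Y) defN1 subsetI subxx join_subG sWN.
    apply/eqP; rewrite eqEsubset mul_subG //= -norm_joinEl //.
    by rewrite -defN1 mul_subG ?joing_subr.
  transitivity 'I_G['chi_l].
    apply/eqP; rewrite eqEsubset.
    rewrite (@inertia_sub_complement _ _ _ M W1) //; last by move=> x Mx; rewrite eqM.
    by rewrite (@inertia_sub_complement _ _ _ M W).
  apply/eqP; rewrite eqEsubset (@inertia_sub_complement _ _ _ W M) //; last first.
    by rewrite (normC _) // (subset_trans sWN).
  rewrite (@inertia_sub_complement _ _ _ W W1) // => x Wx.
  by rewrite eqW.
have [t /andP[Wt Mt]] := exists_irr_sep nsWN nsMW.
have inertiaK (b : Iirr (N / M)) : b != 0%R -> 'I_(G / M)['chi_b] = 'I_G['chi_t] / M.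
  move=> nb; rewrite -inertia_mod_quo // -mod_IirrE //.
  suffices -> : 'I_G['chi_(mod_Iirr b)] = 'I_G['chi_t] by [].
  have Mu : M \subset cfker 'chi_(mod_Iirr b) by rewrite mod_IirrE // cfker_mod.
  apply/esym/eq_inertia => //; apply: contra nb => Wu.
  have : M * W \subset cfker 'chi_(mod_Iirr b) by rewrite mul_subG.
  by rewrite defN sub_ker_mod // subGcfker.
have [b nb] := typeII_exists_nontrivial tGM.
pose T := ('I_(G / M)['chi_b])%G; have sTG : T \subset G / M := Inertia_sub _ _.
have [_ [nsKG nsHG _ _] _ _ cHK] := tGM.
have sKH := typeII_sub tGM; have nHG := normal_norm nsHG; have nKG := normal_norm nsKG.
have nTG : G / M \subset 'N(T).
  apply/subsetP=> y Gy; rewrite inE.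
  have nTy : conjg_Iirr b y != 0%R by rewrite conjg_Iirr_eq0.
  have Ny : y \in 'N(N / M) by rewrite (subsetP nKG).
  have : 'I_(G / M)['chi_(conjg_Iirr b y)] = T by rewrite inertiaK // /T /= inertiaK.
  by rewrite conjg_IirrE -conjg_inertia // -{1}(conjGid Gy) -conjIg => ->.
have sTHK : T :&: H \subset N / M := typeII_inertia_cap tGM nb.
have sTK : T \subset N / M.
  have sTH : T \subset H.
    rewrite -(quotientSGK (subset_trans sTG nKG) sKH); apply: subset_trans cHK.
    rewrite subsetI quotientS //=; apply: quotient_cents2r.
    rewrite (subset_trans _ sTHK) // subsetI commg_subl commg_subr.
    by rewrite (subset_trans (normal_sub nsHG)) ?(subset_trans sTG).
  by apply: subset_trans sTHK; rewrite subsetI subxx.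
have le_c : c <= q by rewrite -(typeII_inertia tGM codGM nb) subset_leq_card.
have f_gt1 := typeII_index_gt1 tGM.
have l_pr := pdiv_prime f_gt1.
have := dvdn_leq m_gt0 (typeII_prime_dvd tGM codGM l_pr (pdiv_dvd _)).
rewrite leqNgt => /negP[]; apply: leq_trans (prime_gt1 l_pr).
by rewrite ltnS -(leq_pmul2l q_gt0) muln1 -c_eq.
Qed.

End TypeIILift.

Lemma typeII_lift_false (gT : finGroupType) (G M : {group gT}) (p a : nat) :
    coprime_cods G -> metab_cod G p a -> minnormal M G -> M \subset G ->
    ~~ (G^`(1) \subset M) ->
  ~ (exists K H s, typeII (G / M) K H p s).
Proof.
move=> cG mG minM sMG nG'M [K [H [s tGM]]].
have [/andP[ntM nMG] _] := mingroupP minM.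
have nsMG : M <| G by apply/andP.
have cGM := coprime_cods_quotient cG nsMG.
have mGM := metab_quotient cG mG nsMG nG'M.
have [nGM'K pK1 ltpK sp a2] := typeII_facts cGM mGM tGM.
have [[p_pr s_pr abelK minK] [nsKG nsHG iHK prHG] frobHK cycGH cHK] := tGM.
have [N defN sMN nsNG] := inv_quotientN nsMG nsKG.
have def_K : K = (N / M)%G by apply: val_inj.
have [sNG nNG] := andP nsNG; have sKH := typeII_sub tGM.
have ntK := typeII_nt tGM.
have liftN : lifting G M N p a s.
  split; rewrite -?defN //.
  - split=> //; apply: leq_trans a2 _; exact: leq_quotient.
  - by split=> //; apply: contra ntK => sNM; rewrite defN -subG1 quotient_sub1 // (subset_trans sNG).
  - move=> z Gz oz; have Hz := typeII_p_elt tGM Gz oz.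
    have nKz : z \notin K.
      apply: contraL (typeII_coprime tGM) => Kz.
      by rewrite coprime_sym prime_coprime // negbK -oz order_dvdG.
    split.
      apply/trivgP/subsetP => x /setIP[Kx czx]; apply/set1P/eqP/idPn => ntx.
      case/negP: nKz; apply: (subsetP (typeII_free tGM Kx ntx)).
      by apply/setIP; rewrite cent1C.
    suffices -> : K <*> <[z]> = H by [].
    apply/eqP; rewrite eqEcard join_subG sKH cycle_subG Hz /=.
    have nKz' : <[z]> \subset 'N(K) by rewrite cycle_subG (subsetP (normal_norm nsKG)).
    rewrite norm_joinEr // TI_cardMg; last first.
      by rewrite coprime_TIg // -orderE oz; apply: typeII_coprime tGM.
    by rewrite -orderE oz -iHK Lagrange.
  - split.
      by apply: subset_trans (typeII_cent tGM); rewrite defN.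
    apply: contra nGM'K => G'N; rewrite defN -quotient_der // quotientS //.
have [c codGM] := typeII_cod_const cGM tGM.
rewrite def_K in tGM codGM.
by case: (lift_faithful_false liftN tGM codGM) => i; apply: (lift_faithful liftN tGM codGM).
Qed.

(** ** Induction on the order *)

(** Either [minimal_two_cods] applies, or a proper quotient by a minimal normal
    subgroup still has two codegrees and one of the two structures. *)
Theorem two_cods_structure (gT : finGroupType) (G : {group gT}) (p a : nat) :
    coprime_cods G -> metab_cod G p a ->
    (exists2 i : Iirr G, ~~ (G^`(1) \subset cfker 'chi_i) & cod i != a) ->
  (exists N Q s, typeI G N Q s) \/ (exists K H s, typeII G K H p s).
Proof.
have [n] := ubnP #|G|; elim: n => // n IHn in gT G * => leGn cG mG two.
case: (pickP [pred M : {group gT} | [&& M <| G, M :!=: 1 &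
    [exists j : Iirr G, [&& ~~ (G^`(1) \subset cfker 'chi_j),
       M \subset cfker 'chi_j & cod j != a]]]]); last first.
  move=> none; apply: (minimal_two_cods cG mG two) => M nsMG ntM j nj Mj.
  apply/eqP/negPn/negP => cod_j; have := none M; rewrite /= nsMG ntM /=.
  by move/existsP=> []; exists j; rewrite nj Mj.
move=> M0 /and3P[nsM0G ntM0 /existsP[j /and3P[nj M0j cod_j]]].
have [M minM sMM0] := minnormal_exists ntM0 (normal_norm nsM0G).
have sMG := subset_trans sMM0 (normal_sub nsM0G).
have Mj := subset_trans sMM0 M0j.
have [/andP[ntM nMG] _] := mingroupP minM; have nsMG : M <| G by apply/andP.
have nG'M : ~~ (G^`(1) \subset M) by apply: contra nj => /subset_trans; apply.
have cGM := coprime_cods_quotient cG nsMG.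
have mGM := metab_quotient cG mG nsMG nG'M.
have [k def_j] := mod_Iirr_quo nsMG Mj.
have [||tI|tII] := IHn _ (G / M)%G _ cGM mGM.
- exact: leq_trans (ltn_quotient ntM sMG) _.
- by exists k; rewrite ?nonlinear_mod // -?(cod_mod k nsMG) -def_j.
- by left; apply: (typeI_lift cG mG minM sMG nG'M tI).
- by case: (typeII_lift_false cG mG minM sMG nG'M tII).
Qed.

(** * The 2-Frobenius series and the theorem *)

Lemma typeII_two_Frobenius (gT : finGroupType) (G K H : {group gT}) (p s : nat) :
  typeII G K H p s -> two_Frobenius_series G H K.
Proof.
move=> tG; have sKH := typeII_sub tG; have ntK := typeII_nt tG.
have [[p_pr _ _ _] [nsKG nsHG iHK prHG] frobHK _ cHK] := tG.
have [ntKH prKH _ _] := Frobenius_kerP frobHK.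
have nKH := subset_trans (normal_sub nsHG) (normal_norm nsKG).
have oHb : #|H / K| = p by rewrite card_quotient.
split=> //; first by split; rewrite // proper1G.
apply/Frobenius_kerP; split.
- by rewrite -cardG_gt1 oHb prime_gt1.
- have [sHG nsGH] := andP prHG.
  by rewrite properE quotientS //= quotientSGK ?normal_norm.
- exact: quotient_normal.
move=> x /setD1P[ntx Hx]; apply: subset_trans cHK; rewrite -cent_cycle setIS // centS //.
apply: prime_meetG; first by rewrite oHb.
by apply/trivgPn; exists x; rewrite // inE Hx cycle_id.
Qed.

(** An element [z] of the complement acts without fixed points, so that [K] consists
    of commutators with [z]. *)
Lemma Frobenius_ker_sub_der1 (gT : finGroupType) (G K H : {group gT}) :
  [Frobenius G = K ><| H] -> K \subset G^`(1).
Proof.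
move=> frobG; have [defG _ ntH _ _] := Frobenius_context frobG.
have [nsKG sHG _ nKH _] := sdprod_context defG.
have [z Hz ntz] := trivgPn _ ntH.
have regz : 'C_K[z] = 1 by apply: (Frobenius_reg_ker frobG); rewrite !inE ntz.
apply: subset_trans (subset_comm_cent1_free (subsetP nKH z Hz) regz) _.
by apply: commgSS (normal_sub nsKG) _; rewrite cycle_subG (subsetP sHG).
Qed.

(** If [K1] were larger than [K] it would contain [H]; then [J] would act without
    fixed points on [K] and on a Sylow [p]-subgroup of [H] that it normalizes,
    contrary to [Frobenius_compl_cent]. Then [H1] is [H], as [G / H] is cyclic and a
    Frobenius kernel is contained in the derived subgroup. *)
Lemma typeII_series_unique (gT : finGroupType) (G K H K1 H1 J : {group gT})
    (R : {group coset_of K1}) (p s : nat) :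
    solvable G -> typeII G K H p s -> K1 <| G -> H1 <| G -> K1 \proper H1 ->
    [Frobenius G / K1 = (H1 / K1) ><| R] -> [Frobenius H1 = K1 ><| J] ->
  K1 = K /\ H1 = H.
Proof.
move=> solG tG nsK1G nsH1G prK1 frobR frobJ.
have [[p_pr s_pr abelK minK] [nsKG nsHG iHK prHG] frobHK cycGH cHK] := tG.
have sKH := typeII_sub tG; have ntK := typeII_nt tG.
have cKK := abelem_abelian abelK; have nKG := normal_norm nsKG.
have [defH1 ntK1 ntJ _ _] := Frobenius_context frobJ.
have [_ sJH1 _ nK1J _] := sdprod_context defH1.
have sJG := subset_trans sJH1 (normal_sub nsH1G).
have sKK1 : K \subset K1 := typeII_monolith tG nsK1G ntK1.
have pHK : prime #|H : K| by rewrite iHK.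
have nKH := subset_trans (normal_sub nsHG) nKG.
have sub_or (X : {group gT}) : X <| G -> K \subset X -> ~~ (H \subset X) -> X = K.
  move=> nsXG sKX nsHX; apply/val_inj/eqP; rewrite eq_sym eqEsubset sKX /=.
  have sXHK : X :&: H \subset K.
    apply: contraR nsHX => nsXHK.
    have nKXH : X :&: H \subset 'N(K) by rewrite subIset // (subset_trans (normal_sub nsXG)).
    rewrite -(quotientSGK nKH sKX); apply: prime_meetG.
      by rewrite card_quotient.
    apply: contraNneq nsXHK => tiXH; rewrite -quotient_sub1 // -tiXH.
    by rewrite subsetI !quotientS ?subsetIl ?subsetIr.
  have sXH : X \subset H.
    rewrite -(quotientSGK (subset_trans (normal_sub nsXG) nKG) sKH).
    apply: subset_trans cHK; rewrite subsetI (quotientS _ (normal_sub nsXG)).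
    apply: quotient_cents2r; rewrite (subset_trans _ sXHK) // commg_subI //.
      by rewrite subsetI subxx (subset_trans (normal_sub nsXG)) // normal_norm.
    by rewrite subsetI subxx (subset_trans (normal_sub nsHG)) // normal_norm.
  by apply: subset_trans sXHK; rewrite subsetI subxx.
have defK1 : K1 = K.
  apply: sub_or => //; apply/negP => sHK1.
  have coHJ : coprime #|H| #|J| := coprimeSg sHK1 (Frobenius_coprime frobJ).
  have nHJ : J \subset 'N(H) := subset_trans sJG (normal_norm nsHG).
  have solH := solvableS (normal_sub nsHG) solG.
  have [P hallP nPJ] := coprime_Hall_exists p nHJ coHJ solH.
  have [sPH pP _] := and3P hallP.
  have ntP : P :!=: 1.
    rewrite -cardG_gt1 (card_Hall hallP) p_part_gt1 mem_primes p_pr cardG_gt0 /=.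
    by rewrite -(Lagrange sKH) iHK dvdn_mull.
  have coKP : coprime #|K| #|P|.
    rewrite coprime_sym (pnat_coprime pP) // p'natE // -prime_coprime // coprime_sym.
    exact: typeII_coprime tG.
  have frobP := Frobenius_subl ntP (subset_trans sPH sHK1) nPJ frobJ.
  case/eqP: ntK; apply: (Frobenius_compl_cent cKK frobP).
  - by rewrite join_subG (subset_trans sPH nKH) (subset_trans sJG nKG).
  - exact: coKP.
  - apply/trivgP/subsetP => x /setIP[Kx cPx]; apply/set1P/eqP/idPn => ntx.
    have sPK : P \subset K.
      apply: subset_trans (typeII_free tG Kx ntx).
      by rewrite subsetI sPH sub_cent1.
    by case/negP: ntP; rewrite -subG1 -(coprime_TIg coKP) subsetI sPK subxx.
  - by apply/trivgP; rewrite -(Frobenius_trivg_cent frobJ) setSI.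
subst K1; split=> //.
have sH1H : H1 \subset H.
  rewrite -(quotientSGK (subset_trans (normal_sub nsH1G) nKG) sKH).
  apply: subset_trans (Frobenius_ker_sub_der1 frobR) _.
  rewrite -quotient_der // quotientS // der1_min ?normal_norm //.
  exact: cyclic_abelian.
apply/val_inj/eqP; rewrite eqEsubset sH1H /=.
apply/idPn => nsHH1; have := sub_or H1 nsH1G (proper_sub prK1) nsHH1 => H1K.
by move: prK1; rewrite H1K properxx.
Qed.

Lemma mem_cod_set (gT : finGroupType) (G N : {group gT}) (a : nat) :
  reflect (exists2 i : Iirr G, ~~ (N \subset cfker 'chi_i) & a = cod i) (a \in cod_set G N).
Proof.
rewrite /cod_set mem_undup; apply: (iffP imageP) => -[i]; rewrite ?inE => Ni ->; exists i => //.
by rewrite inE.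
Qed.

(** [R0] is the subgroup of order [c %/ #|K|] of the cyclic group [R], where [c] is
    the common order of the centralizers of the nontrivial elements of [K]. *)
Lemma typeII_conclusion (gT : finGroupType) (G K H J : {group gT})
    (R : {group coset_of K}) (p s : nat) :
    coprime_cods G -> typeII G K H p s ->
    [Frobenius G / K = (H / K) ><| R] -> [Frobenius H = K ><| J] ->
  [/\ cyclic R, exists p : nat, prime p /\ J \isog Zp p,
      min_normal_subgroup K G /\
        (forall M : {group gT}, min_normal_subgroup M G -> M = K)
    & exists R0 : {group coset_of K},
        [/\ R0 \subset R, \pi(R0) =i \pi(R)
          & forall x : gT, x \in K -> x <> 1 ->
              K \subset 'C_G[x] /\ 'C_G[x] / K \isog R0]].
Proof.
move=> cG tG frobR frobJ; have [c codG] := typeII_cod_const cG tG.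
have [[p_pr _ abelK minK] [nsKG nsHG iHK _] _ cycGH _] := tG.
have sKH := typeII_sub tG; have [sKG nKG] := andP nsKG.
have [defGK _ _ _ _] := Frobenius_context frobR.
have [defH _ _ _ _] := Frobenius_context frobJ.
have isoR : R \isog G / H.
  apply: isog_trans (sdprod_isog defGK) _; exact: third_isog.
have cycR : cyclic R by rewrite (isog_cyclic isoR).
have oR : #|R| = #|G : H| by rewrite (card_isog isoR) card_quotient ?normal_norm.
have oJ : #|J| = p by rewrite -iHK -divgS // -(sdprod_card defH) mulKn ?cardG_gt0.
pose m := (c %/ #|K|)%N; have m_f : m %| #|R|.
  by rewrite oR (typeII_dvd_index tG codG).
have c_eq : c = (#|K| * m)%N by rewrite mulnC divnK // (typeII_dvd_c tG codG).
split=> //.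
- have cycJ : cyclic J by rewrite prime_cyclic ?oJ.
  have oZp : #|Zp p| = p by rewrite card_Zp ?prime_gt0.
  by exists p; split=> //; rewrite isog_cyclic_card // oJ oZp eqxx andbT prime_cyclic ?oZp.
- split=> [|M /andP[sMG minM]]; first exact/andP.
  have [/andP[ntM nMG] minM'] := mingroupP minM.
  have sKM : K \subset M by apply: (typeII_monolith tG) ntM; apply/andP.
  by apply/esym/val_inj/minM' => //; have [] := mingroupP minK.
have [g defR] := cyclicP cycR; have [k def_k] := dvdnP m_f.
pose R0 := <[g ^+ k]>%G.
have k_R : k %| #[g] by rewrite -[#[g]]/(#|<[g]>|) -defR def_k dvdn_mulr.
have R_gt0 : 0 < #|R| := cardG_gt0 R.
have [k_gt0 m_gt0] : 0 < k /\ 0 < m by move: R_gt0; rewrite def_k muln_gt0 => /andP.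
have oR0 : #|<[g ^+ k]>| = m.
  by rewrite -orderE orderXdiv // -[#[g]]/(#|<[g]>|) -defR def_k mulKn.
exists R0; split=> [||x Kx /eqP ntx].
- by rewrite defR cycleX.
- move=> l; rewrite /= !mem_primes oR0 R_gt0 m_gt0 /=; apply: andb_id2l => l_pr.
  apply/idP/idP => [l_m | l_R]; first exact: dvdn_trans l_m m_f.
  by apply: (typeII_prime_dvd tG codG l_pr); rewrite -oR.
have sKC : K \subset 'C_G[x].
  by rewrite subsetI sKG sub_cent1 (subsetP (abelem_abelian abelK)).
split=> //; have sCG : 'C_G[x] \subset G := subsetIl _ _.
have sCHK : 'C_G[x] :&: H \subset K.
  by rewrite setIAC (setIidPr (normal_sub nsHG)) (typeII_free tG).
have [cycC _] := typeII_cyclic_quo tG sKC sCG sCHK.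
rewrite isog_cyclic_card // cycle_cyclic oR0 card_quotient ?(subset_trans sCG) //=.
by rewrite -divgS // (typeII_cent_card tG codG Kx ntx) eqxx.
Qed.

Theorem theoremA (gT : finGroupType) (G : {group gT})
    (hcard : (1 < size (cod_set G G^`(1)))%N)
    (hcoprime : forall a b : nat, a \in cod_set G G^`(1) ->
       b \in cod_set G G^`(1) -> a <> b -> coprime a b) :
  ([Frobenius G] /\
     exists (p k : nat) (V Q : {group gT}),
       [/\ prime p, V \isog [set: 'rV['F_p]_k], Q \isog 'Q_8 & V ><| Q = G])
  \/
  (two_Frobenius G /\
     forall (H K J : {group gT}) (R : {group coset_of K}),
       [/\ [1 gT] \proper K, K \proper H & H \proper G] ->
       K <| G -> H <| G ->
       [Frobenius G / K = (H / K) ><| R] ->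
       [Frobenius H = K ><| J] ->
       [/\ cyclic R,
           exists p : nat, prime p /\ J \isog Zp p,
           min_normal_subgroup K G /\
             (forall M : {group gT}, min_normal_subgroup M G -> M = K)
         & exists R0 : {group coset_of K},
             [/\ R0 \subset R, \pi(R0) =i \pi(R)
               & forall x : gT, x \in K -> x <> 1 ->
                   K \subset 'C_G[x] /\ 'C_G[x] / K \isog R0]]).
Proof.
have cG : coprime_cods G.
  move=> i j ni nj; apply: hcoprime; first by apply/mem_cod_set; exists i.
  by apply/mem_cod_set; exists j.
have ntG' : G^`(1) != 1.
  case def_c: (cod_set G G^`(1)) hcard => [|b l] // _.
  have /mem_cod_set[i ni _] : b \in cod_set G G^`(1) by rewrite def_c mem_head.
  by apply: contraNneq ni => /= G'1; rewrite G'1 sub1G.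
have [p [a mG]] := metabelian_cod cG ntG'.
have two : exists2 i : Iirr G, ~~ (G^`(1) \subset cfker 'chi_i) & cod i != a.
  case: (pickP [pred i : Iirr G | ~~ (G^`(1) \subset cfker 'chi_i) && (cod i != a)]).
    by move=> i /andP[]; exists i.
  move=> none; have := hcard; rewrite ltnNge => /negP[].
  have uniq_c : uniq (cod_set G G^`(1)) := undup_uniq _.
  apply: (@uniq_leq_size _ _ [:: a] uniq_c) => b /mem_cod_set[i ni ->].
  by rewrite inE; have := none i; rewrite /= ni => /negbFE.
have [[N [Q [s [s_pr abelN isoQ frobG]]]] | [K [H [s tG]]]] := two_cods_structure cG mG two.
  left; split; first exact: FrobeniusW frobG.
  have [defG _ _ _ _] := Frobenius_context frobG.
  exists s, (logn s #|N|), N, Q; split=> //.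
  rewrite (isog_abelem_card _ abelN) mx_Fp_abelem //= cardsT card_mx mul1n card_Fp //.
  by rewrite -card_pgroup // abelem_pgroup.
right; split; first by exists H, K; apply: typeII_two_Frobenius tG.
move=> H1 K1 J R [_ prK1 _] nsK1G nsH1G frobR frobJ.
have [defK1 defH1] := typeII_series_unique (coprime_cods_solvable cG) tG nsK1G nsH1G prK1 frobR frobJ.
by subst K1 H1; apply: (typeII_conclusion cG tG frobR frobJ).
Qed.
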